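(* Let $(X_1,Y_1),\dots,(X_n,Y_n)$ be i.i.d. random vectors with bivariate distribution function $H$ on $\mathbb R^2$ and marginals $F(x)=H(x,\infty)$, $G(y)=H(\infty,y)$. Let $C(u,v)=H(F^{-1}(u),G^{-1}(v))$ and $C_n(u,v)=H_n(F_n^{-1}(u),G_n^{-1}(v))$, where $H_n,F_n,G_n$ are the joint and marginal empirical distribution functions. Let $0<p<q<1$ be fixed. Suppose that $F$ and $G$ are continuously differentiable on the intervals $[F^{-1}(p)-\varepsilon,F^{-1}(q)+\varepsilon]$ and $[G^{-1}(p)-\varepsilon,G^{-1}(q)+\varepsilon]$ with strictly positive derivatives $f$ and $g$, respectively, for some $\varepsilon>0$. Furthermore, assume that $\partial H/\partial x$ and $\partial H/\partial y$ exist and are continuous on the product of these intervals. Then $\left\{\frac{\sqrt n}{a(n)}(C_n-C),n\ge1\right\}$ satisfies the large deviation principle in $l_\infty([p,q]^2)$ with speed $a^2(n)$ and rate function $$I^C(\phi)=\inf\{I_H(\alpha);\ \Phi'_H(\alpha)=\phi\},$$ where, for $u,v\in[p,q]$, $$\Phi'_H(\alpha)(u,v)=\alpha(F^{-1}(u),G^{-1}(v))-\frac{\partial H}{\partial x}(F^{-1}(u),G^{-1}(v))\frac{\alpha(F^{-1}(u),\infty)}{f(F^{-1}(u))}-\frac{\partial H}{\partial y}(F^{-1}(u),G^{-1}(v))\frac{\alpha(\infty,G^{-1}(v))}{g(G^{-1}(v))}.$$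
   Context: $a(n)$ is a sequence of positive reals with $a(n)\to\infty$ and $a(n)/\sqrt n\to0$. For a distribution function $K$ on $\mathbb R$, $K^{-1}(p)=\inf\{x;K(x)\ge p\}$. $l_\infty([p,q]^2)$ is the space of bounded real functions on $[p,q]^2$ with the sup-norm; on $l_\infty(T)$ the paper considers the $\sigma$-field generated by all balls and all coordinates. For $\alpha:\mathbb R^2\to\mathbb R$, $$I_H(\alpha)=\inf\left\{\frac12\int\gamma^2\,dH;\ \gamma:\mathbb R^2\to\mathbb R\text{ measurable},\ \int\gamma\,dH=0,\ \alpha(s,t)=\int\gamma(x,y)1_{\{x\le s,y\le t\}}H(dx,dy)\ \text{for each }(s,t)\in\mathbb R^2\right\}$$ (equivalently, $\frac12\int(\alpha'_H)^2dH$ with $\alpha'_H=d\alpha/dH$ if $\alpha\ll H$ and $\lim_{|s|,|t|\to\infty}|\alpha(s,t)|=0$, and $+\infty$ otherwise). When $I_H(\alpha)<\infty$, $\alpha(s,\infty)=\lim_{t\to\infty}\alpha(s,t)$ and $\alpha(\infty,t)=\lim_{s\to\infty}\alpha(s,t)$. Large deviation principle (LDP). For (not necessarily measurable) maps $W_n$ from a probability space to a metric space $\mathcal X$, positive $\lambda(n)\to\infty$, and $I:\mathcal X\to[0,\infty]$ with $\{I\le L\}$ compact for all $L\in\mathbb R$ (rate function), $\{W_n\}$ satisfies the LDP with speed $\lambda(n)$ and rate function $I$ if $\liminf_n\frac1{\lambda(n)}\log P_*(W_n\in U)\ge-\inf_UI$ for every open measurable $U$ and $\limsup_n\frac1{\lambda(n)}\log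 P^*(W_n\in K)\le-\inf_KI$ for every closed measurable $K$, where $P_*$, $P^*$ are inner and outer probability ($\inf\emptyset=+\infty$, $\log 0=-\infty$). *)

(* Defs.v *)
From HB Require Import structures.
From mathcomp Require Import all_boot all_order all_algebra finmap.
From mathcomp Require Import all_classical all_reals all_analysis.

Set Implicit Arguments.
Unset Strict Implicit.
Unset Printing Implicit Defensive.

Import Order.TTheory GRing.Theory Num.Theory.
Import numFieldNormedType.Exports.

Local Open Scope classical_set_scope.
Local Open Scope ring_scope.

Section linf_type.
Context (R : realType) (T : Type).

Definition bounded_funs : {pred T -> R^o} := mem (bounded_fun : set (T -> R^o)).

Record linf := Linf { linf_fun :> T -> R^o; linfP : linf_fun \in bounded_funs }.

HB.instance Definition _ := [isSub for linf_fun].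
HB.instance Definition _ := [Choice of linf by <:].

Lemma bounded_funsE (f : T -> R^o) :
  (f \in bounded_funs) <-> exists M, forall t, `|f t| <= M.
Proof.
rewrite inE; split=> [[M [_ fM]]|[M fM]].
  by exists (M + 1) => t; apply: fM; rewrite ?ltrDl.
by exists M; split; [exact: num_real|move=> N MN t _; exact: le_trans (fM t) (ltW MN)].
Qed.

Lemma bounded_funs_submod_closed : submod_closed bounded_funs.
Proof.
split; first by apply/bounded_funsE; exists 0 => t /=; rewrite normr0.
move=> c f g /bounded_funsE[M fM] /bounded_funsE[N gN].
apply/bounded_funsE; exists (`|c| * M + N) => t.
rewrite (le_trans (ler_normD _ _))// lerD//.
by rewrite [X in `|X|](_ : _ = c * f t)// normrM ler_wpM2l.
Qed.

HB.instance Definition _ :=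
  GRing.isSubmodClosed.Build _ _ bounded_funs bounded_funs_submod_closed.
HB.instance Definition _ := [SubChoice_isSubLmodule of linf by <:].

Definition sup_norm (f : linf) : R := sup (range (fun t => `|f t|)).

Lemma sup_norm_ub (f : linf) t : `|f t| <= sup_norm f.
Proof.
have [M fM] := (bounded_funsE f).1 (linfP f).
by apply: ub_le_sup; [exists M => _ [s _ <-]; exact: fM|exists t].
Qed.

Lemma sup_norm_le (f : linf) M : 0 <= M -> (forall t, `|f t| <= M) -> sup_norm f <= M.
Proof.
move=> M0 fM; rewrite /sup_norm.
have [->|/set0P f0] := eqVneq (range (fun t => `|f t|)) set0; first by rewrite sup0.
by apply: ge_sup => // _ [s _ <-]; exact: fM.
Qed.

Lemma sup_norm_ge0 (f : linf) : 0 <= sup_norm f.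
Proof.
have [f0|/set0P[_ [t _ _]]] := eqVneq (range (fun t => `|f t|)) set0.
  by rewrite /sup_norm f0 sup0.
exact: le_trans (sup_norm_ub f t).
Qed.

Lemma sup_normD (f g : linf) : sup_norm (f + g) <= sup_norm f + sup_norm g.
Proof.
apply: sup_norm_le => [|t]; first by rewrite addr_ge0 ?sup_norm_ge0.
by rewrite (le_trans (ler_normD _ _))// lerD// sup_norm_ub.
Qed.

Lemma sup_normZ_le (c : R) (f : linf) : sup_norm (c *: f) <= `|c| * sup_norm f.
Proof.
apply: sup_norm_le => [|t]; first by rewrite mulr_ge0 ?sup_norm_ge0.
by rewrite [X in `|X|](_ : _ = c * f t)// normrM ler_wpM2l// sup_norm_ub.
Qed.

Lemma sup_normZ (c : R) (f : linf) : sup_norm (c *: f) = `|c| * sup_norm f.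
Proof.
apply/eqP; rewrite eq_le sup_normZ_le/=.
have [->|c0] := eqVneq c 0; first by rewrite normr0 mul0r sup_norm_ge0.
have := sup_normZ_le c^-1 (c *: f).
rewrite scalerA mulVf// scale1r normfV => fc.
by rewrite -ler_pdivlMl ?normr_gt0.
Qed.

Lemma sup_norm0_eq0 (f : linf) : sup_norm f = 0 -> f = 0.
Proof.
move=> f0; apply/val_inj/funext => t /=; apply/eqP.
by rewrite -normr_le0 -f0 sup_norm_ub.
Qed.

HB.instance Definition _ :=
  @Lmodule_isNormed.Build R linf sup_norm sup_normD sup_normZ sup_norm0_eq0.

Let linf_mdist (f g : linf) : R := `|f - g|.

Let linf_mdist_ge0 f g : 0 <= linf_mdist f g.
Proof. exact: normr_ge0. Qed.

Let linf_mdist_positivity f g : linf_mdist f g = 0 -> f = g.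
Proof. by move/normr0_eq0/eqP; rewrite subr_eq0 => /eqP. Qed.

Let linf_ballEmdist f e : ball f e = [set g | linf_mdist f g < e].
Proof. by rewrite -ball_normE. Qed.

HB.instance Definition _ := @PseudoMetric_isMetric.Build R linf
  linf_mdist linf_mdist_ge0 linf_mdist_positivity linf_ballEmdist.

Definition balls : set (set linf) := [set B | exists f e, 0 < e /\ B = ball f e].

Definition coordinates : set (set linf) :=
  [set A | exists t (B : set R), measurable B /\ A = [set f : linf | B (f t)]].

Definition ball_coordinate_sigma_field : set (set linf) :=
  <<s balls `|` coordinates >>.

End linf_type.

Section large_deviations.
Context (R : realType).
Local Open Scope ereal_scope.

Definition outer_prob d (Om : measurableType d) (P : probability Om R)
  (A : set Om) : \bar R := ereal_inf [set P B | B in [set B | measurable B /\ A `<=` B]].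

Definition inner_prob d (Om : measurableType d) (P : probability Om R)
  (A : set Om) : \bar R := ereal_sup [set P B | B in [set B | measurable B /\ B `<=` A]].

Definition rate_function (X : metricType R) (I : X -> \bar R) :=
  (forall x, 0 <= I x) /\ (forall L : R, compact [set x | I x <= L%:E]).

(* [S] is the sigma-field on [X] with respect to which the open and closed sets
   are required to be measurable; it may be smaller than the Borel one. *)
Definition LDP d (Om : measurableType d) (P : probability Om R)
    (X : metricType R) (S : set (set X)) (W : nat -> Om -> X)
    (lambda : nat -> R) (I : X -> \bar R) :=
  [/\ rate_function I,
      forall U, open U -> S U ->
        - ereal_inf (I @` U) <=
        limn_einf (fun n => (lambda n)^-1%:E * lne (inner_prob P (W n @^-1` U)))
    & forall K, closed K -> S K ->
        limn_esup (fun n => (lambda n)^-1%:E * lne (outer_prob P (W n @^-1` K)))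
        <= - ereal_inf (I @` K)].

End large_deviations.

Section distribution_functions.
Context (R : realType).
Implicit Types (K : R -> R) (H alpha : R -> R -> R).

Definition quadrant (s t : R) : set (R * R) := `]-oo, s] `*` `]-oo, t].

Definition joint_cdf (mu : probability (R * R)%type R) (s t : R) : R :=
  fine (mu (quadrant s t)).

(* s |-> alpha(s, oo) and t |-> alpha(oo, t) *)
Definition marginal1 alpha (s : R) : R := lim (alpha s t @[t --> +oo]).
Definition marginal2 alpha (t : R) : R := lim (alpha s t @[s --> +oo]).

Definition quantile K (p : R) : R := inf [set x | p <= K x].

Definition empirical_joint_cdf (n : nat) (z : nat -> R * R) (s t : R) : R :=
  n%:R^-1 * \sum_(i < n) \1_(quadrant s t) (z i).

Definition empirical_cdf (n : nat) (x : nat -> R) (s : R) : R :=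
  n%:R^-1 * \sum_(i < n) \1_`]-oo, s] (x i).

Definition copula H (F G : R -> R) (u v : R) : R := H (quantile F u) (quantile G v).

Definition square (p q : R) : set (R * R) := `[p, q] `*` `[p, q].

Lemma copula_bounded H F G (A : set (R * R)) (H01 : forall s t, 0 <= H s t <= 1) :
  (fun uv : A => copula H F G (val uv).1 (val uv).2) \in @bounded_funs R A.
Proof.
apply/bounded_funsE; exists 1 => uv.
by have /andP[H0 H1] := H01 (quantile F (val uv).1) (quantile G (val uv).2);
  rewrite ger0_norm.
Qed.

Lemma joint_cdf01 mu s t : 0 <= joint_cdf mu s t <= 1.
Proof.
have mQ : measurable (quadrant s t) by apply: measurableX.
rewrite /joint_cdf fine_ge0//= -lee_fin fineK ?probability_le1//.
exact: fin_num_measure.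
Qed.

Lemma empirical_joint_cdf01 n z s t : 0 <= empirical_joint_cdf n z s t <= 1.
Proof.
rewrite /empirical_joint_cdf; apply/andP; split.
  by rewrite mulr_ge0// sumr_ge0.
have [->|n0] := eqVneq n 0%N; first by rewrite invr0 mul0r.
rewrite ler_pdivrMl ?ltr0n ?lt0n// mulr1.
have -> : n%:R = \sum_(i < n) (1 : R).
  by rewrite sumr_const card_ord.
by apply: ler_sum => i _; rewrite indicE lern1 leq_b1.
Qed.

Definition true_copula (p q : R) (mu : probability (R * R)%type R) :
    linf R (square p q) :=
  let H := joint_cdf mu in
  Linf (copula_bounded (marginal1 H) (marginal2 H) (square p q) (joint_cdf01 mu)).

Definition empirical_copula (p q : R) (n : nat) (z : nat -> R * R) :
    linf R (square p q) :=
  Linf (copula_bounded (empirical_cdf n (fst \o z)) (empirical_cdf n (snd \o z))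
          (square p q) (empirical_joint_cdf01 n z)).

Definition partial1 H (x y : R) : R := derive1 (fun x' => H x' y) x.
Definition partial2 H (x y : R) : R := derive1 (fun y' => H x y') y.

End distribution_functions.

Section iid.
Context (R : realType) d d' (Om : measurableType d) (T : measurableType d').
Implicit Types (P : probability Om R) (Z : nat -> Om -> T).

Definition mutually_independent P Z :=
  forall (J : {fset nat}) (A : nat -> set T),
    (forall i, i \in J -> measurable (A i)) ->
    P (\bigcap_(i in [set` J]) Z i @^-1` A i) =
    (\prod_(i <- J) P (Z i @^-1` A i))%E.

Definition iid_with_law P Z (mu : probability T R) :=
  mutually_independent P Z /\
  forall i (A : set T), measurable A -> P (Z i @^-1` A) = mu A.

End iid.

Section rate.
Context (R : realType) (mu : probability (R * R)%type R).
Implicit Type alpha : R -> R -> R.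

(* Integrability of gamma is only what makes the first integral meaningful: it
   is automatic whenever the integral of gamma ^+ 2 is finite. *)
Definition is_density (alpha : R -> R -> R) (gamma : R * R -> R) :=
  [/\ measurable_fun setT gamma,
      mu.-integrable setT (EFin \o gamma),
      (\int[mu]_z (gamma z)%:E = 0)%E
    & forall s t,
        (alpha s t)%:E = (\int[mu]_(z in quadrant s t) (gamma z)%:E)%E].

Definition I_H alpha : \bar R :=
  ereal_inf [set (2^-1%:E * \int[mu]_z ((gamma z) ^+ 2)%:E)%E
            | gamma in [set gamma | is_density alpha gamma]].

Definition Phi' alpha (u v : R) : R :=
  let H := joint_cdf mu in
  let F := marginal1 H in
  let G := marginal2 H in
  let x := quantile F u in
  let y := quantile G v in
  alpha x y - partial1 H x y * (marginal1 alpha x / derive1 F x)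
            - partial2 H x y * (marginal2 alpha y / derive1 G y).

(* When [I_H alpha = +oo] the limits in [marginal1 alpha], [marginal2 alpha] may
   not exist, but such alpha do not affect the infimum. *)
Definition I_C (p q : R) (phi : linf R (square p q)) : \bar R :=
  ereal_inf [set I_H alpha | alpha in
    [set alpha | forall uv : square p q, Phi' alpha (val uv).1 (val uv).2 = phi uv]].

End rate.

(* Main.v *)
Require Import Defs.
From HB Require Import structures.
From mathcomp Require Import all_boot all_order all_algebra finmap.
From mathcomp Require Import all_classical all_reals all_analysis.
From mathcomp Require Import measurable_realfun.
From mathcomp Require Import ring lra zify.

Set Implicit Arguments.
Unset Strict Implicit.
Unset Printing Implicit Defensive.

Import Order.TTheory GRing.Theory Num.Theory.
Import numFieldNormedType.Exports.

Local Open Scope classical_set_scope.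
Local Open Scope ring_scope.

(** Write [dev] for the deviation of the empirical measure from its mean,
rescaled by sqrt n / a(n) and seen as a function of a set, and [ip] for the
inner product of L2(mu). The theorem is the delta method applied to [dev]:
a moderate deviation principle for [dev] with rate half the squared L2 norm of
the limiting density, followed by a linearization of the copula.

Finitely many sets. The values of [dev] on finitely many sets [S j] are
normalized sums of independent variables over a finite alphabet, the code of an
observation being the list of the sets that contain it. A Chernoff bound in the
direction that solves the regularized normal equations gives [stat_upper], an
exponential change of measure gives [stat_lower]. A point of the ellipsoid
defined by the covariance matrix is the vector of integrals over the [S j] of a
centred density in the span of the indicators, and this density has the least
norm among those with the same integrals. So, up to probabilities of exponential
order a(n)^2 * l, the vector of deviations matches the integrals of a density of
squared norm at most 2 * l ([deviations_upper]), and it matches those of a given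
density [gam] with probability of order at least exp (- a(n)^2 * |gam|^2 / 2)
([deviations_lower]).

Equicontinuity. On quadrants and half-planes whose corner lies in a compact box,
[dev] has a small modulus of continuity outside events of probability
exp (- a(n)^2 * M), where M is arbitrary ([modulus_tail], by chaining a Bernstein
bound over grids). A finite grid of sets therefore controls the whole process.
The primitives of the densities of bounded norm are equicontinuous by the
Cauchy-Schwarz inequality ([ip_orthant_oscillation]), so they are controlled by
the same grid.

Linearization. When [dev] is bounded and equicontinuous, the empirical quantile
differs from the true one by - (Fn - F) / f, up to a remainder that is small
compared with a(n) / sqrt n ([quantile_linearization]), and a first-order
expansion of H turns the normalized copula difference into the derivative of the
copula map applied to [dev] ([copula_process_linearized]). Altogether, once [dev]
matches a density [gam] on a suitable finite family of sets, the normalized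
copula difference is uniformly close to the image of [gam]
([copula_process_near_Phi]).

Rate function. The rate of [phi] is the infimum of half the squared norm over the
centred densities with image [phi]. Level sets are totally bounded because
finitely many integrals determine the image approximately on a ball of L2, and
they are complete because a sequence of almost shortest densities is Cauchy by the
parallelogram law ([minimal_norm_limit], [compact_level_set]). A closed set that
misses a level set lies at a positive distance from it, and the two bounds of the
principle follow from the finite-dimensional ones ([limsup_bound],
[liminf_bound]). *)

(** * Exponential inequalities *)

Section exponential.
Context (R : realType).
Implicit Types x : R.

(** From the cubic term on, the terms of the series are at most [`|x| ^+ 3]
times those of a geometric series, because (m + 3)! >= 2 ^ (m + 1). *)
Lemma expR_taylor2 x : `|x| <= 1 ->
  `|expR x - (1 + x + x ^+ 2 / 2)| <= `|x| ^+ 3.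
Proof.
move=> x1.
have E m : `|series (exp_coeff x) (m + 3)%N - (1 + x + x ^+ 2 / 2)|
    <= `|x| ^+ 3 * (1 - (2 ^+ m)^-1).
  elim: m => [|m IH].
    rewrite /series/= !big_nat_recr//= big_geq// /exp_coeff/= !factS fact0.
    rewrite expr0 expr1 !expr0 invr1 subrr mulr0 normr_le0 subr_eq0.
    apply/eqP; rewrite (_ : 2 * (1 * 1) = 2)%N// ?muln1 ?invr1 ?expr2 add0r !mulr1.
    by [].
  rewrite addSn /series/= big_nat_recr//= addrAC.
  rewrite (le_trans (ler_normD _ _))//.
  have -> : `|x| ^+ 3 * (1 - (2 ^+ m.+1)^-1) =
    `|x| ^+ 3 * (1 - (2 ^+ m)^-1) + `|x| ^+ 3 * (2 ^+ m.+1)^-1.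
    by rewrite (exprS 2 m); field; rewrite expf_neq0.
  apply: lerD; first exact: IH.
  rewrite /exp_coeff/= normrM normrX normfV.
  apply: ler_pM => //.
    by rewrite addnC exprD ler_piMr// exprn_ile1.
  rewrite lef_pV2 ?posrE ?normr_gt0 ?pnatr_eq0 -?lt0n ?fact_gt0//.
  rewrite ger0_norm// -natrX ler_nat.
  elim: m {IH} => // m IH; rewrite addSn factS expnS.
  by apply: leq_mul => //; rewrite addn3.
have cv : `|series (exp_coeff x) (m + 3)%N - (1 + x + x ^+ 2 / 2)| @[m --> \oo]
    --> `|expR x - (1 + x + x ^+ 2 / 2)|.
  apply: cvg_norm; apply: cvgB; last exact: cvg_cst.
  by rewrite (cvg_shiftn 3 (series (exp_coeff x))); exact: is_cvg_series_exp_coeff.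
apply: (cvgr_to_le cv); apply: nearW => m.
apply: le_trans (E m) _.
by rewrite ler_piMr// gerBl.
Qed.

Lemma expR_le_quad x : `|x| <= 1 -> expR x <= 1 + x + 2 * x ^+ 2.
Proof.
move=> x1; have := expR_taylor2 x1; rewrite ler_norml => /andP[_].
have x2 : `|x| ^+ 3 <= x ^+ 2 by rewrite exprS real_normK ?num_real// ler_piMl// sqr_ge0.
have := sqr_ge0 x; lra.
Qed.

Lemma exprn_expR_le x n : 0 <= 1 + x -> (1 + x) ^+ n <= expR (n%:R * x).
Proof.
by move=> x0; rewrite expRM_natl; apply: lerXn2r; rewrite ?nnegrE ?expR_ge0 ?expR_ge1Dx.
Qed.

(** For x <= 1, exp (x ^ 2 - x) >= 1 - x + x ^ 2 and
(1 + x) (1 - x + x ^ 2) = 1 + x ^ 3 >= 1; for x > 1 the exponent is negative. *)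
Lemma expR_le_exprn x n : 0 <= x -> expR (n%:R * (x - x ^+ 2)) <= (1 + x) ^+ n.
Proof.
move=> x0; rewrite expRM_natl; apply: lerXn2r; rewrite ?nnegrE ?expR_ge0 ?addr_ge0//.
have [x1|x1] := leP x 1.
- have := expR_ge1Dx (x ^+ 2 - x).
  have -> : x - x ^+ 2 = - (x ^+ 2 - x) by ring.
  rewrite expRN => h.
  have p1 : 0 < 1 + (x ^+ 2 - x) by nra.
  rewrite (le_trans (_ : _ <= (1 + (x ^+ 2 - x))^-1))//.
    by rewrite lef_pV2// ?posrE ?expR_gt0.
  rewrite -[_^-1]mul1r ler_pdivrMr//. nra.
- rewrite (le_trans (_ : _ <= 1)) ?lerDl//.
  by rewrite expR_le1; nra.
Qed.

End exponential.

(** * Range of moderate deviations *)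

Section moderate_regime.
Context (R : realType).

(** Properties that hold as soon as [a] is large and [a / sqrt n] is small.
Letting [n] and [a] vary freely, instead of following a sequence, makes these
properties a filter. *)
Definition moderately (Q : nat -> R -> Prop) :=
  exists2 t0 : R, 0 < t0 & exists2 A0 : R, 0 < A0 &
  forall n a, (0 < n)%N -> A0 <= a -> a / Num.sqrt n%:R <= t0 -> Q n a.

Lemma moderately_and Q Q' : moderately Q -> moderately Q' ->
  moderately (fun n a => Q n a /\ Q' n a).
Proof.
move=> [t0 t00 [A0 A00 H]] [t1 t10 [A1 A10 H']].
exists (Num.min t0 t1); first by rewrite lt_min t00.
exists (Num.max A0 A1); first by rewrite lt_max A00.
move=> n a n0; rewrite ge_max le_min => /andP[h1 h2] /andP[h3 h4].
by split; [exact: H|exact: H'].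
Qed.

Lemma moderately_imp Q Q' :
  (forall n (a : R), (0 < n)%N -> 0 < a -> Q n a -> Q' n a) -> moderately Q -> moderately Q'.
Proof.
move=> QQ' [t0 t00 [A0 A00 H]]; exists t0 => //; exists A0 => // n a n0 Aa at0.
by apply: QQ' => //; [exact: lt_le_trans Aa|exact: H].
Qed.

Lemma moderately_forall (I : finType) (Q : I -> nat -> R -> Prop) :
  (forall i, moderately (Q i)) -> moderately (fun n a => forall i, Q i n a).
Proof.
move=> H; suff : moderately (fun n a => forall i, i \in enum I -> Q i n a).
  by apply: moderately_imp => n a _ _ HQ i; apply: HQ; rewrite mem_enum.
elim: (enum I) => [|i s IH]; first by exists 1 => //; exists 1.
apply: moderately_imp (moderately_and (H i) IH) => n a _ _ [Qi Qs] j.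
by rewrite inE => /orP[/eqP->|]; [|exact: Qs].
Qed.

Lemma moderately_small t1 : 0 < t1 -> moderately (fun n a => a / Num.sqrt n%:R <= t1).
Proof. by move=> t10; exists t1 => //; exists 1. Qed.

Lemma moderately_expR C c : 0 < c -> moderately (fun _ a => C <= expR (a ^+ 2 * c)).
Proof.
move=> c0; exists 1 => //; exists (Num.max 1 (C / c)); first by rewrite lt_max ltr01.
move=> n a _; rewrite ge_max => /andP[a1 aC] _.
have {}aC : C <= a * c by rewrite -ler_pdivrMr.
rewrite (le_trans _ (expR_ge1Dx _))// (le_trans aC)// (le_trans (_ : _ <= a ^+ 2 * c))//.
  by rewrite ler_wpM2r ?(ltW c0)// expr2 ler_peMr// (le_trans _ a1).
by rewrite lerDr.
Qed.

(** Giving up one unit of the rate pays for any constant factor, in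
particular for finitely many exceptional events. *)
Lemma moderately_absorb C M :
  moderately (fun _ a => C * expR (- (a ^+ 2 * (M + 1))) <= expR (- (a ^+ 2 * M))).
Proof.
apply: moderately_imp (moderately_expR C ltr01) => n a _ _ h.
have -> : - (a ^+ 2 * M) = a ^+ 2 * 1 + - (a ^+ 2 * (M + 1)) by ring.
by rewrite expRD ler_wpM2r ?expR_ge0.
Qed.

Lemma moderately_near (a : nat -> R) (Q : nat -> R -> Prop) :
  a n @[n --> \oo] --> +oo -> a n / Num.sqrt n%:R @[n --> \oo] --> (0 : R) ->
  moderately Q -> \forall n \near \oo, Q n (a n).
Proof.
move=> ay at0 [t0 t00 [A0 A00 H]].
have h1 : \forall n \near \oo, (A0 <= a n) by move/cvgryPge : ay; exact.
have h2 : \forall n \near \oo, (a n / Num.sqrt n%:R <= t0).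
  move/cvgrPdist_le : at0 => /(_ _ t00); apply: filterS => n.
  by rewrite sub0r normrN => /(le_trans (ler_norm _)).
have h3 : \forall n \near \oo, (0 < n)%N by exists 1%N.
near=> n; apply: H.
- by near: n.
- by near: n.
- by near: n.
Unshelve. all: by end_near.
Qed.

End moderate_regime.

(** * Exceptional events *)

Section exceptional_events.
Context (R : realType) d (Om : measurableType d) (P : probability Om R).

(** A measurable event of probability at most [b] contains the failure of [G],
whose outer probability is thus at most [b]. *)
Definition holds_but (b : R) (G : Om -> Prop) :=
  exists B, [/\ measurable B, (P B <= b%:E)%E & forall w, ~ B w -> G w].

Lemma holds_but_weak b c (G G' : Om -> Prop) : b <= c -> (forall w, G w -> G' w) ->
  holds_but b G -> holds_but c G'.
Proof.
move=> bc GG' [B [mB PB BG]]; exists B; split => //.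
  by rewrite (le_trans PB)// lee_fin.
by move=> w /BG /GG'.
Qed.

Lemma holds_but_true b (G : Om -> Prop) : 0 <= b -> (forall w, G w) -> holds_but b G.
Proof. by move=> b0 HG; exists set0; split => //; rewrite measure0 lee_fin. Qed.

Lemma holds_but_and b c (G G' : Om -> Prop) :
  holds_but b G -> holds_but c G' -> holds_but (b + c) (fun w => G w /\ G' w).
Proof.
move=> [B [mB PB BG]] [C [mC PC CG]]; exists (B `|` C); split.
- exact: measurableU.
- by rewrite (le_trans (measureU2 _ mB mC))// EFinD leeD.
- by move=> w nBC; split; [apply: BG|apply: CG] => ?; apply: nBC; [left|right].
Qed.

Lemma holds_but_forall n (b : 'I_n -> R) (G : 'I_n -> Om -> Prop) :
  (forall i, holds_but (b i) (G i)) ->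
  holds_but (\sum_i b i) (fun w => forall i, G i w).
Proof.
elim: n b G => [|n IH] b G H.
  by rewrite big_ord0; apply: holds_but_true => // w [].
rewrite big_ord_recr/=.
have H1 := IH (fun i => b (widen_ord (leqnSn n) i)) _ (fun i => H (widen_ord (leqnSn n) i)).
apply: holds_but_weak (holds_but_and H1 (H ord_max)) => // w [Gw Gn] i.
have [in_|ni] := ltnP i n; last first.
  by rewrite (_ : i = ord_max)//; apply/val_inj/eqP; rewrite eqn_leq ni -ltnS ltn_ord.
by have := Gw (Ordinal in_); congr (G _ w); exact: val_inj.
Qed.

Lemma holds_but_forall_fin (I : finType) (b : R) (G : I -> Om -> Prop) :
  (forall i, holds_but b (G i)) ->
  holds_but (#|I|%:R * b) (fun w => forall i, G i w).
Proof.
move=> H; have := holds_but_forall (fun i : 'I_#|I| => H (enum_val i)).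
rewrite sumr_const card_ord; apply: holds_but_weak; first by rewrite mulr_natl.
move=> w Gw i.
by have := Gw (enum_rank i); rewrite enum_rankK.
Qed.

End exceptional_events.

(** * Chernoff bounds on a finite alphabet *)

Section finite_product.
Context (R : realType) (K : finType) (pi : K -> R).
Hypothesis pi_ge0 : forall x, 0 <= pi x.
Hypothesis pi_sum1 : \sum_x pi x = 1.

(** The law of [n] independent draws from [pi]. *)
Definition weight n (k : {ffun 'I_n -> K}) : R := \prod_i pi (k i).

Lemma weight_ge0 n (k : {ffun 'I_n -> K}) : 0 <= weight k.
Proof. by apply: prodr_ge0. Qed.

Lemma sum_weight_prod n (phi : K -> R) :
  \sum_(k : {ffun 'I_n -> K}) weight k * \prod_i phi (k i) =
  (\sum_x pi x * phi x) ^+ n.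
Proof.
have -> : (\sum_x pi x * phi x) ^+ n = \prod_(i < n) \sum_x pi x * phi x.
  by rewrite prodr_const card_ord.
rewrite bigA_distr_bigA/=.
by apply: eq_bigr => k _; rewrite /weight -big_split.
Qed.

Lemma sum_weight_expR n (h : K -> R) (r : R) :
  \sum_(k : {ffun 'I_n -> K}) weight k * expR (r * \sum_i h (k i)) =
  (\sum_x pi x * expR (r * h x)) ^+ n.
Proof.
rewrite -sum_weight_prod; apply: eq_bigr => k _; congr *%R.
by rewrite mulr_sumr expR_sum.
Qed.

(** On [Q] the factor [expR (r * (\sum_i h (k i) - b))] is at least 1, and
its mean over independent draws is a power. *)
Lemma chernoff n (h : K -> R) (r b : R) (Q : pred {ffun 'I_n -> K}) :
  0 <= r -> (forall k, Q k -> b <= \sum_i h (k i)) ->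
  \sum_(k | Q k) weight k <= expR (- (r * b)) * (\sum_x pi x * expR (r * h x)) ^+ n.
Proof.
move=> r0 Qb; rewrite -sum_weight_expR mulr_sumr big_mkcond/=.
apply: ler_sum => k _; rewrite mulrCA -expRD.
case: ifPn => Qk; last by rewrite mulr_ge0 ?weight_ge0 ?expR_ge0.
rewrite ler_peMr ?weight_ge0// -expR0 ler_expR addrC subr_ge0.
by rewrite ler_wpM2l// Qb.
Qed.

Lemma mgf_ge1 (h : K -> R) (t : R) : \sum_x pi x * h x = 0 ->
  1 <= \sum_x pi x * expR (t * h x).
Proof.
move=> h0; rewrite (le_trans (_ : _ <= \sum_x pi x * (1 + t * h x)))//.
  under eq_bigr do rewrite mulrDr mulr1 mulrCA.
  by rewrite big_split/= pi_sum1 -mulr_sumr h0 mulr0 addr0.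
by apply: ler_sum => x _; rewrite ler_wpM2l// expR_ge1Dx.
Qed.

Lemma mgf_taylor (h : K -> R) (B t : R) : \sum_x pi x * h x = 0 ->
  (forall x, `|h x| <= B) -> 0 <= t -> t * B <= 1 ->
  `|\sum_x pi x * expR (t * h x) - (1 + t ^+ 2 * ((\sum_x pi x * h x ^+ 2) / 2))|
    <= (t * B) ^+ 3.
Proof.
move=> h0 hB t0 tB.
have -> : 1 + t ^+ 2 * ((\sum_x pi x * h x ^+ 2) / 2) =
    \sum_x pi x * (1 + t * h x + (t * h x) ^+ 2 / 2).
  have E : \sum_x (pi x + t * (pi x * h x) + t ^+ 2 * ((pi x * h x ^+ 2) / 2)) =
      1 + t ^+ 2 * ((\sum_x pi x * h x ^+ 2) / 2).
    by rewrite !big_split/= pi_sum1 -!mulr_sumr h0 mulr0 addr0 -mulr_suml.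
  by rewrite -E; apply: eq_bigr => x _; field.
rewrite -sumrB (le_trans (ler_norm_sum _ _ _))//.
rewrite (_ : (t * B) ^+ 3 = \sum_x pi x * (t * B) ^+ 3); last first.
  by rewrite -mulr_suml pi_sum1 mul1r.
apply: ler_sum => x _.
have B0 : 0 <= B by rewrite (le_trans _ (hB x)).
have hx : `|t * h x| <= t * B by rewrite normrM (ger0_norm t0) ler_wpM2l.
rewrite -mulrBr normrM (ger0_norm (pi_ge0 x)) ler_wpM2l//.
rewrite (le_trans (expR_taylor2 _)) ?(le_trans hx)//.
by rewrite lerXn2r// ?nnegrE ?mulr_ge0.
Qed.

(** The logarithm of the moment generating function of a centred variable is
t ^ 2 * variance / 2 + O(t ^ 3). The threshold on [t] is uniform in [n], since both
bounds on the function are of the form 1 + x and pass to powers through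
[exprn_expR_le] and [expR_le_exprn]. *)
Lemma mgf_power_bounds (h : K -> R) (eta : R) : \sum_x pi x * h x = 0 -> 0 < eta ->
  exists2 t0 : R, 0 < t0 & forall t n, 0 <= t -> t <= t0 ->
    expR (n%:R * (t ^+ 2 * ((\sum_x pi x * h x ^+ 2) / 2 - eta)))
      <= (\sum_x pi x * expR (t * h x)) ^+ n
      <= expR (n%:R * (t ^+ 2 * ((\sum_x pi x * h x ^+ 2) / 2 + eta))).
Proof.
move=> h0 eta0.
set s := (\sum_x pi x * h x ^+ 2) / 2.
have s0 : 0 <= s.
  by rewrite mulr_ge0// sumr_ge0// => x _; rewrite mulr_ge0// sqr_ge0.
pose B := 1 + \sum_x `|h x|.
have B1 : 1 <= B by rewrite lerDl sumr_ge0.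
have hB x : `|h x| <= B.
  by rewrite /B (bigD1 x)//= addrCA lerDl addr_ge0// sumr_ge0.
pose D := s + B ^+ 3.
have D0 : 0 <= D by rewrite addr_ge0// exprn_ge0// (le_trans _ B1).
pose E := B ^+ 3 + D ^+ 2.
have E0 : 0 < E by rewrite ltr_wpDr ?sqr_ge0// exprn_gt0// (lt_le_trans _ B1).
exists (Num.min B^-1 (eta / E)).
  by rewrite lt_min invr_gt0 (lt_le_trans _ B1)// divr_gt0.
move=> t n t0; rewrite le_min => /andP[tB tE].
have {}tB : t * B <= 1 by rewrite -ler_pdivlMr ?div1r// (lt_le_trans _ B1).
have {}tE : t * E <= eta by rewrite -ler_pdivlMr.
have t1 : t <= 1 by rewrite (le_trans _ tB)// ler_peMr.
have := mgf_taylor h0 hB t0 tB; rewrite -/s.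
have := mgf_ge1 t h0.
move: (\sum_x _) => M.
have [x ->] : exists x, M = 1 + x by exists (M - 1); ring.
rewrite lerDl => x0; rewrite ler_distl exprMn => /andP[xl xu].
have {}xu : x <= t ^+ 2 * s + t ^+ 3 * B ^+ 3 by lra.
have {}xl : t ^+ 2 * s - t ^+ 3 * B ^+ 3 <= x by lra.
have tt0 : 0 <= t ^+ 2 by rewrite sqr_ge0.
have BB : 0 <= B ^+ 3 by rewrite exprn_ge0// (le_trans _ B1).
have t3 : t ^+ 3 * B ^+ 3 = t ^+ 2 * (t * B ^+ 3) by ring.
have tE1 : t * B ^+ 3 <= eta.
  by apply: le_trans tE; rewrite ler_wpM2l// lerDl sqr_ge0.
apply/andP; split; last first.
  apply: (le_trans (exprn_expR_le n _)); first by rewrite addr_ge0.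
  rewrite ler_expR ler_wpM2l// (le_trans xu)// mulrDr lerD2l t3 ler_wpM2l//.
apply: (le_trans _ (expR_le_exprn n x0)).
rewrite ler_expR ler_wpM2l// .
have xD : x <= t ^+ 2 * D.
  by rewrite (le_trans xu)// mulrDr lerD2l t3 ler_wpM2l// ler_piMl.
have x2 : x ^+ 2 <= t ^+ 2 * (t * D ^+ 2).
  rewrite (le_trans (_ : _ <= (t ^+ 2 * D) ^+ 2)) ?lerXn2r ?nnegrE ?mulr_ge0//.
  have -> : (t ^+ 2 * D) ^+ 2 = t ^+ 2 * (t * D ^+ 2) * t by ring.
  by rewrite ler_piMr// !mulr_ge0 ?sqr_ge0.
have : t ^+ 2 * (t * E) <= t ^+ 2 * eta by rewrite ler_wpM2l.
rewrite /E; move: xl; rewrite t3; lra.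
Qed.

End finite_product.

(** * Moderate deviations of finitely many sums *)

(** Regularized normal equations: adding [eps] makes the semidefinite form
definite, so a solution exists even if [c] is not in the range of [G]. *)
Lemma tikhonov (R : realType) N (G : 'I_N -> 'I_N -> R) (eps : R) (c : 'I_N -> R) :
  (forall th : 'I_N -> R, 0 <= \sum_i \sum_j th i * G i j * th j) -> 0 < eps ->
  exists th : 'I_N -> R, forall j, \sum_i th i * G i j + eps * th j = c j.
Proof.
move=> G0 eps0.
pose A : 'M[R]_N := (\matrix_(i, j) G i j) + eps%:M.
have AE (u : 'rV[R]_N) j : (u *m A) 0 j = \sum_i u 0 i * G i j + eps * u 0 j.
  rewrite mulmxDr mul_mx_scalar !mxE; congr +%R.
  by apply: eq_bigr => i _; rewrite mxE.
have Aunit : A \in unitmx.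
  rewrite -row_free_unit; apply: inj_row_free => u uA.
  have : \sum_i \sum_j u 0 i * G i j * u 0 j + eps * \sum_j u 0 j ^+ 2 = 0.
    rewrite exchange_big/= mulr_sumr -big_split/= big1// => j _.
    have := AE u j; rewrite uA mxE => e.
    by rewrite expr2 mulrA -mulr_suml -mulrDl -e mul0r.
  have := G0 (u 0); move: (\sum_i _) => q q0 qe.
  have u0 : \sum_j u 0 j ^+ 2 = 0.
    have : 0 <= \sum_j u 0 j ^+ 2 by apply: sumr_ge0 => j _; exact: sqr_ge0.
    by move=> v0; apply/eqP; rewrite eq_le v0 andbT; nra.
  apply/rowP => j; rewrite mxE; apply/eqP; rewrite -sqrf_eq0; apply/eqP.
  by apply: (psumr_eq0P _ u0) => // i _; exact: sqr_ge0.
exists (fun i => ((\row_j c j) *m invmx A) 0 i) => j.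
by rewrite -AE mulmxKV// mxE.
Qed.

Section moderate_deviations.
Context (R : realType) (K : finType) (pi : K -> R).
Hypothesis pi_ge0 : forall x, 0 <= pi x.
Hypothesis pi_sum1 : \sum_x pi x = 1.
Context (N : nat) (h : 'I_N -> K -> R).
Hypothesis h_centered : forall j, \sum_x pi x * h j x = 0.

(** The covariance matrix of the [h j]. The vector [gramv th] collects the
covariances of [lincomb th] with the [h j], and [gramq th] is the variance of
[lincomb th]. *)
Definition gram i j := \sum_x pi x * (h i x * h j x).
Definition gramv (th : 'I_N -> R) j := \sum_i th i * gram i j.
Definition gramq (th : 'I_N -> R) := \sum_i \sum_j th i * gram i j * th j.
Definition lincomb (th : 'I_N -> R) x := \sum_j th j * h j x.

Definition stat n (a : R) (k : {ffun 'I_n -> K}) j :=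
  (\sum_i h j (k i)) / (a * Num.sqrt n%:R).

Lemma gramqE th : gramq th = \sum_x pi x * lincomb th x ^+ 2.
Proof.
rewrite /gramq /gram.
under [RHS]eq_bigr do rewrite expr2 /lincomb mulr_suml mulr_sumr.
rewrite [RHS]exchange_big/=; apply: eq_bigr => i _.
under [RHS]eq_bigr do rewrite mulr_sumr mulr_sumr.
rewrite [RHS]exchange_big/=; apply: eq_bigr => j _.
rewrite mulr_sumr mulr_suml; apply: eq_bigr => x _; ring.
Qed.

Lemma gramq_ge0 th : 0 <= gramq th.
Proof. by rewrite gramqE sumr_ge0// => x _; rewrite mulr_ge0 ?sqr_ge0. Qed.

Lemma gramvE th j : gramv th j = \sum_x pi x * (lincomb th x * h j x).
Proof.
rewrite /gramv /gram /lincomb.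
under [RHS]eq_bigr do rewrite mulr_suml mulr_sumr.
rewrite [RHS]exchange_big/=; apply: eq_bigr => i _.
rewrite mulr_sumr; apply: eq_bigr => x _; ring.
Qed.

Lemma gramq_gramv th : gramq th = \sum_j th j * gramv th j.
Proof.
rewrite /gramq exchange_big/=; apply: eq_bigr => j _.
by rewrite /gramv mulr_sumr; apply: eq_bigr => i _; rewrite mulrC.
Qed.

Lemma lincomb_centered th : \sum_x pi x * lincomb th x = 0.
Proof.
rewrite /lincomb; under eq_bigr do rewrite mulr_sumr.
rewrite exchange_big/= big1// => j _.
under eq_bigr do rewrite mulrCA.
by rewrite -mulr_sumr h_centered mulr0.
Qed.

Lemma lincomb_stat n a th (k : {ffun 'I_n -> K}) : a != 0 -> (0 < n)%N ->
  a ^+ 2 * \sum_j th j * stat a k j = a / Num.sqrt n%:R * \sum_i lincomb th (k i).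
Proof.
move=> a0 n0; rewrite /lincomb exchange_big/= !mulr_sumr; apply: eq_bigr => j _.
rewrite -mulr_sumr /stat; field.
by rewrite a0 sqrtr_eq0 -ltNge ltr0n n0.
Qed.

(** The time [t = a / sqrt n] is such that [n * t ^+ 2 = a ^+ 2]. *)
Lemma mgf_moderate th (eta : R) : 0 < eta -> moderately (fun n a =>
    expR (a ^+ 2 * (gramq th / 2 - eta))
      <= (\sum_x pi x * expR (a / Num.sqrt n%:R * lincomb th x)) ^+ n
      <= expR (a ^+ 2 * (gramq th / 2 + eta))).
Proof.
move=> eta0.
have [t0 t00 H] := mgf_power_bounds pi_ge0 pi_sum1 (lincomb_centered th) eta0.
exists t0 => //; exists 1 => // n a n0 a1 at0.
have a0 := lt_le_trans ltr01 a1.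
have := H (a / Num.sqrt n%:R) n (divr_ge0 (ltW a0) (sqrtr_ge0 _)) at0.
have tn (y : R) : n%:R * ((a / Num.sqrt n%:R) ^+ 2 * y) = a ^+ 2 * y.
  rewrite expr_div_n sqr_sqrtr ?ler0n// mulrA (mulrC n%:R) mulfVK//.
  by rewrite pnatr_eq0 -lt0n.
by rewrite -gramqE !tn.
Qed.

(** The cube [[-M, M]^N] is cut into finitely many cells with centers [c f].
For each center let [th f] solve [gramv th + eps * th = c f]. The Chernoff bound in
the direction [th f] has exponent
  th . c - gramq th / 2 = gramq th / 2 + eps * |th| ^ 2.
If [gramq th / 2] exceeds [l] this is enough. Otherwise [gramv th] belongs to the
ellipsoid that the cell has to avoid, so that [eps * th], its difference with
[c f], has a coordinate larger than [dl / 2], and the value of [eps] makes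
[eps * |th| ^ 2] at least [l]. *)
Lemma stat_upper (l dl M eta : R) : 0 <= l -> 0 < dl -> 0 < M -> 0 < eta ->
  moderately (fun n a =>
  \sum_(k : {ffun 'I_n -> K} | `[< (forall j, `|stat a k j| <= M) /\
      forall th, gramq th / 2 <= l -> exists j, dl < `|stat a k j - gramv th j| >])
    weight pi k <= expR (- (a ^+ 2 * (l - eta)))).
Proof.
move=> l0 dl0 M0 eta0.
pose eps := dl ^+ 2 / (16 * (l + 1)).
have l10 : 0 < l + 1 by rewrite ltr_wpDl.
have eps0 : 0 < eps by rewrite divr_gt0 ?exprn_gt0 ?mulr_gt0.
pose s := N%:R * (1 + (M / eps) ^+ 2) + 1.
have s0 : 0 < s by rewrite ltr_wpDl// mulr_ge0// addr_ge0// sqr_ge0.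
pose kap := Num.min (dl / 2) (eta / (4 * s)).
have kap0 : 0 < kap by rewrite lt_min !divr_gt0 ?mulr_gt0.
have kapdl : kap <= dl / 2 by rewrite ge_min lexx.
have kaps : s * kap <= eta / 4.
  have : kap <= eta / (4 * s) by rewrite ge_min lexx orbT.
  move=> /(ler_wpM2l (ltW s0)) /le_trans; apply; rewrite le_eqVlt; apply/orP; left.
  by apply/eqP; field; rewrite lt0r_neq0.
pose m := (Num.truncn (2 * M / kap)).+1.
pose c (f : {ffun 'I_N -> 'I_m}) j := - M + kap * (f j : nat)%:R.
have cM f j : `|c f j| <= M.
  have : (f j : nat)%:R <= 2 * M / kap.
    rewrite (le_trans (_ : _ <= (Num.truncn (2 * M / kap))%:R)) ?ler_nat -1?ltnS//.
    by rewrite truncn_le// divr_ge0 ?(ltW kap0)// mulr_ge0 ?(ltW M0).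
  rewrite ler_pdivlMr// mulrC => h1.
  have h2 : 0 <= kap * (f j : nat)%:R by rewrite mulr_ge0 ?(ltW kap0).
  rewrite ler_norml /c; apply/andP; split; lra.
have /choice[th thP] : forall f, exists th : 'I_N -> R,
    forall j, gramv th j + eps * th j = c f j.
  by move=> f; exact: tikhonov gramq_ge0 eps0.
(* The l1 norm of th f is bounded independently of f, from eps * |th f|_2 ^ 2 <= th f . c f
   and the inequality of arithmetic and geometric means in each coordinate. *)
have thl1 f : \sum_j `|th f j| <= s.
  have E : \sum_j th f j * c f j = gramq (th f) + eps * \sum_j th f j ^+ 2.
    rewrite gramq_gramv mulr_sumr -big_split/=; apply: eq_bigr => j _.
    by rewrite -thP; ring.
  set S := \sum_j `|th f j|; set Q := \sum_j th f j ^+ 2 in E.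
  have E1 : eps * (eps * Q) <= eps * (M * S).
    rewrite ler_wpM2l ?(ltW eps0)// (le_trans (_ : _ <= \sum_j th f j * c f j))//.
      by rewrite E lerDr gramq_ge0.
    rewrite mulr_sumr; apply: ler_sum => j _.
    by rewrite (le_trans (ler_norm _))// normrM mulrC ler_wpM2r.
  have E2 : 2 * (eps * M) * S <= eps ^+ 2 * Q + N%:R * M ^+ 2.
    have -> : N%:R * M ^+ 2 = \sum_(j < N) M ^+ 2 by rewrite sumr_const card_ord mulr_natl.
    rewrite !mulr_sumr -big_split/=; apply: ler_sum => j _.
    have := sqr_ge0 (eps * `|th f j| - M).
    rewrite -(real_normK (num_real (th f j))); move: (`|th f j|) => x; lra.
  have E3 : S <= N%:R + Q.
    have -> : N%:R = \sum_(j < N) (1 : R) by rewrite sumr_const card_ord.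
    rewrite -big_split/=; apply: ler_sum => j _.
    rewrite -(real_normK (num_real (th f j))); move: (`|th f j|) => x.
    have := sqr_ge0 (x - 2^-1); lra.
  apply: (le_trans E3); rewrite /s mulrDr mulr1 -addrA lerD2l ler_wpDr//.
  rewrite expr_div_n mulrA ler_pdivlMr ?exprn_gt0//; lra.
apply: moderately_imp (moderately_and
  (moderately_forall (fun f => mgf_moderate (th f) (divr_gt0 eta0 (ltr0Sn R 3))))
  (moderately_expR (#|{: {ffun 'I_N -> 'I_m}}|%:R) (divr_gt0 eta0 (ltr0Sn R 1))))
  => n a n0 a0 [tP AP].
pose near f (k : {ffun 'I_n -> K}) := [forall j, `|stat a k j - c f j| <= kap].
pose bad f := `[< forall th', gramq th' / 2 <= l -> exists j, dl / 2 < `|c f j - gramv th' j| >].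
have bound f : bad f -> \sum_(k | near f k) weight pi k <=
    expR (- (a ^+ 2 * (l - eta / 2))).
  move=> /asboolP badf.
  set th' := th f.
  have E : \sum_j th' j * c f j = gramq th' + eps * \sum_j th' j ^+ 2.
    rewrite gramq_gramv mulr_sumr -big_split/=; apply: eq_bigr => j _.
    by rewrite -thP -/th'; ring.
  have E1 : l <= \sum_j th' j * c f j - gramq th' / 2.
    rewrite E; have q0 := gramq_ge0 th'.
    have p0 : 0 <= eps * \sum_j th' j ^+ 2.
      by rewrite mulr_ge0 ?(ltW eps0)// sumr_ge0// => j _; exact: sqr_ge0.
    have [ql|lq] := leP (gramq th' / 2) l; last by lra.
    have [j] := badf _ ql; rewrite -thP -/th' addrC addKr.
    rewrite normrM gtr0_norm// => jd.
    have : l <= eps * `|th' j| ^+ 2.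
      have : (dl / 2) ^+ 2 <= (eps * `|th' j|) ^+ 2.
        have d0 : 0 <= dl / 2 by rewrite divr_ge0 ?(ltW dl0).
        by apply: lerXn2r; rewrite ?nnegrE ?(ltW jd)// (le_trans d0 (ltW jd)).
      have -> : (dl / 2) ^+ 2 = eps * (4 * (l + 1)).
        by rewrite /eps; field; lra.
      rewrite exprMn (expr2 eps) -(mulrA eps eps) ler_pM2l//; lra.
    move=> /le_trans -/(_ (eps * \sum_j th' j ^+ 2)) le2.
    have : l <= eps * \sum_j th' j ^+ 2.
      apply: le2; rewrite ler_wpM2l ?(ltW eps0)// real_normK ?num_real//.
      by rewrite (bigD1 j)//= lerDl sumr_ge0// => i _; exact: sqr_ge0.
    lra.
  pose b := a * Num.sqrt n%:R * (\sum_j th' j * c f j - s * kap).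
  have sn0 : Num.sqrt (n%:R : R) != 0 by rewrite sqrtr_eq0 -ltNge ltr0n.
  have Qb k : near f k -> b <= \sum_i lincomb th' (k i).
    move=> /forallP nk.
    have -> : \sum_i lincomb th' (k i) = a * Num.sqrt n%:R * \sum_j th' j * stat a k j.
      have := lincomb_stat th' k (lt0r_neq0 a0) n0.
      move: (\sum_j _) (\sum_i _) => X Y XY; apply: (mulfI (x := a / Num.sqrt n%:R)).
        by rewrite mulf_neq0 ?invr_eq0 ?sn0 ?(lt0r_neq0 a0).
      by rewrite -XY; field.
    rewrite /b ler_wpM2l ?mulr_ge0 ?sqrtr_ge0 ?(ltW a0)//.
    rewrite lerBlDr addrC -lerBlDr -sumrB.
    rewrite (le_trans (ler_norm _))// (le_trans (ler_norm_sum _ _ _))//.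
    rewrite (le_trans (_ : _ <= \sum_j `|th' j| * kap))//.
      by apply: ler_sum => j _; rewrite -mulrBr normrM distrC ler_wpM2l.
    by rewrite -mulr_suml ler_wpM2r ?(ltW kap0)// thl1.
  have := chernoff pi_ge0 (divr_ge0 (ltW a0) (sqrtr_ge0 n%:R)) Qb.
  move=> /le_trans; apply.
  have -> : a / Num.sqrt n%:R * b = a ^+ 2 * (\sum_j th' j * c f j - s * kap).
    by rewrite /b; field.
  apply: (le_trans (ler_wpM2l (expR_ge0 _) (andP (tP f)).2)).
  rewrite -/th' -expRD ler_expR.
  have : l - eta / 2 <= \sum_j th' j * c f j - s * kap - (gramq th' / 2 + eta / 4) by lra.
  move=> /(ler_wpM2l (sqr_ge0 a)); lra.
apply: (@le_trans _ _ (\sum_(f | bad f) \sum_(k | near f k) weight pi k)).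
  rewrite (exchange_big_dep xpredT)//= big_mkcond/=.
  apply: ler_sum => k _; case: ifPn => [/asboolP[vM kbad]|_]; last first.
    by rewrite sumr_ge0// => *; exact: weight_ge0.
  pose f := [ffun j : 'I_N => inord (Num.truncn ((stat a k j + M) / kap)) : 'I_m].
  have nearf j : `|stat a k j - c f j| <= kap.
    have /ler_normlP[v1 v2] := vM j.
    have x0 : 0 <= (stat a k j + M) / kap by rewrite divr_ge0 ?(ltW kap0)//; lra.
    have := truncn_itv x0.
    rewrite /c /f ffunE inordK; last first.
      rewrite ltnS; apply: le_truncn; rewrite ler_wpM2r ?invr_ge0 ?(ltW kap0)//; lra.
    move: (Num.truncn _) => z; rewrite ler_pdivlMr// ltr_pdivrMr// -natr1 => /andP[z1 z2].
    rewrite ler_norml; apply/andP; split; lra.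
  rewrite (bigD1 f)/= ?lerDl ?sumr_ge0//.
    by move=> *; exact: weight_ge0.
  apply/andP; split; last exact/forallP.
  apply/asboolP => th' /kbad[j jd]; exists j.
  have := nearf j.
  have := ler_distD (c f j) (stat a k j) (gramv th' j); lra.
apply: (@le_trans _ _ (\sum_(f | bad f) expR (- (a ^+ 2 * (l - eta / 2))))).
  by apply: ler_sum => f; exact: bound.
rewrite sumr_const -[leLHS]mulr_natl.
apply: (@le_trans _ _ (expR (a ^+ 2 * (eta / 2)) * expR (- (a ^+ 2 * (l - eta / 2))))).
  rewrite ler_wpM2r ?expR_ge0// (le_trans _ AP)// ler_nat max_card//.
rewrite -expRD ler_expR; lra.
Qed.


Lemma gramq_perturb th j r :
  gramq (fun i => th i + r * (i == j)%:R) =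
  gramq th + 2 * (r * gramv th j) + r ^+ 2 * gram j j.
Proof.
have lc x : lincomb (fun i => th i + r * (i == j)%:R) x = lincomb th x + r * h j x.
  rewrite /lincomb; under eq_bigr do rewrite mulrDl.
  rewrite big_split/=; congr +%R; rewrite (bigD1 j)//= eqxx mulr1 big1 ?addr0//.
  by move=> i /negPf ->; rewrite mulr0 mul0r.
rewrite !gramqE gramvE /gram !mulr_sumr -!big_split/=; apply: eq_bigr => x _.
by rewrite lc; ring.
Qed.

(** Change of measure. Weights are tilted by the exponential of [a ^+ 2] times the
scalar product of [th] with [stat]. The tilted law concentrates at [gramv th], as
Chernoff bounds in the directions [th] shifted by [rho] or [- rho] along a
coordinate show. On the event of concentration the tilting factor is at most
[expR (a ^+ 2 * (gramq th + eta / 2))], while the total tilted mass is about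
[expR (a ^+ 2 * (gramq th / 2))]; the quotient is the bound. *)
Lemma stat_lower th (dl eta : R) : 0 < dl -> 0 < eta ->
  moderately (fun n a =>
  expR (- (a ^+ 2 * (gramq th / 2 + eta))) <=
  \sum_(k : {ffun 'I_n -> K} | [forall j, `|stat a k j - gramv th j| <= dl]) weight pi k).
Proof.
move=> dl0 eta0.
set q := gramq th.
pose s := \sum_j `|th j| + 1.
have s0 : 0 < s by rewrite ltr_wpDl// sumr_ge0.
pose dl' := Num.min dl (eta / (2 * s)).
have dl'0 : 0 < dl' by rewrite lt_min dl0 divr_gt0// mulr_gt0.
have dl's : s * dl' <= eta / 2.
  have : dl' <= eta / (2 * s) by rewrite ge_min lexx orbT.
  move=> /(ler_wpM2l (ltW s0)) /le_trans; apply; rewrite le_eqVlt; apply/orP; left.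
  by apply/eqP; field; rewrite lt0r_neq0.
have gram0 j : 0 <= gram j j.
  by apply: sumr_ge0 => x _; rewrite mulr_ge0// -expr2 sqr_ge0.
pose g := 1 + \sum_j gram j j.
have gj j : gram j j <= g.
  by rewrite /g (bigD1 j)//= addrCA lerDl addr_ge0// sumr_ge0.
have g0 : 0 < g by rewrite ltr_wpDr// sumr_ge0.
(* This value maximizes the gain rho * dl' - rho ^ 2 * g / 2 of the shifted Chernoff bounds. *)
pose rho := dl' / g.
have rho0 : 0 < rho by rewrite divr_gt0.
have rhog : rho * g = dl' by rewrite /rho divfK// lt0r_neq0.
pose e := Num.min (rho * dl' / 8) (eta / 4).
have e0 : 0 < e by rewrite lt_min !divr_gt0// mulr_gt0.
have e1 : e <= rho * dl' / 8 by rewrite ge_min lexx.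
have e2 : e <= eta / 4 by rewrite ge_min lexx orbT.
pose pert (b : bool) j := fun i => th i + ((-1) ^+ b * rho) * (i == j)%:R.
apply: moderately_imp (moderately_and (moderately_and (mgf_moderate th e0)
  (moderately_forall (fun bj : bool * 'I_N => mgf_moderate (pert bj.1 bj.2) e0)))
  (moderately_and (moderately_expR (4 * N%:R) e0)
    (moderately_expR 2 (divr_gt0 eta0 (ltr0Sn R 3)))))
  => n a n0 a0 [[/andP[Xl _] H2] [AP1 AP2]].
have a20 : 0 <= a ^+ 2 by rewrite sqr_ge0.
have sn0 : Num.sqrt (n%:R : R) != 0 by rewrite sqrtr_eq0 -ltNge ltr0n.
pose t := a / Num.sqrt n%:R.
set X := (_ ^+ n) in Xl.
pose tw (k : {ffun 'I_n -> K}) := weight pi k * expR (a ^+ 2 * \sum_j th j * stat a k j).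
have tw0 k : 0 <= tw k by rewrite mulr_ge0 ?weight_ge0 ?expR_ge0.
have XE : X = \sum_k tw k.
  by rewrite /X -(sum_weight_expR pi); apply: eq_bigr => k _; rewrite /tw lincomb_stat ?lt0r_neq0.
pose good (k : {ffun 'I_n -> K}) := [forall j, `|stat a k j - gramv th j| <= dl'].
pose far (b : bool) j (k : {ffun 'I_n -> K}) := dl' < (-1) ^+ b * (stat a k j - gramv th j).
have farX (b : bool) j : \sum_(k | far b j k) tw k <= X * expR (- (a ^+ 2 * e)) * expR (- (a ^+ 2 * e)).
  apply: (@le_trans _ _ (\sum_(k : {ffun 'I_n -> K}) weight pi k *
      expR (t * \sum_i lincomb (pert b j) (k i)) *
      expR (- (a ^+ 2 * (rho * (dl' + (-1) ^+ b * gramv th j)))))).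
    rewrite big_mkcond; apply: ler_sum => k _.
    case: ifPn => [fk|_]; last by rewrite !mulr_ge0 ?weight_ge0 ?expR_ge0.
    rewrite -mulrA ler_wpM2l ?weight_ge0// -expRD ler_expR.
    rewrite -lincomb_stat ?lt0r_neq0//.
    have -> : \sum_j0 pert b j j0 * stat a k j0 =
        \sum_j0 th j0 * stat a k j0 + (-1) ^+ b * rho * stat a k j.
      under eq_bigr do rewrite mulrDl.
      rewrite big_split/=; congr +%R; rewrite (bigD1 j)//= eqxx mulr1 big1 ?addr0//.
      by move=> i /negPf ->; rewrite mulr0 mul0r.
    have : rho * dl' <= rho * ((-1) ^+ b * (stat a k j - gramv th j)).
      by rewrite ler_wpM2l ?(ltW rho0)// ltW.
    move=> /(ler_wpM2l a20); lra.
  rewrite -mulr_suml (sum_weight_expR pi).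
  have /andP[_] := H2 (b, j).
  move=> /(ler_wpM2r (expR_ge0 (- (a ^+ 2 * (rho * (dl' + (-1) ^+ b * gramv th j)))))).
  move=> /le_trans; apply.
  rewrite (le_trans (_ : _ <= expR (a ^+ 2 * (q / 2 - e)) * expR (- (a ^+ 2 * e)) * expR (- (a ^+ 2 * e))))//.
    rewrite -!expRD ler_expR/= gramq_perturb -/q exprMn -exprM mulnC exprM sqrrN !expr1n mul1r.
    have : rho ^+ 2 * gram j j <= rho * dl'.
      by rewrite expr2 -mulrA -rhog ler_wpM2l ?(ltW rho0)// ler_wpM2l ?(ltW rho0).
    move=> h1.
    have : (q + 2 * ((-1) ^+ b * rho * gramv th j) + rho ^+ 2 * gram j j) / 2 + e -
       (rho * (dl' + (-1) ^+ b * gramv th j)) <= q / 2 - e - e - e by lra.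
    move=> /(ler_wpM2l a20); lra.
  by rewrite !ler_wpM2r ?expR_ge0.
have E0 : 0 < expR (- (a ^+ 2 * e)) by rewrite expR_gt0.
have X0 : 0 <= X by rewrite XE sumr_ge0.
have Ngood : \sum_(k | ~~ good k) tw k <= X / 2.
  apply: (@le_trans _ _ (\sum_bj \sum_(k | far bj.1 bj.2 k) tw k)).
    rewrite (exchange_big_dep xpredT)//= big_mkcond/=.
    apply: ler_sum => k _; case: ifPn => [|_]; last by rewrite sumr_ge0.
    rewrite negb_forall => /existsP[j]; rewrite -ltNge => jd.
    pose b := stat a k j - gramv th j < 0.
    rewrite (bigD1 (b, j))/= ?lerDl ?sumr_ge0//.
    rewrite /far /b; case: (ltP (stat a k j - gramv th j) 0) => z /=.
      by rewrite expr1 mulN1r -ltr0_norm.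
    by rewrite expr0 mul1r -(ger0_norm z).
  apply: (@le_trans _ _ (\sum_(bj : bool * 'I_N) X * expR (- (a ^+ 2 * e)) * expR (- (a ^+ 2 * e)))).
    by apply: ler_sum => -[b j] _; exact: farX.
  rewrite sumr_const card_prod card_bool card_ord -[leLHS]mulr_natl natrM.
  have := AP1; rewrite -[expR _]invrK -expRN => h1.
  have {}h1 : 4 * N%:R * expR (- (a ^+ 2 * e)) <= 1 by rewrite -ler_pdivlMr// mul1r.
  have E1 : expR (- (a ^+ 2 * e)) <= 1.
    by rewrite expR_le1 oppr_le0 mulr_ge0// ltW.
  have -> : 2 * N%:R * (X * expR (- (a ^+ 2 * e)) * expR (- (a ^+ 2 * e))) =
     X / 2 * (4 * N%:R * expR (- (a ^+ 2 * e)) * expR (- (a ^+ 2 * e))) by field.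
  rewrite ler_piMr ?divr_ge0// mulr_ile1// ?(ltW E0)//.
have goodX : X / 2 <= \sum_(k | good k) tw k.
  move: XE; rewrite (bigID good)/=; move: Ngood; lra.
have goodW : \sum_(k | good k) tw k <=
    (\sum_(k | good k) weight pi k) * expR (a ^+ 2 * (q + eta / 2)).
  rewrite mulr_suml; apply: ler_sum => k /forallP gk.
  rewrite ler_wpM2l ?weight_ge0// ler_expR ler_wpM2l//.
  rewrite /q gramq_gramv -lerBlDl -sumrB.
  rewrite (le_trans (ler_norm _))// (le_trans (ler_norm_sum _ _ _))//.
  rewrite (le_trans _ dl's)// (le_trans (_ : _ <= \sum_j `|th j| * dl'))//.
    by apply: ler_sum => j _; rewrite -mulrBr normrM ler_wpM2l.
  by rewrite -mulr_suml ler_wpM2r ?(ltW dl'0)// lerDl.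
apply: (@le_trans _ _ (\sum_(k | good k) weight pi k)); last first.
  rewrite [leRHS]big_mkcond [leLHS]big_mkcond/=; apply: ler_sum => k _.
  case: ifPn => gk; last by case: ifP; rewrite ?weight_ge0.
  rewrite ifT//; apply/forallP => j; rewrite (le_trans (forallP gk j))//.
  by rewrite ge_min lexx.
have E3 := expR_gt0 (a ^+ 2 * (q + eta / 2)).
rewrite -(ler_pM2r E3) (le_trans _ goodW)// (le_trans _ goodX)//.
rewrite (le_trans (_ : _ <= expR (a ^+ 2 * (q / 2 - e)) / 2)) ?ler_wpM2r//.
have := AP2; rewrite -[expR _]invrK -expRN => h1.
have {}h1 : expR (- (a ^+ 2 * (eta / 4))) <= 2^-1.
  by rewrite -[leLHS]invrK lef_pV2 ?posrE ?invr_gt0 ?expR_gt0.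
rewrite (le_trans _ (ler_wpM2l (expR_ge0 _) h1))//.
rewrite -!expRD ler_expR.
have : q / 2 - eta / 2 <= q / 2 - e - eta / 4 by lra.
move=> /(ler_wpM2l a20); lra.
Qed.

End moderate_deviations.

(** * Coding independent observations by finitely many symbols *)

Section finite_coding.
Context (R : realType).

Lemma probability_finite_union d (T : measurableType d) (P : probability T R)
    (I : finType) (Q : pred I) (F : I -> set T) :
  (forall i, measurable (F i)) -> trivIset setT F ->
  P [set x | exists2 i, Q i & F i x] = (\sum_(i | Q i) P (F i))%E.
Proof.
move=> mF tF.
have -> : [set x | exists2 i, Q i & F i x] = \bigcup_(i in [set i | Q i]) F i.
  by apply/seteqP; split => [x [i Qi Fx]|x [i Qi Fx]]; exists i.
rewrite measure_fin_bigcup//; last 2 first.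
- exact: finite_finset.
- exact: sub_trivIset tF.
rewrite (fsbigE [seq i <- index_enum I | Q i]).
- rewrite big_filter_cond; apply: eq_bigl => i.
  by apply/andP/idP => [[]//|Qi]; split => //; exact: mem_set.
- exact: filter_uniq (index_enum_uniq I).
- by move=> i /=; rewrite mem_filter => /andP[].
- by move=> i /= Qi; rewrite mem_filter Qi mem_index_enum.
Qed.

Section law_of_code.
Context d (T : measurableType d) (mu : probability T R) (K : finType) (kap : T -> K).
Hypothesis mkap : forall k, measurable (kap @^-1` [set k]).

Definition code_law (k : K) : R := fine (mu (kap @^-1` [set k])).

Lemma code_lawE k : mu (kap @^-1` [set k]) = (code_law k)%:E.
Proof. by rewrite /code_law fineK// fin_num_measure. Qed.

Lemma code_law_ge0 k : 0 <= code_law k.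
Proof. by rewrite fine_ge0. Qed.

Lemma code_preimages_trivIset : trivIset setT (fun k => kap @^-1` [set k]).
Proof. by move=> i j _ _ [x [/= <- <-]]. Qed.

Lemma sum_code_law : \sum_k code_law k = 1.
Proof.
apply: EFin_inj; rewrite -(probability_setT mu) -sumEFin.
have -> : [set: T] = [set x | exists2 k, predT k & (kap @^-1` [set k]) x].
  by apply/seteqP; split => // x _; exists (kap x).
rewrite probability_finite_union//; last exact: code_preimages_trivIset.
by apply: eq_bigr => k _; rewrite code_lawE.
Qed.

Lemma codeE (phi : K -> R) x :
  phi (kap x) = \sum_k phi k * \1_(kap @^-1` [set k]) x.
Proof.
rewrite (bigD1 (kap x))//= indicE mem_set// mulr1 big1 ?addr0// => k /negPf kx.
by rewrite indicE memNset ?mulr0// => /= /eqP; rewrite eq_sym kx.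
Qed.

Lemma integrable_code (phi : K -> R) :
  mu.-integrable setT (EFin \o (phi \o kap)).
Proof.
rewrite (_ : _ \o _ = fun x => (\sum_k (phi k * \1_(kap @^-1` [set k]) x)%:E)%E).
  apply: integrable_sum => //= k _.
  under eq_fun do rewrite EFinM.
  by apply: integrableZl => //; exact: integrable_indic.
by apply/funext => x /=; rewrite sumEFin -codeE.
Qed.

Lemma integral_code (phi : K -> R) :
  (\int[mu]_x (phi (kap x))%:E = (\sum_k code_law k * phi k)%:E)%E.
Proof.
under eq_integral do rewrite codeE -sumEFin.
rewrite integral_sum//; last first.
  move=> k; under eq_fun do rewrite EFinM.
  by apply: integrableZl => //; exact: integrable_indic.
rewrite -sumEFin; apply: eq_bigr => k _.
under eq_integral do rewrite EFinM.
rewrite integralZl//; last exact: integrable_indic.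
by rewrite integral_indic// setIT mulrC EFinM; congr (_ * _)%E; exact: code_lawE.
Qed.

End law_of_code.

Section iid_codes.
Context d d' (Om : measurableType d) (T : measurableType d') (P : probability Om R).
Context (mu : probability T R) (Z : nat -> Om -> T).
Hypothesis mZ : forall i, measurable_fun setT (Z i).
Hypothesis iidZ : iid_with_law P Z mu.
Context (K : finType) (kap : T -> K).
Hypothesis mkap : forall k, measurable (kap @^-1` [set k]).

(** A property of the codes of the observations is a finite disjoint union of
product events, so that its probability is computed on the finite alphabet. *)
Lemma iid_code_event n (Q : pred {ffun 'I_n -> K}) :
  let E := [set w | Q [ffun i : 'I_n => kap (Z i w)]] in
  measurable E /\ P E = (\sum_(k | Q k) weight (code_law mu kap) k)%:E.
Proof.
pose A (k : {ffun 'I_n -> K}) i :=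
  if insub i is Some j then kap @^-1` [set k j] else setT.
have mA k i : measurable (A k i) by rewrite /A; case: insubP.
pose J := [fset i | i in iota 0 n]%fset.
pose F (k : {ffun 'I_n -> K}) := \bigcap_(i in [set` J]) Z i @^-1` A k i.
have FE k w : F k w <-> [ffun i : 'I_n => kap (Z i w)] = k.
  split => [Fw|<- i _].
    apply/ffunP => i; rewrite ffunE.
    have := Fw i; rewrite /A/= !inE/= mem_iota leq0n add0n ltn_ord.
    by rewrite (insubT (fun i => i < n)%N (ltn_ord i)) => /(_ isT)/= ->; congr (k _); exact: val_inj.
  rewrite /A/=; case: insubP => //= j _ ij; by rewrite ffunE ij.
have mF k : measurable (F k).
  apply: fin_bigcap_measurable => // i _.
  by rewrite -[X in measurable X]setTI; exact: mZ.
have PF k : P (F k) = (weight (code_law mu kap) k)%:E.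
  rewrite /F iidZ.1//.
  rewrite (perm_big (iota 0 n))/=; last first.
    apply: uniq_perm; rewrite ?fset_uniq ?iota_uniq//.
    by move=> i; rewrite !inE.
  rewrite (_ : iota 0 n = index_iota 0 n); last by rewrite /index_iota subn0.
  rewrite big_mkord /weight -prodEFin; apply: eq_bigr => i _.
  rewrite iidZ.2// /A (insubT (fun i => i < n)%N (ltn_ord i))/= code_lawE//.
  by do 3 f_equal; exact: val_inj.
have EE : [set w | Q [ffun i : 'I_n => kap (Z i w)]] = [set w | exists2 k, Q k & F k w].
  apply/seteqP; split => w /=.
    by move=> Qw; exists [ffun i : 'I_n => kap (Z i w)] => //; exact/FE.
  by move=> [k Qk /FE ->].
rewrite /= EE; split.
  rewrite (_ : mkset _ = \bigcup_(k in [set k | Q k]) F k).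
    by apply: fin_bigcup_measurable => //; exact: finite_finset.
  by apply/seteqP; split => [x [i Qi Fx]|x [i Qi Fx]]; exists i.
rewrite probability_finite_union//.
  by rewrite -sumEFin; apply: eq_bigr => k _.
by move=> i j _ _ [w [/FE <- /FE <-]].
Qed.

End iid_codes.
End finite_coding.

(** * Square-integrable densities *)

Section square_integrable.
Context (R : realType) d (T : measurableType d) (mu : probability T R).
Implicit Types f g : T -> R.

Definition sqint f := measurable_fun setT f /\
  mu.-integrable setT (fun x => (f x ^+ 2)%:E).

Definition ip f g : R := \int[mu]_x (f x * g x).

Lemma ipE f g : ip f g = \int[mu]_x (f x * g x).
Proof. by []. Qed.

Lemma ipC f g : ip f g = ip g f.
Proof. by apply: eq_Rintegral => x _; rewrite mulrC. Qed.

Lemma sqint_mul f g : sqint f -> sqint g ->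
  mu.-integrable setT (fun x => (f x * g x)%:E).
Proof.
move=> [mf if2] [mg ig2].
apply: (@le_integrable _ _ _ mu setT measurableT _ (fun x => (f x ^+ 2 + g x ^+ 2)%:E)).
- by apply/measurable_EFinP; exact: measurable_funM.
- move=> x _; rewrite !abse_EFin lee_fin.
  have p : 0 <= f x ^+ 2 + g x ^+ 2 by rewrite addr_ge0 ?sqr_ge0.
  rewrite (ger0_norm p) normrM.
  rewrite -(real_normK (num_real (f x))) -(real_normK (num_real (g x))).
  have := sqr_ge0 (`|f x| - `|g x|); have := normr_ge0 (f x); have := normr_ge0 (g x).
  nra.
- by rewrite (_ : (fun x => _) = (fun x => (f x ^+ 2)%:E) \+ (fun x => (g x ^+ 2)%:E))%E;
    [exact: integrableD|apply/funext => x; rewrite /= EFinD].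
Qed.

Lemma sqint_bounded f M : measurable_fun setT f -> (forall x, `|f x| <= M) -> sqint f.
Proof.
move=> mf fM; split => //.
apply: (@le_integrable _ _ _ mu setT measurableT _ (cst (M ^+ 2)%:E)).
- by apply/measurable_EFinP; exact: measurable_funX.
- move=> x _; rewrite /= lee_fin normrX [leRHS]ger0_norm ?sqr_ge0//.
  by rewrite lerXn2r// ?nnegrE// (le_trans _ (fM x)).
- exact: finite_measure_integrable_cst.
Qed.

Lemma sqint_cst c : sqint (fun=> c).
Proof. by apply: (@sqint_bounded _ `|c|) => //. Qed.

Lemma sqint_indic (A : set T) : measurable A -> sqint \1_A.
Proof.
move=> mA; apply: (@sqint_bounded _ 1); first exact: measurable_indic.
by move=> x; rewrite indicE ger0_norm// lern1 leq_b1.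
Qed.

Lemma sqint_lin f g (a b : R) : sqint f -> sqint g -> sqint (fun x => a * f x + b * g x).
Proof.
move=> sf sg; have [mf if2] := sf; have [mg ig2] := sg; split.
  by apply: measurable_funD; exact: measurable_funM.
rewrite (_ : (fun x => _) = (fun x => (a ^+ 2)%:E * (f x ^+ 2)%:E +
   ((2 * a * b)%:E * (f x * g x)%:E + (b ^+ 2)%:E * (g x ^+ 2)%:E)))%E.
  apply: integrableD => //; first exact: integrableZl.
  by apply: integrableD => //; apply: integrableZl => //; exact: sqint_mul.
by apply/funext => x; rewrite -!EFinM -!EFinD; congr EFin; ring.
Qed.

Lemma sqintB f g : sqint f -> sqint g -> sqint (fun x => f x - g x).
Proof.
move=> sf sg; have := sqint_lin 1 (-1) sf sg.
by under eq_fun do rewrite mul1r mulN1r.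
Qed.

Lemma sqint_integrable f : sqint f -> mu.-integrable setT (EFin \o f).
Proof.
move=> sf; have := sqint_mul sf (sqint_cst 1).
by under eq_fun do rewrite mulr1.
Qed.

Lemma ip_linl f g h (a b : R) : sqint f -> sqint g -> sqint h ->
  ip (fun x => a * f x + b * g x) h = a * ip f h + b * ip g h.
Proof.
move=> sf sg sh; have ifh := sqint_mul sf sh; have igh := sqint_mul sg sh.
rewrite /ip -!RintegralZl//-RintegralD//.
- by apply: eq_Rintegral => x _; ring.
- exact: (integrableZl measurableT a ifh).
- exact: (integrableZl measurableT b igh).
Qed.

Lemma ipBl f g h : sqint f -> sqint g -> sqint h ->
  ip (fun x => f x - g x) h = ip f h - ip g h.
Proof.
move=> sf sg sh; have := ip_linl 1 (-1) sf sg sh; rewrite mul1r mulN1r => <-.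
by apply: eq_Rintegral => x _; rewrite mul1r mulN1r.
Qed.

Lemma ip_ge0 f : 0 <= ip f f.
Proof. by apply: Rintegral_ge0 => x _; rewrite -expr2 sqr_ge0. Qed.

Lemma ip_lin_sqr f g (a b : R) : sqint f -> sqint g ->
  ip (fun x => a * f x + b * g x) (fun x => a * f x + b * g x) =
  a ^+ 2 * ip f f + 2 * (a * b) * ip f g + b ^+ 2 * ip g g.
Proof.
move=> sf sg; have sfg := sqint_lin a b sf sg.
have E h : sqint h -> ip h (fun x => a * f x + b * g x) = a * ip h f + b * ip h g.
  by move=> sh; rewrite ipC ip_linl// (ipC f) (ipC g).
rewrite ip_linl// !E// (ipC g f); ring.
Qed.

Lemma ipB_sqr f g : sqint f -> sqint g ->
  ip (fun x => f x - g x) (fun x => f x - g x) = ip f f - 2 * ip f g + ip g g.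
Proof.
move=> sf sg; have := ip_lin_sqr 1 (-1) sf sg.
have -> : ip (fun x => 1 * f x + -1 * g x) (fun x => 1 * f x + -1 * g x) =
    ip (fun x => f x - g x) (fun x => f x - g x).
  by apply: eq_Rintegral => x _; ring.
by move=> ->; ring.
Qed.

Lemma cauchy_schwarz f g : sqint f -> sqint g -> ip f g ^+ 2 <= ip f f * ip g g.
Proof.
move=> sf sg.
have H (a b : R) : 0 <= a ^+ 2 * ip f f + 2 * (a * b) * ip f g + b ^+ 2 * ip g g.
  by rewrite -ip_lin_sqr// ip_ge0.
move: (ip_ge0 f) (ip_ge0 g) H.
move: (ip f f) (ip f g) (ip g g) => A B C A0 C0 H.
have [E|C1] := eqVneq C 0.
  rewrite E mulr0; have := H B (- (A + 1)); rewrite E mulr0 addr0 => H1.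
  have B2 := sqr_ge0 B; have := mulr_ge0 A0 B2; nra.
have Cp : 0 < C by rewrite lt_neqAle eq_sym C1.
have := H C (- B); nra.
Qed.

Lemma Rintegral_indic f (A : set T) : measurable A ->
  \int[mu]_(x in A) f x = ip f \1_A.
Proof.
move=> mA; rewrite Rintegral_mkcond; apply: eq_Rintegral => x _.
by rewrite patchE indicE; case: ifP => _; rewrite ?mulr1 ?mulr0.
Qed.

Lemma ip_indic (A : set T) : measurable A -> ip \1_A \1_A = fine (mu A).
Proof.
move=> mA; rewrite -Rintegral_indic// /Rintegral.
by rewrite integral_indic// setIid.
Qed.

Lemma ip1 f : ip f (fun=> 1) = \int[mu]_x f x.
Proof. by apply: eq_Rintegral => x _; rewrite mulr1. Qed.

(** The primitives of a density vary at most like the square root of the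
measure, with a constant that only involves the norm of the density. This yields
both the existence of their limits at infinity and the equicontinuity of the
primitives of all densities in a ball. *)
Lemma ip_indic_diff f (A B : set T) : sqint f -> measurable A -> measurable B ->
  A `<=` B ->
  (ip f \1_B - ip f \1_A) ^+ 2 <= ip f f * fine (mu (B `\` A)).
Proof.
move=> sf mA mB AB.
have mBA : measurable (B `\` A) by exact: measurableD.
have -> : ip f \1_B - ip f \1_A = ip f \1_(B `\` A).
  rewrite ![ip f _]ipC -ipBl; [|exact: sqint_indic|exact: sqint_indic|by []].
  apply: eq_Rintegral => x _; congr (_ * _); rewrite !indicE.
  have [xA|xA] := pselect (A x).
    by rewrite (mem_set xA) (mem_set (AB _ xA)) memNset ?subrr// => -[].
  rewrite [x \in A]memNset// subr0; congr (_%:R); congr nat_of_bool.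
  by apply/idP/idP => [/set_mem xB|/set_mem[xB _]]; apply/mem_set.
by rewrite -ip_indic//; apply: cauchy_schwarz => //; exact: sqint_indic.
Qed.

Lemma sqint_ipE f : sqint f -> (\int[mu]_x ((f x) ^+ 2)%:E)%E = (ip f f)%:E.
Proof.
move=> [mf if2]; rewrite /ip /Rintegral fineK; first by under [RHS]eq_integral do rewrite -expr2.
by under eq_integral do rewrite -expr2; exact: integrable_fin_num.
Qed.

End square_integrable.

Notation sqdist mu f g := (ip mu (fun x => f x - g x) (fun x => f x - g x)).

(** * Completeness of the space of square-integrable densities *)

Section limits_superior.
Context (R : realType).
Local Open Scope ereal_scope.

Lemma limn_esup_le_near (u : nat -> \bar R) c :
  (\forall n \near \oo, u n <= c) -> limn_esup u <= c.
Proof.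
move=> uc; rewrite /limn_esup limf_esupE.
apply: (@le_trans _ _ (ereal_sup (u @` [set n | u n <= c]))).
  by apply: ereal_inf_lbound; exists [set n | u n <= c].
by apply: ge_ereal_sup => _ [n nc <-].
Qed.

Lemma limn_einf_ge_near (u : nat -> \bar R) c :
  (\forall n \near \oo, c <= u n) -> c <= limn_einf u.
Proof.
move=> uc; rewrite /limn_einf leeNr; apply: limn_esup_le_near.
by apply: filterS uc => n; rewrite leeN2.
Qed.

End limits_superior.

Section completeness.
Context (R : realType) d (T : measurableType d) (mu : probability T R).
Local Notation ip := (ip mu).
Local Notation sqint := (sqint mu).

Lemma sqint_abs (f : T -> R) : sqint f -> sqint (fun x => `|f x|).
Proof.
move=> [mf if2]; split; first exact: measurableT_comp.
by rewrite (_ : (fun x => _) = (fun x => (f x ^+ 2)%:E))//; apply/funext => x; rewrite real_normK ?num_real.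
Qed.

Lemma integral_abs_le_L2 (f : T -> R) (b : R) : sqint f -> 0 <= b -> ip f f <= b ^+ 2 ->
  (\int[mu]_x `|f x|%:E <= b%:E)%E.
Proof.
move=> sf b0 fb; have sa := sqint_abs sf.
have := cauchy_schwarz sa (sqint_cst mu 1).
have -> : ip (fun x => `|f x|) (fun x => `|f x|) = ip f f.
  by apply: eq_Rintegral => x _; rewrite -expr2 real_normK ?num_real// expr2.
have -> : ip (fun=> 1) (fun=> 1) = 1.
  transitivity (1 * 1 * fine (mu setT)); first exact: Rintegral_cst.
  by rewrite probability_setT/= !mulr1.
rewrite mulr1 ip1 => h.
have i0 : 0 <= \int[mu]_x `|f x| by apply: Rintegral_ge0.
have {}h : \int[mu]_x `|f x| <= b by rewrite -(@ler_pXn2r _ 2)// ?nnegrE// (le_trans h).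
rewrite -lee_fin in h; apply: le_trans h; rewrite /Rintegral fineK//.
exact: integrable_fin_num (sqint_integrable sa).
Qed.

(** The increments have L1 norms at most 2 ^ - k, so the sum of their absolute
values is integrable, hence finite almost everywhere. *)
Lemma ae_cvg_fast_cauchy (g : nat -> T -> R) : (forall k, sqint (g k)) ->
  (forall k, sqdist mu (g k.+1) (g k) <= (16 ^+ k)^-1) ->
  {ae mu, forall x, cvgn (g ^~ x)}.
Proof.
move=> sg gk.
pose D k x : \bar R := (`|g k.+1 x - g k x|)%:E.
have sD k : sqint (fun x => g k.+1 x - g k x) by exact: sqintB.
have mD k : measurable_fun setT (D k).
  by apply/measurable_EFinP; have [] := sqint_abs (sD k).
have D0 k x : (0 <= D k x)%E by rewrite lee_fin.
have Dle k : (\int[mu]_x D k x <= (2^-1 ^+ k)%:E)%E.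
  apply: integral_abs_le_L2 => //.
  rewrite (le_trans (gk k))// -exprVn -exprM mulnC exprM.
  apply: lerXn2r; rewrite ?nnegrE ?sqr_ge0//.
  by rewrite expr2; lra.
have iD : (\int[mu]_x (\sum_(k <oo) D k x) <= 2%:E)%E.
  rewrite integral_nneseries//; apply: lime_le.
    by apply: is_cvg_nneseries => n _ _; exact: integral_ge0.
  apply: nearW => n.
  apply: (@le_trans _ _ (\sum_(0 <= k < n) (2^-1 ^+ k)%:E)%E).
    by apply: lee_sum => k _; exact: Dle.
  rewrite sumEFin lee_fin.
  suff -> : \sum_(0 <= k < n) 2^-1 ^+ k = 2 - 2 * 2^-1 ^+ n :> R.
    by rewrite gerBl mulr_ge0// exprn_ge0.
  elim: n => [|n IH]; first by rewrite big_geq// expr0 mulr1 subrr.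
  by rewrite big_nat_recr//= IH exprS; field; rewrite ?expf_neq0.
have intD : mu.-integrable setT (fun x => \sum_(k <oo) D k x)%E.
  apply/integrableP; split.
    by apply: ge0_emeasurable_sum => // k x _ _; exact: mD.
  apply: (@le_lt_trans _ _ (\int[mu]_x (\sum_(k <oo) D k x))%E).
    rewrite le_eqVlt; apply/orP; left; apply/eqP; apply: eq_integral => x _.
    by rewrite gee0_abs// nneseries_ge0.
  by rewrite (le_lt_trans iD)// ltry.
have := integrable_ae measurableT intD.
apply: filterS => x /(_ I) fx.
have : cvgn (series (telescope (g ^~ x))).
  apply: normed_cvg; apply: nondecreasing_is_cvgn.
    by apply: nondecreasing_series => n _ _ /=; exact: normr_ge0.
  exists (fine (\sum_(k <oo) D k x)%E) => _ [n _ <-].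
  rewrite -lee_fin fineK// /series/= -sumEFin.
  by apply: nneseries_lim_ge => k _ _; exact: D0.
move=> /cvg_ex[l cl]; apply/cvg_ex; exists (l + g 0%N x).
rewrite (_ : g ^~ x = fun n => series (telescope (g ^~ x)) n + g 0%N x).
  by apply: cvgD => //; exact: cvg_cst.
by apply/funext => n; rewrite [LHS](eq_sum_telescope (g ^~ x)) addrC.
Qed.

(** Riesz-Fischer theorem: a rapidly Cauchy subsequence converges almost
everywhere, and Fatou's lemma transfers the Cauchy estimate to its limit. Taking an
upper limit everywhere makes the limit function measurable. *)
Lemma sqint_complete (f : nat -> T -> R) : (forall k, sqint (f k)) ->
  (forall e : R, 0 < e -> exists N, forall m n, (N <= m)%N -> (N <= n)%N ->
     sqdist mu (f m) (f n) <= e) ->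
  exists2 g, sqint g & forall e : R, 0 < e -> exists N, forall m, (N <= m)%N ->
     sqdist mu (f m) g <= e.
Proof.
move=> sf cf.
have /choice[N NP] k : exists N, forall m n, (N <= m)%N -> (N <= n)%N ->
     sqdist mu (f m) (f n) <= (16 ^+ k)^-1.
  by apply: cf; rewrite invr_gt0 exprn_gt0.
(* The sum makes phi monotone and at least N k, the term k makes it unbounded. *)
pose phi k := (k + \sum_(i < k.+1) N i)%N.
have phiN k : (N k <= phi k)%N.
  by rewrite /phi big_ord_recr/= addnA leq_addl.
have phiS k : (phi k <= phi k.+1)%N.
  by rewrite /phi (big_ord_recr k.+1)/= addSn addnA leqW// leq_addr.
pose g k := f (phi k).
have cg : {ae mu, forall x, cvgn (g ^~ x)}.
  apply: ae_cvg_fast_cauchy => k; first exact: sf.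
  by apply: NP; rewrite ?(leq_trans (phiN k))// phiS.
have mg k : measurable_fun setT (g k) by have [] := sf (phi k).
pose G x := fine (limn_esup (fun k => (g k x)%:E)).
have mG : measurable_fun setT G.
  apply: (measurableT_comp (fine_measurable _)) => //.
  by apply: measurable_fun_limn_esup => k; apply/measurable_EFinP; exact: mg.
have GE x : cvgn (g ^~ x) -> (g ^~ x) @ \oo --> G x.
  move=> /cvg_ex[l gl]; have gl' : (fun k => (g k x)%:E) @ \oo --> l%:E.
    by apply: cvg_EFin => //; apply: nearW.
  rewrite /G is_cvg_limn_esupE; last by apply/cvg_ex; exists l%:E.
  by rewrite (cvg_lim _ gl').
have key m e : 0 < e -> (\forall l \near \oo, sqdist mu (f m) (g l) <= e) ->
    (\int[mu]_x ((f m x - G x) ^+ 2)%:E <= e%:E)%E.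
  move=> e0 fe.
  pose h l x : \bar R := ((f m x - g l x) ^+ 2)%:E.
  have mfm : measurable_fun setT (f m) by have [] := sf m.
  have mh l : measurable_fun setT (h l).
    by apply/measurable_EFinP; apply: measurable_funX; exact: measurable_funB.
  have h0 l x : setT x -> (0 <= h l x)%E by rewrite lee_fin sqr_ge0.
  apply: (@le_trans _ _ (\int[mu]_x (limn_einf (h ^~ x)))%E).
    apply: ae_ge0_le_integral => //.
    - by move=> x _; rewrite lee_fin sqr_ge0.
    - by apply/measurable_EFinP; apply: measurable_funX; exact: measurable_funB.
    - by move=> x _; apply: limn_einf_ge_near; apply: nearW => l; exact: h0.
    - apply: (@measurableT_comp _ _ _ _ _ _ -%E) => //.
      apply: (@measurable_fun_limn_esup _ _ _ _ (fun l x => - h l x)%E) => l.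
      exact: measurableT_comp.
    apply: filterS cg => x /GE gx _.
    have hx : h ^~ x @ \oo --> ((f m x - G x) ^+ 2)%:E.
      apply: cvg_EFin; first exact: nearW.
      have c1 : (f m x - g l x) @[l --> \oo] --> f m x - G x.
        by apply: cvgB => //; exact: cvg_cst.
      exact: (cvgM c1 c1).
    by rewrite is_cvg_limn_einfE ?(cvg_lim _ hx)//; apply/cvg_ex; exists ((f m x - G x) ^+ 2)%:E.
  apply: (le_trans (fatou _ _ mh h0)) => //.
  rewrite (le_trans (limn_einf_sup _))//.
  apply: limn_esup_le_near; apply: filterS fe => l le.
  have s : sqint (fun x => f m x - g l x) by apply: sqintB; exact: sf.
  by rewrite /h (sqint_ipE s) lee_fin.
have nearphi m e : (forall n, (m <= n)%N -> sqdist mu (f m) (f n) <= e) ->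
    \forall l \near \oo, sqdist mu (f m) (g l) <= e.
  move=> H; exists m => // l /= ml; apply: H; rewrite (leq_trans ml)// /phi leq_addr//.
have sfG m e : 0 < e -> (\forall l \near \oo, sqdist mu (f m) (g l) <= e) ->
    sqint (fun x => f m x - G x).
  move=> e0 H; split; first by apply: measurable_funB => //; have [] := sf m.
  apply/integrableP; split.
    apply/measurable_EFinP; apply: measurable_funX; apply: measurable_funB => //.
    by have [] := sf m.
  rewrite (le_lt_trans _ (ltry e))// (le_trans _ (key m e e0 H))//.
  rewrite le_eqVlt; apply/orP; left; apply/eqP; apply: eq_integral => x _.
  by rewrite gee0_abs// lee_fin sqr_ge0.
have [N1 N1P] := cf 1 ltr01.
have s1 : sqint (fun x => f N1 x - G x).
  by apply: (sfG N1 1) => //; apply: nearphi => n; exact: N1P.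
have sG : sqint G.
  have := sqintB (sf N1) s1; rewrite (_ : (fun x => _) = G)//.
  by apply/funext => x; ring.
exists G => // e e0; have [N0 N0P] := cf e e0; exists N0 => m N0m.
have H : \forall l \near \oo, sqdist mu (f m) (g l) <= e.
  by apply: nearphi => n mn; apply: N0P => //; exact: leq_trans mn.
by rewrite -lee_fin -sqint_ipE; [exact: key|exact: sqintB].
Qed.

End completeness.

(** * Deviations of the empirical measure on finitely many sets *)

Section empirical_deviations.
Context (R : realType) d d' (Om : measurableType d) (T : measurableType d').
Context (P : probability Om R) (mu : probability T R) (Z : nat -> Om -> T).
Local Notation ip := (ip mu).
Local Notation sqint := (sqint mu).

(** The deviation of the empirical measure from [mu], multiplied by
sqrt n / a. *)
Definition dev (a : R) n w (A : set T) : R :=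
  (\sum_(i < n) (\1_A (Z i w) - fine (mu A))) / (a * Num.sqrt n%:R).

Lemma devE a n w A :
  dev a n w A = (\sum_(i < n) (\1_A (Z i w) - fine (mu A))) / (a * Num.sqrt n%:R).
Proof. by []. Qed.

Lemma sqint_sum (I : Type) (s : seq I) (th : I -> R) (g : I -> T -> R) :
  (forall i, sqint (g i)) -> sqint (fun x => \sum_(i <- s) th i * g i x).
Proof.
move=> sg; elim: s => [|i s IH].
  by under eq_fun do rewrite big_nil; exact: sqint_cst.
under eq_fun do rewrite big_cons -[X in _ + X]mul1r.
exact: sqint_lin.
Qed.

Lemma ip_sumr (I : Type) (s : seq I) (th : I -> R) (g : I -> T -> R) f :
  (forall i, sqint (g i)) -> sqint f ->
  ip f (fun x => \sum_(i <- s) th i * g i x) = \sum_(i <- s) th i * ip f (g i).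
Proof.
move=> sg sf; elim: s => [|i s IH].
  rewrite big_nil; transitivity (\int[mu]_(x in setT) (0 : R)); last first.
    by rewrite Rintegral_cst// mul0r.
  by apply: eq_Rintegral => x _; rewrite big_nil mulr0.
rewrite big_cons -IH [in RHS]ipC [X in _ + X]ipC.
rewrite -[X in _ + X]mul1r -ip_linl//; last exact: sqint_sum.
by rewrite ipC; apply: eq_Rintegral => x _; rewrite big_cons mul1r.
Qed.

Hypothesis mZ : forall i, measurable_fun setT (Z i).
Hypothesis iidZ : iid_with_law P Z mu.
Context (N : nat) (S : 'I_N -> set T).
Hypothesis mS : forall j, measurable (S j).

Let K : finType := {ffun 'I_N -> bool}.
(** The deviations on the [S j] depend on an observation only through the list
of the sets that contain it. *)
Let kap (z : T) : K := [ffun j => z \in S j].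
Let h (j : 'I_N) (k : K) : R := (k j)%:R - fine (mu (S j)).
Let pi := code_law mu kap.

Let mkap k : measurable (kap @^-1` [set k]).
Proof.
rewrite (_ : _ @^-1` _ = \bigcap_(j in [set: 'I_N]) (if k j then S j else ~` S j)).
  apply: fin_bigcap_measurable => // j _; case: ifP => _ //; exact: measurableC.
apply/seteqP; split => [z <- j _|z H] /=.
  by rewrite ffunE; case: ifPn => [/set_mem//|/negP zS] /mem_set.
apply/ffunP => j; rewrite ffunE; have := H j I.
by case: ifP => _ zS; [exact: mem_set|exact: memNset].
Qed.

Let pi_ge0 := code_law_ge0 mu kap.
Let pi_sum1 : \sum_k pi k = 1 := sum_code_law mu mkap.

Let h_kap j z : h j (kap z) = \1_(S j) z - fine (mu (S j)).
Proof. by rewrite /h ffunE indicE. Qed.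

Let stat_kap a n w j :
  stat h a [ffun i : 'I_n => kap (Z i w)] j = dev a n w (S j).
Proof.
by rewrite /stat /dev; congr (_ / _); apply: eq_bigr => i _; rewrite ffunE h_kap.
Qed.

Let Rintegral_kap (phi : K -> R) : \int[mu]_z phi (kap z) = \sum_k pi k * phi k.
Proof. by rewrite /Rintegral integral_code. Qed.

Let sqint_kap (phi : K -> R) : sqint (phi \o kap).
Proof.
apply: (@sqint_bounded _ _ _ _ _ (\sum_k `|phi k|)).
  by apply/measurable_EFinP; have /integrableP[] := integrable_code mu mkap phi.
by move=> z; rewrite (bigD1 (kap z))//= lerDl sumr_ge0.
Qed.

Let ip_centered f j : sqint f -> \int[mu]_z f z = 0 ->
  ip f (h j \o kap) = ip f \1_(S j).
Proof.
move=> sf f0.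
have -> : ip f (h j \o kap) = ip f (fun z => \1_(S j) z - fine (mu (S j)) * 1).
  by apply: eq_Rintegral => z _; rewrite /= h_kap mulr1.
have := @ip_linl _ _ _ mu \1_(S j) (fun=> 1) f 1 (- fine (mu (S j)))
  (sqint_indic mu (mS j)) (sqint_cst mu 1) sf.
rewrite ![ip _ f]ipC ip1 f0 mulr0 addr0 mul1r => <-.
by apply: eq_Rintegral => z _; congr (_ * _); ring.
Qed.

Let h_centered j : \sum_k pi k * h j k = 0.
Proof.
rewrite -Rintegral_kap.
have -> : \int[mu]_z h j (kap z) = \int[mu]_z (\1_(S j) z - fine (mu (S j)) * 1).
  by apply: eq_Rintegral => z _; rewrite /= h_kap mulr1.
rewrite RintegralB//; first last.
- exact: sqint_integrable (sqint_cst mu _).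
- exact: sqint_integrable (sqint_indic mu _).
have -> : \int[mu]_x (fine (mu (S j)) * 1) = fine (mu (S j)) * 1 * fine (mu setT).
  exact: Rintegral_cst.
rewrite probability_setT !mulr1 /Rintegral.
by rewrite integral_indic// setIT subrr.
Qed.

Let density (th : 'I_N -> R) := lincomb h th \o kap.

Let density_centered th : \int[mu]_z density th z = 0.
Proof. by rewrite Rintegral_kap; exact: lincomb_centered. Qed.

Let ip_density th j : ip (density th) \1_(S j) = gramv pi h th j.
Proof.
rewrite -(ip_centered j (sqint_kap _) (density_centered th)).
by rewrite ipE (Rintegral_kap (fun k => lincomb h th k * h j k)) -gramvE.
Qed.

Let ip_density_density th : ip (density th) (density th) = gramq pi h th.
Proof.
rewrite ipE (Rintegral_kap (fun k => lincomb h th k * lincomb h th k)) gramqE.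
by under eq_bigr do rewrite -expr2.
Qed.

(** The density attached to [th] has integral [gramv pi h th j] over [S j] and
squared norm [gramq pi h th], which translates the ellipsoid of [stat_upper] into
a ball of centred densities. *)
Lemma deviations_upper (l dl M eta : R) : 0 <= l -> 0 < dl -> 0 < M -> 0 < eta ->
  moderately (fun n a => holds_but P (expR (- (a ^+ 2 * (l - eta)))) (fun w =>
    (forall j, `|dev a n w (S j)| <= M) ->
      exists gam, [/\ sqint gam, \int[mu]_z gam z = 0, ip gam gam / 2 <= l &
        forall j, `|dev a n w (S j) - ip gam \1_(S j)| <= dl])).
Proof.
move=> l0 dl0 M0 eta0.
apply: moderately_imp (stat_upper pi_ge0 pi_sum1 h_centered l0 dl0 M0 eta0) => n a n0 a0 H.
pose Q (k : {ffun 'I_n -> K}) := `[< (forall j, `|stat h a k j| <= M) /\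
  forall th, gramq pi h th / 2 <= l -> exists j, dl < `|stat h a k j - gramv pi h th j| >].
have [mB PB] := iid_code_event mZ iidZ mkap Q.
eexists; split; [exact: mB|rewrite PB lee_fin; exact: H|].
move=> w nQ wM.
have [th [thl thdl]] : exists th, gramq pi h th / 2 <= l /\
    forall j, `|dev a n w (S j) - gramv pi h th j| <= dl.
  apply: contrapT => nth; apply: nQ; apply/asboolP; split; first by move=> j; rewrite stat_kap.
  move=> th thl; apply: contrapT => nj; apply: nth; exists th; split => // j.
  by rewrite leNgt; apply/negP => jd; apply: nj; exists j; rewrite stat_kap.
exists (density th); split.
- exact: sqint_kap.
- exact: density_centered.
- by rewrite ip_density_density.
- by move=> j; rewrite ip_density.
Qed.

(** [gam] is replaced by the density attached to the solution [th] of the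
regularized normal equations: it is not longer than [gam], by expanding the squared
norm of the difference, and its integral over [S j] differs from that of [gam] by
[eps * th j] only. *)
Lemma deviations_lower gam (dl eta : R) : sqint gam -> \int[mu]_z gam z = 0 ->
  0 < dl -> 0 < eta ->
  moderately (fun n a => exists B, [/\ measurable B,
    ((expR (- (a ^+ 2 * (ip gam gam / 2 + eta))))%:E <= P B)%E &
    forall w, B w -> forall j, `|dev a n w (S j) - ip gam \1_(S j)| <= dl]).
Proof.
move=> sg g0 dl0 eta0.
pose q := ip gam gam.
have q0 : 0 <= q by exact: ip_ge0.
(* Expanding |gam - density th|^2 gives eps * |th|^2 <= q / 2, so that (eps * th j)^2 is at
   most eps * q / 2, hence at most (dl / 2)^2. *)
pose eps := dl ^+ 2 / (2 * (q + 1)).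
have eps0 : 0 < eps by rewrite divr_gt0 ?exprn_gt0 ?mulr_gt0 ?ltr_wpDl.
have G0 := gramq_ge0 pi_ge0 h.
have [th thP] := tikhonov (fun j => ip gam \1_(S j)) G0 eps0.
have E : ip gam (density th) = gramq pi h th + eps * \sum_j th j ^+ 2.
  rewrite /density /lincomb.
  have -> : ip gam ((fun x => \sum_j th j * h j x) \o kap) =
     ip gam (fun x => \sum_j th j * (h j \o kap) x) by [].
  rewrite (ip_sumr _ _ (fun j => sqint_kap (h j)) sg).
  rewrite gramq_gramv mulr_sumr -big_split/=; apply: eq_bigr => j _.
  by rewrite ip_centered// -thP -/(gramv pi h th j); ring.
have le2 : gramq pi h th + 2 * (eps * \sum_j th j ^+ 2) <= q.
  have := ip_ge0 mu (fun x => gam x - density th x).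
  rewrite ipB_sqr//; last exact: sqint_kap.
  by rewrite E ip_density_density -/q; lra.
have s0 : 0 <= \sum_j th j ^+ 2 by apply: sumr_ge0 => j _; exact: sqr_ge0.
have thq : gramq pi h th <= q.
  have : 0 <= eps * \sum_j th j ^+ 2 by rewrite mulr_ge0// ltW.
  lra.
have close j : `|gramv pi h th j - ip gam \1_(S j)| <= dl / 2.
  rewrite -thP -/(gramv pi h th j) opprD addrA subrr sub0r normrN.
  rewrite -(@ler_pXn2r _ 2)// ?nnegrE ?divr_ge0 ?(ltW dl0)//.
  rewrite real_normK ?num_real//.
  have thj : th j ^+ 2 <= \sum_j th j ^+ 2.
    by rewrite (bigD1 j)//= lerDl sumr_ge0// => i _; exact: sqr_ge0.
  have e1 : eps * (2 * (q + 1)) = dl ^+ 2 by rewrite /eps; field; lra.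
  have e2 : eps * (2 * th j ^+ 2) <= q + 1.
    have : eps * th j ^+ 2 <= eps * \sum_j th j ^+ 2 by rewrite ler_wpM2l// ltW.
    have := G0 th; rewrite -/(gramq pi h th); lra.
  have e3 : eps * (eps * (2 * th j ^+ 2)) <= eps * (q + 1) by rewrite ler_wpM2l// ltW.
  by move: (eps) e1 e3 => ep; lra.
have dl20 : 0 < dl / 2 by rewrite divr_gt0.
apply: moderately_imp (stat_lower pi_ge0 pi_sum1 h_centered th dl20 eta0) => n a n0 a0 H.
pose Q (k : {ffun 'I_n -> K}) := [forall j, `|stat h a k j - gramv pi h th j| <= dl / 2].
have [mB PB] := iid_code_event mZ iidZ mkap Q.
eexists; split; [exact: mB|rewrite PB lee_fin|].
  apply: le_trans H; rewrite ler_expR lerN2.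
  by rewrite ler_wpM2l ?sqr_ge0// lerD2r ler_wpM2r.
move=> w /forallP Qw j; have := Qw j; rewrite stat_kap => Qj.
have := ler_distD (gramv pi h th j) (dev a n w (S j)) (ip gam \1_(S j)).
have := close j; lra.
Qed.

End empirical_deviations.

(** * Bernstein bound for one set *)

Section deviation_tail.
Context (R : realType) d d' (Om : measurableType d) (T : measurableType d').
Context (P : probability Om R) (mu : probability T R) (Z : nat -> Om -> T).
Hypothesis mZ : forall i, measurable_fun setT (Z i).
Hypothesis iidZ : iid_with_law P Z mu.
Local Notation dev := (dev mu Z).

Lemma dev_setD a n w (A B : set T) : measurable A -> measurable B -> A `<=` B ->
  dev a n w B - dev a n w A = dev a n w (B `\` A).
Proof.
move=> mA mB AB.
have mBA : measurable (B `\` A) by exact: measurableD.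
rewrite !devE -mulrBl -sumrB; congr (_ / _); apply: eq_bigr => i _.
have -> : fine (mu B) = fine (mu A) + fine (mu (B `\` A)).
  rewrite -fineD ?fin_num_measure// -measureU//; last first.
    by apply/seteqP; split => // x [Ax [_]].
  by rewrite setDUK.
have -> : \1_B (Z i w) = \1_A (Z i w) + \1_(B `\` A) (Z i w) :> R.
  rewrite !indicE; have [xA|xA] := pselect (A (Z i w)).
    rewrite (mem_set xA) (mem_set (AB _ xA)) [_ \in B `\` A]memNset ?addr0//.
    by move=> -[].
  rewrite [_ \in A]memNset// add0r; congr (_%:R); congr nat_of_bool.
  by apply/idP/idP => [/set_mem xB|/set_mem[xB _]]; apply/mem_set.
ring.
Qed.

(** Bernstein bound: membership in [D] is a Bernoulli variable of variance at
most [V], and [expR_le_quad] bounds its moment generating function as long as the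
exponent [rho * a / sqrt n] is at most 1. *)
Lemma dev_tail (D : set T) (V rho eta a : R) n : measurable D -> fine (mu D) <= V ->
  (0 < n)%N -> 0 < a -> 0 <= rho -> rho * (a / Num.sqrt n%:R) <= 1 ->
  holds_but P (2 * expR (a ^+ 2 * (2 * V * rho ^+ 2 - rho * eta)))
    (fun w => `|dev a n w D| <= eta).
Proof.
move=> mD DV n0 a0 rho0 rhot.
set m := fine (mu D).
have m0 : 0 <= m by rewrite fine_ge0.
have m1 : m <= 1 by rewrite -lee_fin fineK ?fin_num_measure// probability_le1.
pose kap z : bool := z \in D.
pose pi := code_law mu kap.
have mkap (b : bool) : measurable (kap @^-1` [set b]).
  rewrite (_ : _ @^-1` _ = if b then D else ~` D).
    by case: b => //; exact: measurableC.
  apply/seteqP; split => z /=.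
    by rewrite /kap; case: b => [/set_mem//|/negbT/negP zD /mem_set].
  by case: b => zD; [exact: mem_set|exact: memNset].
have pi0 : forall b, 0 <= pi b by exact: code_law_ge0.
have pi1 := sum_code_law mu mkap.
pose h (b : bool) : R := b%:R - m.
have piE (phi : bool -> R) : \sum_b pi b * phi b = phi true * m + phi false * (1 - m).
  have pt : pi true = m.
    rewrite /pi /code_law /m; congr (fine (mu _)).
    by apply/seteqP; split => z /=; [exact: set_mem|exact: mem_set].
  have pf : pi false = 1 - m by move: pi1; rewrite big_bool/= -/pi pt => <-; ring.
  by rewrite big_bool/= pt pf mulrC [X in _ + X]mulrC.
have tail (s : bool) : \sum_(k : {ffun 'I_n -> bool} |
      eta * (a * Num.sqrt n%:R) < (-1) ^+ s * \sum_i h (k i)) weight pi k <=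
    expR (a ^+ 2 * (2 * V * rho ^+ 2 - rho * eta)).
  have sn0 : 0 < Num.sqrt (n%:R : R) by rewrite sqrtr_gt0 ltr0n.
  pose lam := rho * (a / Num.sqrt n%:R).
  have lam0 : 0 <= lam by rewrite mulr_ge0// divr_ge0// ltW.
  have := @chernoff _ _ _ pi0 n (fun b => (-1) ^+ s * h b) lam
    (eta * (a * Num.sqrt n%:R))
    (fun k => eta * (a * Num.sqrt n%:R) < (-1) ^+ s * \sum_i h (k i)) lam0.
  move=> /(_ _)/le_trans; apply; first by move=> k; rewrite mulr_sumr => /ltW.
  have hs b : `|lam * ((-1) ^+ s * h b)| <= 1.
    rewrite normrM (ger0_norm lam0) normrM normrX normrN1 expr1n mul1r.
    rewrite (le_trans _ rhot)// ler_piMr// /h ler_norml.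
    by case: b; apply/andP; split => /=; lra.
  have mgf : \sum_b pi b * expR (lam * ((-1) ^+ s * h b)) <= expR (2 * V * lam ^+ 2).
    apply: (@le_trans _ _ (1 + 2 * V * lam ^+ 2)); last exact: expR_ge1Dx.
    apply: (@le_trans _ _ (\sum_b pi b * (1 + lam * ((-1) ^+ s * h b) +
        2 * (lam * ((-1) ^+ s * h b)) ^+ 2))).
      by apply: ler_sum => b _; rewrite ler_wpM2l// expR_le_quad.
    rewrite piE /h/=.
    have -> : (1 + lam * ((-1) ^+ s * (1 - m)) +
         2 * (lam * ((-1) ^+ s * (1 - m))) ^+ 2) * m +
        (1 + lam * ((-1) ^+ s * (0 - m)) +
         2 * (lam * ((-1) ^+ s * (0 - m))) ^+ 2) * (1 - m) =
        1 + 2 * (lam ^+ 2 * ((-1) ^+ s) ^+ 2 * (m * (1 - m))) by ring.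
    rewrite -exprM mulnC exprM sqrrN !expr1n mulr1 lerD2l -mulrA ler_wpM2l//.
    rewrite mulrC ler_wpM2r ?sqr_ge0//.
    by rewrite (le_trans _ DV)// -/m ler_piMr//; lra.
  have mgf0 : 0 <= \sum_b pi b * expR (lam * ((-1) ^+ s * h b)).
    by apply: sumr_ge0 => b _; rewrite mulr_ge0 ?expR_ge0.
  apply: (@le_trans _ _ (expR (- (lam * (eta * (a * Num.sqrt n%:R)))) *
     expR (2 * V * lam ^+ 2) ^+ n)).
    by rewrite ler_wpM2l ?expR_ge0// lerXn2r ?nnegrE ?expR_ge0.
  rewrite -expRM_natl -expRD ler_expR le_eqVlt; apply/orP; left; apply/eqP.
  have nE : n%:R = Num.sqrt (n%:R : R) ^+ 2 by rewrite sqr_sqrtr.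
  by rewrite [in n%:R * _]nE /lam; field; rewrite lt0r_neq0.
pose Q (k : {ffun 'I_n -> bool}) :=
  eta * (a * Num.sqrt n%:R) < `|\sum_i h (k i)|.
have [mB PB] := iid_code_event mZ iidZ mkap Q.
eexists; split; [exact: mB| |].
  rewrite PB lee_fin.
  have -> : 2 * expR (a ^+ 2 * (2 * V * rho ^+ 2 - rho * eta)) =
     expR (a ^+ 2 * (2 * V * rho ^+ 2 - rho * eta)) +
     expR (a ^+ 2 * (2 * V * rho ^+ 2 - rho * eta)) by ring.
  apply: (le_trans _ (lerD (tail false) (tail true))).
  rewrite big_mkcond [X in _ <= X + _]big_mkcond [X in _ <= _ + X]big_mkcond -big_split/=.
  apply: ler_sum => k _; rewrite /Q.
  rewrite expr0 mul1r expr1 mulN1r lter_normr.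
  have w0 := weight_ge0 pi0 k.
  by case: (_ < _) => /=; case: (_ < _); rewrite /= ?addr0 ?add0r// lerDl.
move=> w /negP; rewrite -leNgt.
under eq_bigr do rewrite ffunE.
have an0 : 0 < a * Num.sqrt (n%:R : R) by rewrite mulr_gt0// sqrtr_gt0 ltr0n.
rewrite !devE normrM normfV (gtr0_norm an0) ler_pdivrMr//.
Qed.

End deviation_tail.

(** * Chaining over grids *)

Section dyadic_chaining.
Context (R : realType).

(** Grids of mesh 16 ^ - k on the unit interval: [cell k s] is the index of the
last node of level [k] before [s]. *)
Definition cell k (s : R) : nat := Num.truncn (16 ^+ k * s).
Definition node k (i : nat) : R := i%:R / 16 ^+ k.

Let p16 k : 0 < 16 ^+ k :> R. Proof. by rewrite exprn_gt0. Qed.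

Lemma cellP k s : 0 <= s -> node k (cell k s) <= s < node k (cell k s).+1.
Proof.
move=> s0; have /truncn_itv/andP[h1 h2] : 0 <= 16 ^+ k * s by rewrite mulr_ge0// ltW.
by rewrite /node ler_pdivrMr// ltr_pdivlMr// mulrC h1 h2.
Qed.

Lemma node_le k i j : (node k i <= node k j) = (i <= j)%N.
Proof. by rewrite /node ler_pM2r ?invr_gt0// ler_nat. Qed.

Lemma node_lt k i j : (node k i < node k j) = (i < j)%N.
Proof. by rewrite /node ltr_pM2r ?invr_gt0// ltr_nat. Qed.

Lemma node_ge0 k i : 0 <= node k i.
Proof. by rewrite /node divr_ge0// ltW. Qed.

Lemma node1 k : node k (16 ^ k) = 1.
Proof. by rewrite /node natrX divff// lt0r_neq0. Qed.

Lemma cell_le k s : 0 <= s -> s <= 1 -> (cell k s <= 16 ^ k)%N.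
Proof.
by move=> s0 s1; rewrite -(node_le k) node1 (le_trans _ s1)//; have /andP[] := cellP k s0.
Qed.

Lemma nodeS k i : node k i = node k.+1 (16 * i).
Proof. by rewrite /node natrM exprS; field; rewrite lt0r_neq0. Qed.

Lemma cellS k s : 0 <= s -> (16 * cell k s <= cell k.+1 s < 16 * cell k s + 16)%N.
Proof.
move=> s0; have /andP[a1 a2] := cellP k s0; have /andP[b1 b2] := cellP k.+1 s0.
apply/andP; split.
  by rewrite -ltnS -(node_lt k.+1) -nodeS (le_lt_trans a1).
by rewrite addnC -mulnS -(node_lt k.+1) -nodeS (le_lt_trans b1).
Qed.

Lemma cell_close k s s' : 0 <= s -> 0 <= s' -> `|s - s'| <= (16 ^+ k)^-1 ->
  (cell k s <= (cell k s').+1)%N.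
Proof.
move=> s0 s0' ss; have /andP[a1 a2] := cellP k s0; have /andP[b1 b2] := cellP k s0'.
rewrite -ltnS -(node_lt k) (le_lt_trans a1)//.
have -> : node k (cell k s').+2 = node k (cell k s').+1 + (16 ^+ k)^-1.
  by rewrite /node -[_.+2]addn1 natrD mulrDl mul1r.
move: ss; rewrite ler_norml => /andP[_]; lra.
Qed.

Lemma leq_minnD16 i j : (i <= j.+1)%N -> (i <= minn i j + 16)%N.
Proof.
rewrite addn_minl leq_min leq_addr => /leq_trans -> //.
by rewrite -addn1 leq_add2l.
Qed.

(** Values of [g] are compared with its values at the nodes below the arguments.
Passing from level [k] to level [k - 1] costs [eta / 2 ^ k], so the steps from [K]
to [k0] add up to at most [eta]. Below the last level, [g] is controlled by an upper and a
lower node: there the increments are monotone up to a drift of slope [om], which is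
negligible at the mesh of level [K]. Two close points have neighbouring nodes of
level [k0], which are compared through the smaller of the two. *)
Lemma chaining (g : R -> R -> R) (eta om : R) k0 K : 0 <= eta -> 0 <= om -> (k0 <= K)%N ->
  (forall k i i' j j', (k0 <= k <= K)%N ->
    (i <= i' <= i + 16)%N -> (i' <= 16 ^ k)%N ->
    (j <= j' <= j + 16)%N -> (j' <= 16 ^ k)%N ->
    `|g (node k i') (node k j') - g (node k i) (node k j)| <= eta / 2 ^+ k) ->
  (forall s s1 s' t t1 t', 0 <= s -> s <= s1 -> s1 <= s' -> s' <= 1 ->
     0 <= t -> t <= t1 -> t1 <= t' -> t' <= 1 ->
    `|g s1 t1 - g s t| <= `|g s' t' - g s t| + om * ((s' - s) + (t' - t))) ->
  om * (2 / 16 ^+ K) <= eta ->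
  forall s s' t t', 0 <= s <= 1 -> 0 <= s' <= 1 -> 0 <= t <= 1 -> 0 <= t' <= 1 ->
    `|s - s'| <= (16 ^+ k0)^-1 -> `|t - t'| <= (16 ^+ k0)^-1 ->
    `|g s t - g s' t'| <= 8 * eta.
Proof.
move=> eta0 om0 kK lev br omK.
pose G k s t := g (node k (cell k s)) (node k (cell k t)).
have half k : eta / 2 ^+ k <= eta.
  by rewrite ler_pdivrMr ?exprn_gt0// ler_peMr// exprn_ege1// ler1n.
have chain m s t : (k0 + m <= K)%N -> 0 <= s <= 1 -> 0 <= t <= 1 ->
    `|G (k0 + m)%N s t - G k0 s t| <= eta * ((2 ^+ k0)^-1 - (2 ^+ (k0 + m))^-1).
  move=> + /andP[s0 s1] /andP[t0 t1]; elim: m => [|m IH] mK.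
    by rewrite addn0 !subrr normr0 mulr0.
  have step : `|G (k0 + m).+1 s t - G (k0 + m)%N s t| <= eta / 2 ^+ (k0 + m).+1.
    rewrite /G (nodeS (k0 + m) (cell (k0 + m) s)) (nodeS (k0 + m) (cell (k0 + m) t)).
    have /andP[cs1 cs2] := cellS (k0 + m) s0; have /andP[ct1 ct2] := cellS (k0 + m) t0.
    apply: lev; rewrite ?cell_le// ?cs1 ?ct1 ?(ltnW cs2) ?(ltnW ct2)//.
    by rewrite -addnS mK leq_addr.
  have := IH (leq_trans (leq_add (leqnn _) (leqnSn _)) mK).
  have := ler_distD (G (k0 + m)%N s t) (G (k0 + m).+1 s t) (G k0 s t).
  rewrite addnS.
  have e1 : (2 ^+ (k0 + m))^-1 = 2 * (2 ^+ (k0 + m).+1)^-1 :> R.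
    by rewrite exprS; field; rewrite expf_neq0.
  by rewrite e1; lra.
have close s t : 0 <= s <= 1 -> 0 <= t <= 1 -> `|g s t - G k0 s t| <= 3 * eta.
  move=> /[dup] s01 /andP[s0 s1] /[dup] t01 /andP[t0 t1].
  have c1 : `|G K s t - G k0 s t| <= eta.
    have := @chain (K - k0)%N s t; rewrite subnKC// => /(_ (leqnn _) s01 t01) /le_trans; apply.
    rewrite ler_piMr//.
    have : 0 <= (2 ^+ K)^-1 :> R by rewrite invr_ge0 exprn_ge0.
    have : (2 ^+ k0)^-1 <= 1 :> R by rewrite invf_le1 ?exprn_gt0// exprn_ege1// ler1n.
    lra.
  have up r : 0 <= r -> r <= 1 -> [/\ r <= node K (minn (cell K r).+1 (16 ^ K)),
      node K (minn (cell K r).+1 (16 ^ K)) <= 1,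
      (cell K r <= minn (cell K r).+1 (16 ^ K) <= cell K r + 16)%N &
      node K (minn (cell K r).+1 (16 ^ K)) - node K (cell K r) <= (16 ^+ K)^-1].
    move=> r0 r1; have /andP[a1 a2] := cellP K r0; split.
    - by rewrite /minn; case: ifP => _; rewrite ?node1// ltW.
    - by rewrite -(node1 K) node_le geq_minr.
    - rewrite leq_min leqnSn cell_le//= geq_min -addn1 leq_add2l//.
    - apply: (@le_trans _ _ (node K (cell K r).+1 - node K (cell K r))).
        by rewrite lerD2r node_le geq_minl.
      by rewrite /node -mulrBl -natrB// subSnn mul1r.
  have [us1 us2 us3 us4] := up s s0 s1; have [ut1 ut2 ut3 ut4] := up t t0 t1.
  have /andP[cs _] := cellP K s0; have /andP[ct _] := cellP K t0.
  have := br _ _ _ _ _ _ (node_ge0 _ _) cs us1 us2 (node_ge0 _ _) ct ut1 ut2.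
  rewrite -/(G K s t) => c2.
  have c3 : `|g (node K (minn (cell K s).+1 (16 ^ K))) (node K (minn (cell K t).+1 (16 ^ K)))
     - G K s t| <= eta / 2 ^+ K.
    by apply: lev; rewrite ?kK ?leqnn ?geq_minr.
  have c4 : om * (node K (minn (cell K s).+1 (16 ^ K)) - node K (cell K s) +
     (node K (minn (cell K t).+1 (16 ^ K)) - node K (cell K t))) <= eta.
    by apply: le_trans omK; rewrite ler_wpM2l//; lra.
  have := ler_distD (G K s t) (g s t) (G k0 s t); have := half K; lra.
move=> s s' t t' s01 s01' t01 t01' ss tt.
have [/andP[s0 s1] /andP[s0' s1'] /andP[t0 t1] /andP[t0' t1']] := And4 s01 s01' t01 t01'.
pose im := minn (cell k0 s) (cell k0 s'); pose it := minn (cell k0 t) (cell k0 t').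
have m1 : `|G k0 s t - g (node k0 im) (node k0 it)| <= eta.
  apply: le_trans (half k0); apply: lev; rewrite ?leqnn ?kK ?cell_le//.
    by rewrite geq_minl leq_minnD16// cell_close.
  by rewrite geq_minl leq_minnD16// cell_close.
have m2 : `|G k0 s' t' - g (node k0 im) (node k0 it)| <= eta.
  apply: le_trans (half k0); apply: lev; rewrite ?leqnn ?kK ?cell_le//.
    by rewrite geq_minr /im minnC leq_minnD16// cell_close// distrC.
  by rewrite geq_minr /it minnC leq_minnD16// cell_close// distrC.
have := close s t s01 t01; have := close s' t' s01' t01'.
have := ler_distD (G k0 s t) (g s t) (g s' t').
have := ler_distD (g (node k0 im) (node k0 it)) (G k0 s t) (g s' t').
have := ler_distD (G k0 s' t') (g (node k0 im) (node k0 it)) (g s' t').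
rewrite (distrC (g (node k0 im) (node k0 it)) (G k0 s' t')) (distrC (G k0 s' t') (g s' t')).
lra.
Qed.

End dyadic_chaining.

(** * Modulus of continuity of the empirical deviations *)

Section modulus_of_continuity.
Context (R : realType) d d' (Om : measurableType d) (T : measurableType d').
Context (P : probability Om R) (mu : probability T R) (Z : nat -> Om -> T).
Hypothesis mZ : forall i, measurable_fun setT (Z i).
Hypothesis iidZ : iid_with_law P Z mu.
Local Notation dev := (dev mu Z).

(** Counts are monotone in the set, so only the centring is lost; this is the
drift in the chaining. *)
Lemma dev_subset a n w (X Y : set T) : measurable X -> measurable Y -> X `<=` Y ->
  (0 < n)%N -> 0 < a ->
  `|dev a n w X| <= `|dev a n w Y| + Num.sqrt n%:R / a * fine (mu Y).
Proof.
move=> mX mY XY n0 a0.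
have sn0 : 0 < Num.sqrt (n%:R : R) by rewrite sqrtr_gt0 ltr0n.
have q0 : 0 < a * Num.sqrt (n%:R : R) by rewrite mulr_gt0.
have muXY : fine (mu X) <= fine (mu Y).
  by rewrite fine_le ?fin_num_measure// le_measure// inE.
have devE D : dev a n w D * (a * Num.sqrt n%:R) + n%:R * fine (mu D) = \sum_(i < n) \1_D (Z i w).
  by rewrite !devE divfK ?lt0r_neq0// sumrB sumr_const card_ord -[_ *+ n]mulr_natl subrK.
have NX : 0 <= \sum_(i < n) \1_X (Z i w) :> R by apply: sumr_ge0.
have NXY : \sum_(i < n) \1_X (Z i w) <= \sum_(i < n) \1_Y (Z i w) :> R.
  apply: ler_sum => i _; rewrite !indicE ler_nat.
  have [xX|xX] := pselect (X (Z i w)); first by rewrite (mem_set xX) (mem_set (XY _ xX)).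
  by rewrite memNset.
have Y0 : n%:R * fine (mu X) <= n%:R * fine (mu Y) by rewrite ler_wpM2l.
have yE : Num.sqrt n%:R / a * fine (mu Y) * (a * Num.sqrt n%:R) = n%:R * fine (mu Y).
  have nE : n%:R = Num.sqrt (n%:R : R) ^+ 2 by rewrite sqr_sqrtr.
  by rewrite [in RHS]nE; field; rewrite lt0r_neq0.
have nE D : `|dev a n w D| * (a * Num.sqrt n%:R) = `|dev a n w D * (a * Num.sqrt n%:R)|.
  by rewrite -[in LHS](gtr0_norm q0) -normrM.
rewrite -(ler_pM2r q0) mulrDl yE nE.
have := devE X; have := devE Y.
have := ler_norm (dev a n w Y * (a * Num.sqrt n%:R)); rewrite -(nE Y).
have dY0 : 0 <= `|dev a n w Y| * (a * Num.sqrt n%:R) by rewrite mulr_ge0// ltW.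
have mX0 : 0 <= n%:R * fine (mu X) by rewrite mulr_ge0// fine_ge0.
move=> h1 h2 h3; rewrite ler_norml; apply/andP; split; lra.
Qed.

(** The geometric growth of the exponents of the levels beats the logarithm of
the number of increments, which is linear in the level. *)
Lemma linear_le_geometric (e C : R) : 0 < e -> 0 <= C ->
  exists k0 : nat, forall k, (k0 <= k)%N -> C + 13 * k.+1%:R <= e * 2 ^+ k.
Proof.
move=> e0 C0.
have sq k : (k.+1 ^ 2 <= 4 * 2 ^ k)%N.
  elim: k => // -[//|[//|k]] IH; rewrite expnS mulnCA.
  apply: leq_trans (leq_mul (leqnn 2) IH); nia.
pose k0 := Num.truncn (4 * (C + 13) / e).
have k0P : 4 * (C + 13) / e < k0.+1%:R.
  have c0 : 0 <= 4 * (C + 13) / e by rewrite divr_ge0 ?(ltW e0)//; lra.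
  by have /truncn_itv/andP[] := c0.
exists k0 => k kk0.
have k1 : 4 * (C + 13) <= e * k.+1%:R.
  rewrite (mulrC e) -ler_pdivrMr// (le_trans (ltW k0P))// ler_nat//.
have sqk : k.+1%:R ^+ 2 <= 4 * 2 ^+ k :> R by rewrite -!natrX -natrM ler_nat.
have k10 : 1 <= k.+1%:R :> R by rewrite ler1n.
have h1 : e * k.+1%:R ^+ 2 <= e * (4 * 2 ^+ k) by rewrite ler_wpM2l// ltW.
have h2 : 4 * (C + 13) * k.+1%:R <= e * k.+1%:R * k.+1%:R by rewrite ler_wpM2r.
have h3 : C <= C * k.+1%:R by rewrite ler_peMr.
move: h1 h2; rewrite expr2; lra.
Qed.

Lemma power4_bracket (y : R) : 1 <= y -> exists K, 4 ^+ K <= y < 4 ^+ K.+1.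
Proof.
move=> y1; have y0 : 0 <= y by rewrite (le_trans _ y1).
have /truncn_itv/andP[t1 t2] := y0.
have tp : (0 < Num.truncn y)%N by rewrite truncn_gt0.
have /andP[h1 h2] := @trunc_log_bounds 4 _ isT tp.
exists (trunc_log 4 (Num.truncn y)); apply/andP; split.
  by rewrite (le_trans _ t1)// -natrX ler_nat.
by rewrite (lt_le_trans t2)// -natrX ler_nat.
Qed.

Context (S : R -> R -> set T) (L : R).
Hypothesis mS : forall s t, measurable (S s t).
Hypothesis S_mono : forall s s' t t', s <= s' -> t <= t' -> S s t `<=` S s' t'.
Hypothesis L0 : 0 <= L.
Hypothesis S_lip : forall s s' t t', 0 <= s -> s <= s' -> s' <= 1 ->
  0 <= t -> t <= t' -> t' <= 1 ->
  fine (mu (S s' t' `\` S s t)) <= L * ((s' - s) + (t' - t)).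

(** Increments of level [k] have measure of order 16 ^ - k. With base 16, the
choice [rho = 4 ^ k] in [dev_tail] keeps [V * rho ^+ 2] bounded while [rho] times
the threshold [e / 2 ^ k] grows like [2 ^ k]. There are at most [2 ^ (12 * (k + 1))]
pairs of nearby nodes. *)
Lemma level_tail k a n e : 0 < a -> (0 < n)%N -> 4 ^+ k * (a / Num.sqrt n%:R) <= 1 ->
  holds_but P (2 ^+ (12 * k.+1) * expR (a ^+ 2 * (64 * L - e * 2 ^+ k))) (fun w =>
    forall i i' j j', (i <= i' <= i + 16)%N -> (i' <= 16 ^ k)%N ->
      (j <= j' <= j + 16)%N -> (j' <= 16 ^ k)%N ->
      `|dev a n w (S (node R k i') (node R k j')) - dev a n w (S (node R k i) (node R k j))|
        <= e / 2 ^+ k).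
Proof.
move=> a0 n0 kt.
have p16 : 0 < 16 ^+ k :> R by rewrite exprn_gt0.
(* A pair of nodes at most 16 apart is a lower node and two offsets; pairs that leave
   the unit square are assigned the empty set. *)
pose D (x : 'I_(16 ^ k).+1 * 'I_(16 ^ k).+1 * ('I_17 * 'I_17)) :=
  let: ((i, j), (u, v)) := x in
  if ((i + u <= 16 ^ k) && (j + v <= 16 ^ k))%N then
    S (node R k (i + u)) (node R k (j + v)) `\` S (node R k i) (node R k j) else set0.
have mD x : measurable (D x).
  by case: x => -[i j] [u v] /=; case: ifP => // _; exact: measurableD.
pose V := L * (32 / 16 ^+ k).
have V0 : 0 <= V by rewrite mulr_ge0// divr_ge0// ltW.
have DV x : fine (mu (D x)) <= V.
  case: x => -[i j] [u v] /=; case: ifP => [/andP[iu jv]|_]; last by rewrite measure0.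
  apply: (le_trans (S_lip _ _ _ _ _ _)); rewrite ?node_ge0 ?node_le ?leq_addr//.
  - by rewrite -(node1 R k) node_le.
  - by rewrite -(node1 R k) node_le.
  rewrite ler_wpM2l// /node -!mulrBl -mulrDl ler_wpM2r ?invr_ge0 ?(ltW p16)//.
  rewrite !natrD.
  have u16 : u%:R <= 16 :> R by rewrite ler_nat -ltnS ltn_ord.
  have v16 : v%:R <= 16 :> R by rewrite ler_nat -ltnS ltn_ord.
  lra.
have tl x := @dev_tail _ _ _ _ _ P mu Z mZ iidZ (D x) V (4 ^+ k) (e / 2 ^+ k) a n
  (mD x) (DV x) n0 a0 (exprn_ge0 k (ler0n R 4)) kt.
have := holds_but_forall_fin tl; apply: holds_but_weak.
  have -> : 2 * V * (4 ^+ k) ^+ 2 - 4 ^+ k * (e / 2 ^+ k) = 64 * L - e * 2 ^+ k.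
    have e4 : (4 : R) = 2 * 2 by rewrite -natrM.
    have e16 : (16 : R) = 2 * 2 * (2 * 2) by rewrite -!natrM.
    rewrite /V e4 e16 !exprMn; field.
    by rewrite expf_neq0.
  rewrite mulrA ler_wpM2r ?expR_ge0// !card_prod !card_ord.
  rewrite -natrX -!natrM ler_nat.
  have -> : (2 ^ (12 * k.+1) = 16 * 16 * 16 * (16 ^ k * 16 ^ k * 16 ^ k))%N.
    have -> : (16 = 2 ^ 4)%N by [].
    by rewrite -!expnM -!expnD; congr (_ ^ _)%N; lia.
  have : (1 <= 16 ^ k)%N by rewrite expn_gt0.
  move: (16 ^ k)%N => z z1.
  apply: (@leq_trans (16 * 16 * 16 * (z * z * 1))); last by rewrite !leq_mul.
  by nia.
move=> w Dw i i' j j' /andP[ii' i'16] i'k /andP[jj' j'16] j'k.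
have ik : (i < (16 ^ k).+1)%N by rewrite ltnS (leq_trans ii').
have jk : (j < (16 ^ k).+1)%N by rewrite ltnS (leq_trans jj').
have iu : (i' - i < 17)%N by rewrite ltnS leq_subLR.
have jv : (j' - j < 17)%N by rewrite ltnS leq_subLR.
have := Dw ((Ordinal ik, Ordinal jk), (Ordinal iu, Ordinal jv)).
rewrite /D/= !subnKC// i'k j'k/= -dev_setD//.
by apply: S_mono; rewrite node_le.
Qed.

(** The chaining starts at the level [k0] where the exponents of [level_tail]
exceed the target rate [M] by more than the logarithm of the number of increments, and
ends at the last level [K] with
[4 ^ K <= sqrt n / a], beyond which the Bernstein bound does not apply. At that level
the drift, of slope sqrt n / a, has size sqrt n / a * 16 ^ - K, which is at most of
order a / sqrt n. The exceptional probabilities of the levels form a geometric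
series. *)
Lemma modulus_tail (M eta : R) : 0 <= M -> 0 < eta ->
  exists2 dl : R, 0 < dl & moderately (fun n a =>
  holds_but P (expR (- (a ^+ 2 * M))) (fun w =>
    forall s s' t t', 0 <= s <= 1 -> 0 <= s' <= 1 -> 0 <= t <= 1 -> 0 <= t' <= 1 ->
    `|s - s'| <= dl -> `|t - t'| <= dl ->
    `|dev a n w (S s t) - dev a n w (S s' t')| <= eta)).
Proof.
move=> M0 eta0.
pose e := eta / 8.
have e0 : 0 < e by rewrite divr_gt0.
have [k0 k0P] := linear_le_geometric e0 (addr_ge0 M0 (mulr_ge0 (ler0n R 64) L0)).
have p4 k : 0 < 4 ^+ k :> R by rewrite exprn_gt0.
have p16 k : 0 < 16 ^+ k :> R by rewrite exprn_gt0.
have L1 : 0 < 32 * L + 1 by rewrite ltr_wpDl// mulr_ge0.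
exists (16 ^+ k0)^-1; first by rewrite invr_gt0.
exists (Num.min (4 ^+ k0)^-1 (e / (32 * L + 1))).
  by rewrite lt_min invr_gt0 p4 divr_gt0.
exists 1 => // n a n0 a1; rewrite le_min => /andP[tk te].
have a0 : 0 < a by rewrite (lt_le_trans _ a1).
have sn0 : 0 < Num.sqrt (n%:R : R) by rewrite sqrtr_gt0 ltr0n.
set t := a / Num.sqrt n%:R in tk te.
have t0 : 0 < t by rewrite divr_gt0.
have ty : Num.sqrt n%:R / a = t^-1 by rewrite /t invf_div.
have yk : 4 ^+ k0 <= t^-1 by rewrite -[leLHS]invrK lef_pV2// posrE invr_gt0.
have y1 : 1 <= t^-1 by rewrite (le_trans _ yk)// exprn_ege1// ler1n.
have [K /andP[K1 K2]] := power4_bracket y1.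
have kK : (k0 <= K)%N.
  rewrite leqNgt; apply/negP => Kk.
  have : 4 ^+ K.+1 <= 4 ^+ k0 :> R by rewrite ler_weXn2l ?ler1n.
  by move=> /(lt_le_trans K2) /lt_le_trans /(_ yk); rewrite ltxx.
have omK : t^-1 * L * (2 / 16 ^+ K) <= e.
  have h1 : (t^-1) ^+ 2 <= 16 * 16 ^+ K.
    have -> : 16 * 16 ^+ K = (4 ^+ K.+1) ^+ 2 :> R.
      have -> : (16 : R) = 4 ^+ 2 by rewrite -natrX.
      by rewrite -exprS -!exprM mulnC.
    by rewrite lerXn2r ?nnegrE ?(ltW (p4 _)) ?invr_ge0 ?(ltW t0)// ltW.
  have h2 : (16 ^+ K)^-1 <= 16 * t ^+ 2.
    rewrite -[leLHS]mul1r ler_pdivrMr//.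
    have := ler_wpM2r (sqr_ge0 t) h1; rewrite exprVn mulVf; first by lra.
    by rewrite expf_neq0// lt0r_neq0.
  have h3 : t * (32 * L + 1) <= e by rewrite -ler_pdivlMr.
  apply: (@le_trans _ _ (t^-1 * L * (2 * (16 * t ^+ 2)))).
    by rewrite ler_wpM2l ?mulr_ge0 ?invr_ge0 ?(ltW t0)// ler_wpM2l.
  have -> : t^-1 * L * (2 * (16 * t ^+ 2)) = t * (32 * L) by field; rewrite lt0r_neq0.
  lra.
pose lev k w := forall i i' j j', (i <= i' <= i + 16)%N -> (i' <= 16 ^ k)%N ->
      (j <= j' <= j + 16)%N -> (j' <= 16 ^ k)%N ->
      `|dev a n w (S (node R k i') (node R k j')) - dev a n w (S (node R k i) (node R k j))|
        <= e / 2 ^+ k.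
have H (k : 'I_K.+1) : holds_but P (expR (- (a ^+ 2 * M)) * 2^-1 ^+ k.+1)
    (fun w => (k0 <= k)%N -> lev k w).
  have [kk|kk] := leqP k0 k; last first.
    by apply: holds_but_true => //; rewrite mulr_ge0 ?expR_ge0// exprn_ge0.
  have k4 : 4 ^+ k * (a / Num.sqrt n%:R) <= 1.
    rewrite -ler_pdivlMr// mul1r (le_trans _ K1)// ler_weXn2l ?ler1n// -ltnS//.
  have := level_tail e a0 n0 k4; apply: holds_but_weak => //.
  have aM : 64 * L - e * 2 ^+ k <= - M - 13 * k.+1%:R by have := k0P k kk; lra.
  have a21 : 1 <= a ^+ 2 by rewrite exprn_ege1.
  have e13 : 2 ^+ (13 * k.+1) <= expR (13 * k.+1%:R) :> R.
    rewrite -natrM -[X in expR X]mulr1 expRM_natl lerXn2r ?nnegrE ?expR_ge0//.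
    by have := expR_ge1Dx (1 : R); rewrite -natr1.
  have -> : expR (- (a ^+ 2 * M)) * 2^-1 ^+ k.+1 =
      2 ^+ (12 * k.+1) * (expR (- (a ^+ 2 * M)) * (2 ^+ (13 * k.+1))^-1).
    rewrite (mulSn 12) exprD exprVn; field.
    by rewrite !expf_neq0.
  rewrite ler_wpM2l ?exprn_ge0//.
  apply: (@le_trans _ _ (expR (- (a ^+ 2 * M)) * expR (- (13 * k.+1%:R)))).
    rewrite -expRD ler_expR.
    have : 13 * k.+1%:R <= a ^+ 2 * (13 * k.+1%:R) :> R by rewrite ler_peMl// mulr_ge0.
    have := ler_wpM2l (sqr_ge0 a) aM; lra.
  by rewrite ler_wpM2l ?expR_ge0// expRN lef_pV2 ?posrE ?expR_gt0 ?exprn_gt0.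
have := holds_but_forall H; apply: holds_but_weak.
  rewrite -mulr_sumr ler_piMr ?expR_ge0//.
  suff -> : \sum_(i < K.+1) 2^-1 ^+ i.+1 = 1 - 2^-1 ^+ K.+1 :> R by rewrite gerBl exprn_ge0.
  elim: (K.+1) => [|m IH]; first by rewrite big_ord0 expr0 subrr.
  by rewrite big_ord_recr/= IH exprS; field; rewrite ?expf_neq0.
move=> w Hw s s' u u' s01 s01' u01 u01' ss uu.
have -> : eta = 8 * e by rewrite /e; field.
apply: (@chaining _ (fun s t => dev a n w (S s t)) e (t^-1 * L) k0 K) => //.
- exact: ltW.
- by rewrite mulr_ge0// invr_ge0 ltW.
- move=> k i i' j j' /andP[k0k kK'] ii ik jj jk.
  by have := Hw (Ordinal (kK' : (k < K.+1)%N)) k0k; apply.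
- move=> s0 s1 s2 v0 v1 v2 s00 s01_ s12 s21 v00 v01 v12 v21.
  have s02 := le_trans s01_ s12; have v02 := le_trans v01 v12.
  rewrite !dev_setD//; try exact: S_mono.
  apply: (le_trans (dev_subset _ _ _ _ n0 a0)); rewrite ?ty.
  - exact: measurableD.
  - exact: (measurableD (mS s2 v2) (mS s0 v0)).
  - by apply: setSD; exact: S_mono.
  by rewrite lerD2l -mulrA ler_wpM2l ?invr_ge0 ?(ltW t0)// S_lip.
Qed.

End modulus_of_continuity.

(** * Calculus on compact sets *)

Section calculus_on_compacts.
Context (R : realType).

Lemma compact_uniform_continuity (V : pseudoMetricType R) (K : set V) (f : V -> R) :
  compact K -> {within K, continuous f} -> forall e : R, 0 < e ->
  exists2 dl : R, 0 < dl & forall x y, K x -> K y -> ball x dl y -> `|f x - f y| <= e.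
Proof.
move=> /compact_near_coveringP/near_covering_withinP cK /subspace_continuousP cf e e0.
have e2 : 0 < e / 2 by rewrite divr_gt0.
have := cK R (0^'+) (fun dl x => forall y, K y -> ball x dl y -> `|f x - f y| <= e) _.
case=> [x Kx|dl /= dl0 H].
  have /cvgrPdist_le/(_ _ e2) := cf x Kx.
  rewrite near_withinE => /nbhs_ballP[r /= r0 rP].
  have r2 : 0 < r / 2 by rewrite divr_gt0.
  exists (ball x (r / 2), [set dl | 0 < dl < r / 2]) => /=.
    split; first exact: nbhsx_ballx.
    near=> dl => /=; apply/andP; split => //.
  move=> [x' dl]/= [xx' /andP[dl0 dlr]] Kx' y Ky x'y.
  have xy : ball x r y.
    rewrite (splitr r); apply: ball_triangle xx' _.
    by apply: le_ball x'y; exact: ltW.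
  have xx2 : ball x r x' by apply: le_ball xx'; lra.
  have := rP _ xx2 Kx'; have := rP _ xy Ky.
  have := ler_distD (f x) (f x') (f y); rewrite (distrC (f x') (f x)); lra.
exists (dl / 2); first by rewrite divr_gt0.
move=> x y Kx Ky xy; apply: (H (dl / 2)) => //=.
- by rewrite sub0r normrN gtr0_norm ?divr_gt0// ltr_pdivrMr// ltr_pMr// ltr1n.
- by rewrite divr_gt0.
Unshelve. all: by end_near.
Qed.

Lemma mvt_interval (h : R -> R) (l r : R) :
  (forall x, l <= x <= r -> derivable h x 1) ->
  forall x y, l <= x <= r -> l <= y <= r ->
  exists c, [/\ l <= c <= r, `|c - x| <= `|y - x| & h y - h x = derive1 h c * (y - x)].
Proof.
move=> dh x y /andP[lx xr] /andP[ly yr].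
have main a b : l <= a -> b <= r -> a <= b ->
    exists2 c, a <= c <= b & h b - h a = derive1 h c * (b - a).
  move=> la br ab.
  have d c : c \in `[a, b]%R -> derivable h c 1.
    by rewrite in_itv/= => /andP[ac cb]; apply: dh; rewrite (le_trans la)//= (le_trans cb).
  have [||c] := @MVT_segment R h (derive1 h) a b ab.
  - move=> c cab; apply: DeriveDef; last by rewrite derive1E.
    by apply: d; exact: subset_itv_oo_cc cab.
  - exact: derivable_within_continuous.
  by rewrite in_itv/= => cab E; exists c.
have [xy|yx] := leP x y.
  have [c /andP[xc cy] E] := main x y lx yr xy; exists c; split => //.
    by rewrite (le_trans lx)//= (le_trans cy).
  by rewrite !ger0_norm ?subr_ge0// lerD2r.
have [c /andP[yc cx] E] := main y x ly xr (ltW yx); exists c; split => //.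
- by rewrite (le_trans ly)//= (le_trans cx).
- by rewrite !ler0_norm ?subr_le0 ?(ltW yx)// lerN2 lerD2r.
- by rewrite -(opprB (h x)) E -(opprB x y) mulrN.
Qed.

Lemma derivable_continuous_at (h : R -> R) x : derivable h x 1 -> {for x, continuous h}.
Proof. by move=> /derivable1_diffP; exact: differentiable_continuous. Qed.

Lemma positive_lower_bound (h : R -> R) (l r : R) : l <= r ->
  (forall x, l <= x <= r -> 0 < h x) -> {within `[l, r], continuous h} ->
  exists2 m : R, 0 < m & forall x, l <= x <= r -> m <= h x.
Proof.
move=> lr h0 ch; have [c clr cP] := EVT_min lr ch.
exists (h c); first by apply: h0; move: clr; rewrite in_itv.
by move=> x xlr; apply: cP; rewrite in_itv.
Qed.

Lemma compact_abs_bound (V : pseudoMetricType R) (K : set V) (f : V -> R) :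
  compact K -> {within K, continuous f} ->
  exists2 M : R, 0 < M & forall x, K x -> `|f x| <= M.
Proof.
move=> cK cf; have /compact_bounded[M [_ HM]] : compact (f @` K).
  exact: continuous_compact.
exists (Num.max 1 (M + 1)); first by rewrite lt_max ltr01.
move=> x Kx; apply: HM; last by exists x.
by rewrite lt_max ltrDl ltr01 orbT.
Qed.

End calculus_on_compacts.

(** * Linearization of quantiles *)

Section quantiles.
Context (R : realType).
Implicit Types K : R -> R.

(** The bounds [lo] and [hi] ensure that the set whose infimum defines the
quantile is bounded below and nonempty. *)
Lemma quantile_between K u lo hi : {homo K : x y / x <= y} -> K lo < u -> u <= K hi ->
  [/\ lo <= quantile K u <= hi, forall y, y < quantile K u -> K y < u &
      forall y, quantile K u < y -> u <= K y].
Proof.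
move=> Kmono lou uhi; set S := [set x | u <= K x].
have Slb : lbound S lo.
  move=> x /= ux; rewrite leNgt; apply/negP => /ltW/Kmono.
  by move=> /le_lt_trans/(_ lou)/(le_lt_trans ux); rewrite ltxx.
have S0 : S !=set0 by exists hi.
have Sinf : has_inf S by split => //; exists lo.
split.
- by rewrite /quantile lb_le_inf//= ge_inf//; exists lo.
- move=> y yq; rewrite ltNge; apply/negP => uy.
  have : quantile K u <= y by apply: ge_inf => //; exists lo.
  by rewrite leNgt yq.
- move=> y qy; have qy0 : 0 < y - quantile K u by rewrite subr_gt0.
  have [x Sx xy] := inf_adherent qy0 Sinf.
  by rewrite (le_trans Sx)// Kmono// ltW//; move: xy; rewrite addrC subrK.
Qed.

Lemma left_limit_le (h : R -> R) x l c : {for x, continuous h} -> l < x ->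
  (forall y, l < y -> y < x -> h y <= c) -> h x <= c.
Proof.
move=> ch lx H; apply: (cvgr_to_le (cvg_at_left_filter ch)).
by near=> y; apply: H.
Unshelve. all: by end_near.
Qed.

Lemma right_limit_ge (h : R -> R) x r c : {for x, continuous h} -> x < r ->
  (forall y, x < y -> y < r -> c <= h y) -> c <= h x.
Proof.
move=> ch xr H; apply: (cvgr_to_ge (cvg_at_right_filter ch)).
by near=> y; apply: H.
Unshelve. all: by end_near.
Qed.

End quantiles.

Section quantile_perturbation.
Context (R : realType) (F : R -> R) (p q eps m : R).
Local Notation xp := (quantile F p).
Local Notation xq := (quantile F q).
Context (l r : R).
Hypotheses (lE : l = xp - eps) (rE : r = xq + eps).
Local Notation inA x := (l <= x <= r).
Hypothesis Fmono : {homo F : x y / x <= y}.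
Hypothesis Flow : forall u : R, 0 < u -> exists x, F x < u.
Hypothesis Fhigh : forall u, u < 1 -> exists x, u <= F x.
Hypotheses (p0 : 0 < p) (pq : p < q) (q1 : q < 1) (eps0 : 0 < eps) (m0 : 0 < m).
Hypothesis dF : forall x, inA x -> derivable F x 1.
Hypothesis Fm : forall x, inA x -> m <= derive1 F x.

Lemma quantile_mono u u' : 0 < u -> u <= u' -> u' < 1 -> quantile F u <= quantile F u'.
Proof.
move=> u0 uu' u1; have [lo ulo] := Flow u0; have [hi uhi] := Fhigh u1.
have [_ _ H2] := quantile_between Fmono (lt_le_trans ulo uu') uhi.
have [_ H3 _] := quantile_between Fmono ulo (le_trans uu' uhi).
rewrite leNgt; apply/negP => qq.
have [y /andP[y1 y2]] : exists y, quantile F u' < y < quantile F u.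
  by exists ((quantile F u' + quantile F u) / 2); rewrite midf_lt//= midf_lt.
have := H2 _ y1; have := H3 _ y2; lra.
Qed.

Lemma quantile_in u : p <= u -> u <= q -> xp <= quantile F u <= xq.
Proof.
move=> pu uq; rewrite !quantile_mono// ?(lt_le_trans p0)// (le_lt_trans uq)//.
Qed.

Lemma quantile_inA u : p <= u -> u <= q -> inA (quantile F u).
Proof.
move=> pu uq; have [e0 lE' rE'] := And3 eps0 lE rE.
by have /andP[a b] := quantile_in pu uq; apply/andP; split; lra.
Qed.

Lemma cdf_quantile u : p <= u -> u <= q -> F (quantile F u) = u.
Proof.
move=> pu uq; have u0 := lt_le_trans p0 pu; have u1 := le_lt_trans uq q1.
have [lo ulo] := Flow u0; have [hi uhi] := Fhigh u1.
have [_ H1 H2] := quantile_between Fmono ulo uhi.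
have ch := derivable_continuous_at (dF (quantile_inA pu uq)).
apply/eqP; rewrite eq_le; apply/andP; split.
  apply: (@left_limit_le _ _ _ (quantile F u - 1) _ ch); first by lra.
  by move=> y _ /H1/ltW.
apply: (@right_limit_ge _ _ _ (quantile F u + 1) _ ch); first by lra.
by move=> y /H2.
Qed.

Lemma increment_lower x y : inA x -> inA y -> x <= y -> m * (y - x) <= F y - F x.
Proof.
move=> Ax Ay xy; have [c [Ac _ ->]] := mvt_interval dF Ax Ay.
by rewrite ler_wpM2r ?subr_ge0// Fm.
Qed.

(** Bahadur representation. Since [Fn] is within [t * M] of [F], the quantile
[xn] of [Fn] stays in the window where [F] has slope at least [m], and close to [x].
As [Fn] crosses the level [u = F x] at [xn], and [Fn - F] varies by at most [t * eta]
between [x] and [xn], the increment of [F] from [x] to [xn] is [- (Fn x - F x)] up to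
[t * eta]; the mean value theorem then divides by the derivative. *)
Lemma quantile_linearization (Fn : R -> R) (t M eta dl om : R) :
  {homo Fn : x y / x <= y} -> 0 < t -> 0 <= M -> 0 <= eta -> 0 < dl ->
  (forall x, inA x -> `|Fn x - F x| <= t * M) ->
  (forall x y, inA x -> inA y -> `|x - y| <= dl ->
     `|(Fn x - F x) - (Fn y - F y)| <= t * eta) ->
  (forall x y, inA x -> inA y -> `|x - y| <= dl -> `|derive1 F x - derive1 F y| <= om) ->
  t * M < m * (eps / 2) -> t * M / m <= dl / 2 ->
  forall u, p <= u -> u <= q ->
    let x := quantile F u in let xn := quantile Fn u in
    [/\ inA xn, `|xn - x| <= t * M / m &
      `|(xn - x) + (Fn x - F x) / derive1 F x| <= t * ((eta + om * (M / m)) / m)].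
Proof.
move=> Fnmono t0 M0 eta0 dl0 FnF osc oscf tM tMdl u pu uq x xn.
have [e0 lE' rE'] := And3 eps0 lE rE.
have Ax : inA x := quantile_inA pu uq.
have Fx : F x = u := cdf_quantile pu uq.
have pp : xp <= xq.
  by have /andP[] := quantile_in (lexx p) (ltW pq).
have Axp : inA xp by apply/andP; split; lra.
have Axq : inA xq by apply/andP; split; lra.
have Fp : F xp = p by apply: cdf_quantile => //; exact: ltW.
have Fq : F xq = q by apply: cdf_quantile => //; exact: ltW.
have Al : inA (xp - eps / 2) by apply/andP; split; lra.
have Ar : inA (xq + eps / 2) by apply/andP; split; lra.
have ilow : Fn (xp - eps / 2) < u.
  have le1 : xp - eps / 2 <= xp by lra.
  have := increment_lower Al Axp le1; rewrite Fp.
  have := FnF _ Al; rewrite ler_norml => /andP[_ h1] h2; lra.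
have ihigh : u <= Fn (xq + eps / 2).
  have le1 : xq <= xq + eps / 2 by lra.
  have := increment_lower Axq Ar le1; rewrite Fq.
  have := FnF _ Ar; rewrite ler_norml => /andP[h1 _] h2; lra.
have [/andP[xnl xnr] below above] := quantile_between Fnmono ilow ihigh.
rewrite -/xn in xnl xnr below above.
have [xlo xhi] : l < xn /\ xn < r by split; lra.
clear pp Axp Axq Fp Fq Al Ar ilow ihigh xnl xnr lE' rE' tM.
have Axn : inA xn by apply/andP; split; lra.
have ch := derivable_continuous_at (dF Axn).
have c1 : `|F xn - u| <= t * M.
  rewrite ler_norml; apply/andP; split.
    (* Fn may jump at xn: its values are compared with u on either side of xn, and
       continuity carries the inequality over to F xn. *)
    rewrite lerBrDr; apply: (@right_limit_ge _ _ _ r _ ch); first by lra.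
    move=> y y1 y2; have Ay : inA y by apply/andP; split; lra.
    have := above _ y1; have := FnF _ Ay; rewrite ler_norml => /andP[h1 h2]; lra.
  rewrite lerBlDr; apply: (@left_limit_le _ _ _ l _ ch); first by lra.
  move=> y y1 y2; have Ay : inA y by apply/andP; split; lra.
  have := below _ y2; have := FnF _ Ay; rewrite ler_norml => /andP[h1 h2]; lra.
have [c [Ac cx E]] := mvt_interval dF Ax Axn.
have c2 : `|xn - x| <= t * M / m.
  rewrite ler_pdivlMr//; apply: le_trans c1; rewrite -Fx E normrM.
  rewrite mulrC ler_wpM2r//.
  by rewrite ger0_norm ?Fm// (le_trans (ltW m0))// Fm.
have c2dl : `|xn - x| <= dl / 2 := le_trans c2 tMdl.
have c3 : `|(F xn - u) + (Fn x - F x)| <= t * eta.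
  move: c2dl; rewrite ler_norml => /andP[d1 d2].
  rewrite ler_norml; apply/andP; split.
    rewrite -lerBlDr lerBrDr.
    apply: (@right_limit_ge _ _ _ (Num.min r (xn + dl / 2)) _ ch).
      by rewrite lt_min; apply/andP; split; lra.
    move=> y y1; rewrite lt_min => /andP[y2 y3].
    have Ay : inA y by apply/andP; split; lra.
    have yx : `|y - x| <= dl by rewrite ler_norml; apply/andP; split; lra.
    have := above _ y1; have := osc _ _ Ay Ax yx; rewrite ler_norml => /andP[h1 h2]; lra.
  rewrite -lerBrDr lerBlDr.
  apply: (@left_limit_le _ _ _ (Num.max l (xn - dl / 2)) _ ch).
    by rewrite gt_max; apply/andP; split; lra.
  move=> y; rewrite gt_max => /andP[y2 y3] y1.
  have Ay : inA y by apply/andP; split; lra.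
  have yx : `|y - x| <= dl by rewrite ler_norml; apply/andP; split; lra.
  have := below _ y1; have := osc _ _ Ay Ax yx; rewrite ler_norml => /andP[h1 h2]; lra.
split => //.
have fx := Fm Ax; have fx0 : 0 < derive1 F x := lt_le_trans m0 fx.
have cxdl : `|c - x| <= dl.
  rewrite (le_trans cx)// (le_trans c2dl)//; lra.
have fc := oscf _ _ Ac Ax cxdl.
have om0 : 0 <= om by apply: le_trans fc.
have key : `|derive1 F x * (xn - x) + (Fn x - F x)| <= t * (eta + om * (M / m)).
  have -> : derive1 F x * (xn - x) + (Fn x - F x) =
     ((F xn - u) + (Fn x - F x)) - (derive1 F c - derive1 F x) * (xn - x).
    by rewrite -Fx E; ring.
  rewrite (le_trans (ler_normB _ _))// [t * _]mulrDr lerD// normrM.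
  have -> : t * (om * (M / m)) = om * (t * M / m) by ring.
  by rewrite ler_pM.
have -> : xn - x + (Fn x - F x) / derive1 F x =
   (derive1 F x * (xn - x) + (Fn x - F x)) / derive1 F x.
  by field; rewrite lt0r_neq0.
rewrite normrM normfV (gtr0_norm fx0) mulrA.
rewrite ler_pM ?invr_ge0 ?(ltW fx0)// lef_pV2 ?posrE//.
Qed.

End quantile_perturbation.

(** * Linearization of the copula *)

Section copula_linearization.
Context (R : realType).

(** The oscillation of [Hn - H] between the two points is negligible, and the
increment of [H] is expanded by the mean value theorem in one coordinate at a time;
[e1] and [e2] stand for the opposites of the linearized quantile increments. *)
Lemma copula_linearization (H Hn : R -> R -> R) (l1 r1 l2 r2 t beta kap om eta Dm : R)
    (x xn y yn e1 e2 dl : R) :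
  (forall x y, l1 <= x <= r1 -> l2 <= y <= r2 ->
     derivable (fun x' => H x' y) x 1 /\ derivable (fun y' => H x y') y 1) ->
  (forall x y, l1 <= x <= r1 -> l2 <= y <= r2 ->
     `|partial1 H x y| <= Dm /\ `|partial2 H x y| <= Dm) ->
  (forall x x' y y', l1 <= x <= r1 -> l1 <= x' <= r1 -> l2 <= y <= r2 -> l2 <= y' <= r2 ->
     `|x - x'| <= dl -> `|y - y'| <= dl ->
     `|partial1 H x y - partial1 H x' y'| <= om /\
     `|partial2 H x y - partial2 H x' y'| <= om) ->
  0 <= t ->
  l1 <= x <= r1 -> l1 <= xn <= r1 -> l2 <= y <= r2 -> l2 <= yn <= r2 ->
  `|xn - x| <= t * beta -> `|yn - y| <= t * beta -> t * beta <= dl ->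
  `|(xn - x) + e1| <= t * kap -> `|(yn - y) + e2| <= t * kap ->
  `|(Hn xn yn - H xn yn) - (Hn x y - H x y)| <= t * eta ->
  `|Hn xn yn - H x y - ((Hn x y - H x y) - partial1 H x y * e1 - partial2 H x y * e2)|
    <= t * (eta + 2 * (om * beta + Dm * kap)).
Proof.
move=> dH Db osc t0 Ax Axn By Byn xb yb tb xk yk Ho.
have [c [Ac cx E1]] := mvt_interval (fun x Ax => (dH x yn Ax Byn).1) Ax Axn.
have [d [Bd dy E2]] := mvt_interval (fun y By => (dH x y Ax By).2) By Byn.
rewrite -/(partial1 H c yn) in E1; rewrite -/(partial2 H x d) in E2.
have xdl := le_trans xb tb; have ydl := le_trans yb tb.
have dl0 : 0 <= dl := le_trans (normr_ge0 _) xdl.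
have [po1 _] := osc _ _ _ _ Ac Ax Byn By (le_trans cx xdl) ydl.
have [|_ po2] := osc x x d y Ax Ax Bd By _ (le_trans dy ydl).
  by rewrite subrr normr0.
have [b1 b2] := Db _ _ Ax By.
have -> : Hn xn yn - H x y - ((Hn x y - H x y) - partial1 H x y * e1 - partial2 H x y * e2)
  = ((Hn xn yn - H xn yn) - (Hn x y - H x y)) +
    ((partial1 H c yn - partial1 H x y) * (xn - x) + partial1 H x y * ((xn - x) + e1)) +
    ((partial2 H x d - partial2 H x y) * (yn - y) + partial2 H x y * ((yn - y) + e2)).
  have -> : H xn yn = H x y + partial1 H c yn * (xn - x) + partial2 H x d * (yn - y).
    by rewrite -E1 -E2; ring.
  ring.
have p (A B C D a b e f : R) : `|A| <= a -> `|B| <= b -> `|C| <= e -> `|D| <= f ->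
    `|A * B + C * D| <= a * b + e * f.
  move=> Aa Bb Ce Df; rewrite (le_trans (ler_normD _ _))// !normrM lerD// ler_pM//.
have h1 := p _ _ _ _ _ _ _ _ po1 xb b1 xk.
have h2 := p _ _ _ _ _ _ _ _ po2 yb b2 yk.
apply: (le_trans (ler_normD _ _)).
apply: (le_trans (lerD (le_trans (ler_normD _ _) (lerD Ho h1)) h2)).
by rewrite le_eqVlt; apply/orP; left; apply/eqP; ring.
Qed.

End copula_linearization.

(** * Quadrants and half-planes *)

Section quadrant_families.
Context (R : realType) (mu : probability (R * R)%type R).
Local Notation ip := (ip mu).
Local Notation sqint := (sqint mu).
Local Notation H := (joint_cdf mu).
Local Notation F := (marginal1 H).
Local Notation G := (marginal2 H).

(** The sets on which the copula depends: quadrants for the joint distribution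
function, half-planes for the marginals. Treating them as one family indexed by
its corner lets a single chaining argument serve for all three. *)
Definition orthant (c : 'I_3) (x y : R) : set (R * R) :=
  match val c with
  | 0 => quadrant x y
  | 1 => `]-oo, x] `*` setT
  | _ => setT `*` `]-oo, y]
  end.

Definition joint : 'I_3 := inord 0.
Definition side1 : 'I_3 := inord 1.
Definition side2 : 'I_3 := inord 2.

Lemma orthant0 x y : orthant joint x y = quadrant x y.
Proof. by rewrite /orthant /joint/= inordK. Qed.
Lemma orthant1 x y : orthant side1 x y = `]-oo, x] `*` setT.
Proof. by rewrite /orthant /side1/= inordK. Qed.
Lemma orthant2 x y : orthant side2 x y = setT `*` `]-oo, y].
Proof. by rewrite /orthant /side2/= inordK. Qed.

Lemma measurable_orthant c x y : measurable (orthant c x y).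
Proof. by rewrite /orthant; case: (val c) => [|[|k]]; exact: measurableX. Qed.

Lemma orthant_mono c x x' y y' : x <= x' -> y <= y' -> orthant c x y `<=` orthant c x' y'.
Proof.
move=> xx yy [a b]; rewrite /orthant /quadrant; case: (val c) => [|[|k]]; rewrite /= !in_itv/=.
- by move=> [ax b_y]; split; [exact: le_trans ax xx|exact: le_trans b_y yy].
- by move=> [ax _]; split => //; exact: le_trans ax xx.
- by move=> [_ b_y]; split => //; exact: le_trans b_y yy.
Qed.

Let X1 : {RV mu >-> R} := mfun_Sub (mem_set (@measurable_fst _ _ R R)).
Let X2 : {RV mu >-> R} := mfun_Sub (mem_set (@measurable_snd _ _ R R)).

Let cdf1E x y : cdf X1 x = mu (orthant side1 x y).
Proof.
rewrite orthant1 /cdf /distribution/= /pushforward; congr (mu _).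
by apply/seteqP; split => [z ?|z []].
Qed.

Let cdf2E x y : cdf X2 y = mu (orthant side2 x y).
Proof.
rewrite orthant2 /cdf /distribution/= /pushforward; congr (mu _).
by apply/seteqP; split => [z ?|z []].
Qed.

Let fine_cvg (X : {RV mu >-> R}) (FF : set_system R) {PF : Filter FF} (l : R) :
  cdf X x @[x --> FF] --> l%:E -> fine (cdf X x) @[x --> FF] --> l.
Proof. by move=> /fine_cvg. Qed.

Lemma orthant1_to1 y : fine (mu (orthant side1 x y)) @[x --> +oo] --> (1 : R).
Proof. by under eq_fun do rewrite -cdf1E; apply: fine_cvg; exact: cvg_cdfy1. Qed.
Lemma orthant1_to0 y : fine (mu (orthant side1 x y)) @[x --> -oo] --> (0 : R).
Proof. by under eq_fun do rewrite -cdf1E; apply: fine_cvg; exact: cvg_cdfNy0. Qed.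
Lemma orthant2_to1 x : fine (mu (orthant side2 x y)) @[y --> +oo] --> (1 : R).
Proof. by under eq_fun do rewrite -(cdf2E x); apply: fine_cvg; exact: cvg_cdfy1. Qed.
Lemma orthant2_to0 x : fine (mu (orthant side2 x y)) @[y --> -oo] --> (0 : R).
Proof. by under eq_fun do rewrite -(cdf2E x); apply: fine_cvg; exact: cvg_cdfNy0. Qed.

Lemma fine_probC (A : set (R * R)) : measurable A -> fine (mu (~` A)) = 1 - fine (mu A).
Proof.
move=> mA; rewrite probability_setC// fineB ?fin_num_measure//.
Qed.

Lemma fine_le_measure (A B : set (R * R)) : measurable A -> measurable B -> A `<=` B ->
  fine (mu A) <= fine (mu B).
Proof. by move=> mA mB AB; rewrite fine_le ?fin_num_measure// le_measure// inE. Qed.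

Lemma fine_measureD (A B : set (R * R)) : measurable A -> measurable B -> A `<=` B ->
  fine (mu (B `\` A)) = fine (mu B) - fine (mu A).
Proof.
move=> mA mB AB; have mBA : measurable (B `\` A) by exact: measurableD.
apply/eqP; rewrite eq_sym subr_eq addrC -fineD ?fin_num_measure// -measureU//.
  by rewrite setDUK.
by apply/seteqP; split => // x [Ax [_]].
Qed.

Let limit_of_sqr (f g : R -> R) (FF : set_system R) {PF : Filter FF} (a C : R) :
  0 <= C -> g x @[x --> FF] --> (1 : R) ->
  (forall x, (a - f x) ^+ 2 <= C * (1 - g x)) -> f x @[x --> FF] --> a.
Proof.
move=> C0 g1 fg; apply/cvgrPdist_le => e e0.
have C1 : 0 < C + 1 by rewrite ltr_wpDl.
have e20 : 0 < e ^+ 2 / (C + 1) by rewrite divr_gt0// exprn_gt0.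
have /cvgrPdist_le/(_ _ e20) := g1; apply: filterS => x.
move=> /(le_trans (ler_norm _)) h.
rewrite -(@ler_pXn2r _ 2)// ?nnegrE// ?(ltW e0)// real_normK ?num_real//.
apply: (le_trans (fg x)).
have : C * (1 - g x) <= C * (e ^+ 2 / (C + 1)) by rewrite ler_wpM2l.
move=> /le_trans; apply.
by rewrite mulrCA ler_piMr ?sqr_ge0// ler_pdivrMr// mul1r lerDl.
Qed.

(** The part of the vertical half-plane above height [t] has vanishing measure,
and [ip_indic_diff] bounds the integral of [gam] on it. *)
Lemma marginal1_ip gam x y : sqint gam ->
  marginal1 (fun s t => ip gam \1_(quadrant s t)) x = ip gam \1_(orthant side1 x y).
Proof.
move=> sg; rewrite /marginal1; apply/cvg_lim => //.
apply: (limit_of_sqr (ip_ge0 mu gam) (orthant2_to1 x)) => t.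
have mq := measurable_orthant joint x t; rewrite orthant0 in mq.
apply: (le_trans (ip_indic_diff sg mq (measurable_orthant side1 x y) _)).
  by rewrite orthant1 /quadrant => -[a b]/= [].
rewrite ler_wpM2l ?ip_ge0// -fine_probC; last exact: measurable_orthant.
apply: fine_le_measure.
- by apply: measurableD => //; exact: measurable_orthant.
- by apply: measurableC; exact: measurable_orthant.
- rewrite orthant1 orthant2 /quadrant => -[a b]/= [[ax _] nq] [_ bt].
  by apply: nq; split.
Qed.

Lemma marginal2_ip gam x y : sqint gam ->
  marginal2 (fun s t => ip gam \1_(quadrant s t)) y = ip gam \1_(orthant side2 x y).
Proof.
move=> sg; rewrite /marginal2; apply/cvg_lim => //.
apply: (limit_of_sqr (ip_ge0 mu gam) (orthant1_to1 y)) => t.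
have mq := measurable_orthant joint t y; rewrite orthant0 in mq.
apply: (le_trans (ip_indic_diff sg mq (measurable_orthant side2 x y) _)).
  by rewrite orthant2 /quadrant => -[a b]/= [].
rewrite ler_wpM2l ?ip_ge0// -fine_probC; last exact: measurable_orthant.
apply: fine_le_measure.
- by apply: measurableD => //; exact: measurable_orthant.
- by apply: measurableC; exact: measurable_orthant.
- rewrite orthant1 orthant2 /quadrant => -[a b]/= [[_ b_y] nq] [at_ _].
  by apply: nq; split.
Qed.

Let ip_cst1_indic (A : set (R * R)) : measurable A -> ip (fun=> 1) \1_A = fine (mu A).
Proof.
move=> mA; rewrite ipC ip1 /Rintegral integral_indic// setIT//.
Qed.

Lemma joint_cdfE : H = fun s t => ip (fun=> 1) \1_(quadrant s t).
Proof.
apply/funext => s; apply/funext => t; rewrite /joint_cdf ip_cst1_indic//.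
by have := measurable_orthant joint s t; rewrite orthant0.
Qed.

Lemma joint_cdf_orthant x y : H x y = fine (mu (orthant joint x y)).
Proof. by rewrite orthant0. Qed.

Lemma marginal1_orthant x y : F x = fine (mu (orthant side1 x y)).
Proof.
rewrite joint_cdfE (marginal1_ip x y (sqint_cst mu 1)) ip_cst1_indic//.
exact: measurable_orthant.
Qed.

Lemma marginal2_orthant x y : G y = fine (mu (orthant side2 x y)).
Proof.
rewrite joint_cdfE (marginal2_ip x y (sqint_cst mu 1)) ip_cst1_indic//.
exact: measurable_orthant.
Qed.

Lemma marginal1_mono : {homo F : x y / x <= y}.
Proof.
move=> x y xy; rewrite !(marginal1_orthant _ 0); apply: fine_le_measure; try exact: measurable_orthant.
exact: orthant_mono.
Qed.

Lemma marginal2_mono : {homo G : x y / x <= y}.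
Proof.
move=> x y xy; rewrite !(marginal2_orthant 0); apply: fine_le_measure; try exact: measurable_orthant.
exact: orthant_mono.
Qed.

Let cdf_low (K : R -> R) : K x @[x --> -oo] --> (0 : R) ->
  forall u, 0 < u -> exists x, K x < u.
Proof.
move=> K0 u u0; have /cvgrPdist_lt/(_ _ u0) := K0.
move=> [M [_ HM]]; exists (M - 1).
have /HM : M - 1 < M by rewrite ltrBlDr ltrDl.
by rewrite sub0r normrN => /(le_lt_trans (ler_norm _)).
Qed.

Let cdf_high (K : R -> R) : K x @[x --> +oo] --> (1 : R) ->
  forall u, u < 1 -> exists x, u <= K x.
Proof.
move=> K1 u u1; have u0 : 0 < 1 - u by rewrite subr_gt0.
have /cvgrPdist_lt/(_ _ u0) := K1.
move=> [M [_ HM]]; exists (M + 1).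
have /HM : M < M + 1 by rewrite ltrDl.
move=> /(le_lt_trans (ler_norm _)) => h; apply: ltW; lra.
Qed.

Lemma marginal1_low u : 0 < u -> exists x, F x < u.
Proof.
apply: cdf_low; rewrite (_ : F = fun x => fine (mu (orthant side1 x 0))); first exact: orthant1_to0.
by apply/funext => x; exact: marginal1_orthant.
Qed.

Lemma marginal2_low u : 0 < u -> exists x, G x < u.
Proof.
apply: cdf_low; rewrite (_ : G = fun x => fine (mu (orthant side2 0 x))); first exact: orthant2_to0.
by apply/funext => x; exact: marginal2_orthant.
Qed.

Lemma marginal1_high u : u < 1 -> exists x, u <= F x.
Proof.
apply: cdf_high; rewrite (_ : F = fun x => fine (mu (orthant side1 x 0))); first exact: orthant1_to1.
by apply/funext => x; exact: marginal1_orthant.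
Qed.

Lemma marginal2_high u : u < 1 -> exists x, u <= G x.
Proof.
apply: cdf_high; rewrite (_ : G = fun x => fine (mu (orthant side2 0 x))); first exact: orthant2_to1.
by apply/funext => x; exact: marginal2_orthant.
Qed.

(** The difference of two quadrants is covered by a vertical and a horizontal
strip. *)
Lemma orthant_increment c x x' y y' : x <= x' -> y <= y' ->
  fine (mu (orthant c x' y' `\` orthant c x y)) <= (F x' - F x) + (G y' - G y).
Proof.
move=> xx yy.
have m := measurable_orthant.
have dF : fine (mu (orthant side1 x' 0 `\` orthant side1 x 0)) = F x' - F x.
  by rewrite !(marginal1_orthant _ 0) fine_measureD//; exact: orthant_mono.
have dG : fine (mu (orthant side2 0 y' `\` orthant side2 0 y)) = G y' - G y.
  by rewrite !(marginal2_orthant 0) fine_measureD//; exact: orthant_mono.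
rewrite -dF -dG -fineD ?fin_num_measure//; try by apply: measurableD; exact: m.
rewrite fine_le ?fin_numD ?fin_num_measure//; try by apply: measurableD; exact: m.
apply: (le_trans _ (measureU2 _ _ _)); try by apply: measurableD; exact: m.
apply: le_measure; rewrite ?inE; try by apply: measurableD; exact: m.
  by apply: measurableU; apply: measurableD; exact: m.
rewrite orthant1 orthant1 orthant2 orthant2 /orthant /quadrant => -[a b].
case: (val c) => [|[|k]] /=; rewrite !in_itv/=.
- move=> [[ax b_y] n]; have [axx|nax] := pselect (a <= x).
    by right; split => // -[_ b_y2]; apply: n.
  by left; split => // -[].
- by move=> [[ax _] n]; left; split => // -[ax2 _]; apply: n.
- by move=> [[_ b_y] n]; right; split => // -[_ ?]; apply: n.
Qed.

End quadrant_families.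

(** * Empirical deviations on quadrants and half-planes *)

Section deviations_on_box.
Context (R : realType) d (Om : measurableType d) (P : probability Om R).
Context (mu : probability (R * R)%type R) (Z : nat -> Om -> R * R).
Hypothesis mZ : forall i, measurable_fun setT (Z i).
Hypothesis iidZ : iid_with_law P Z mu.
Local Notation dev := (dev mu Z).
Local Notation H := (joint_cdf mu).
Local Notation F := (marginal1 H).
Local Notation G := (marginal2 H).
Context (l1 r1 l2 r2 L : R).
Hypotheses (lr1 : l1 < r1) (lr2 : l2 < r2) (L0 : 0 <= L).
Hypothesis FL : forall x x', l1 <= x -> x <= x' -> x' <= r1 -> F x' - F x <= L * (x' - x).
Hypothesis GL : forall y y', l2 <= y -> y <= y' -> y' <= r2 -> G y' - G y <= L * (y' - y).

Definition grid (l r : R) (n i : nat) : R := l + i%:R / n.+1%:R * (r - l).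

Lemma grid_in (l r : R) n (i : 'I_n.+2) : l <= r -> l <= grid l r n i <= r.
Proof.
move=> lr; have i1 : i%:R / n.+1%:R <= 1 :> R.
  by rewrite ler_pdivrMr// mul1r ler_nat -ltnS ltn_ord.
have i0 : 0 <= i%:R / n.+1%:R :> R by rewrite divr_ge0.
have d0 : 0 <= r - l by rewrite subr_ge0.
rewrite /grid lerDl mulr_ge0//= -lerBrDl; by rewrite ler_piMl.
Qed.

Lemma grid_near (l r x : R) n : l < r -> l <= x <= r ->
  exists i : 'I_n.+2, `|x - grid l r n i| <= (r - l) / n.+1%:R.
Proof.
move=> lr /andP[lx xr]; have d0 : 0 < r - l by rewrite subr_gt0.
pose s := (x - l) / (r - l).
have s0 : 0 <= s by rewrite divr_ge0 ?subr_ge0// ltW.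
have s1 : s <= 1 by rewrite ler_pdivrMr// mul1r lerD2r.
have n0 : 0 < n.+1%:R :> R by [].
have sn0 : 0 <= s * n.+1%:R by rewrite mulr_ge0.
have /truncn_itv/andP[h1 h2] := sn0.
have im : (Num.truncn (s * n.+1%:R)%R < n.+2)%N.
  rewrite ltnS -(ler_nat R) (le_trans h1)//; by rewrite ler_piMl.
exists (Ordinal im); rewrite /grid /=.
move: (Num.truncn _) h1 h2 {im} => k h1 h2.
have -> : x - (l + k%:R / n.+1%:R * (r - l)) = (s * n.+1%:R - k%:R) * ((r - l) / n.+1%:R).
  rewrite /s; move: (n.+1%:R) n0 {s0 s1 sn0 h1 h2} => nn n0.
  by field; rewrite !lt0r_neq0.
rewrite normrM (ger0_norm (divr_ge0 (ltW d0) (ltW n0))) ler_piMl ?divr_ge0 ?(ltW d0)//.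
rewrite ger0_norm ?subr_ge0// lerBlDr; apply: ltW; by rewrite addrC natr1.
Qed.

Lemma grid_fine (dl : R) : 0 < dl -> exists n : nat,
  (r1 - l1) / n.+1%:R <= dl /\ (r2 - l2) / n.+1%:R <= dl.
Proof.
move=> dl0; pose w := (r1 - l1) + (r2 - l2).
have [w1 w2] : 0 < r1 - l1 /\ 0 < r2 - l2 by rewrite !subr_gt0.
have w0 : 0 <= w / dl by rewrite divr_ge0 ?(ltW dl0)// addr_ge0// ltW.
have /truncn_itv/andP[_ h] := w0.
exists (Num.truncn (w / dl)).
move: h; rewrite ltr_pdivrMr// /w mulrC => h.
by split; rewrite ler_pdivrMr//; lra.
Qed.

Let osc_c (c : 'I_3) (M eta : R) : 0 <= M -> 0 < eta ->
  exists2 dl : R, 0 < dl & moderately (fun n a =>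
  holds_but P (expR (- (a ^+ 2 * M))) (fun w =>
    forall x x' y y', l1 <= x <= r1 -> l1 <= x' <= r1 -> l2 <= y <= r2 -> l2 <= y' <= r2 ->
    `|x - x'| <= dl -> `|y - y'| <= dl ->
    `|dev a n w (orthant c x y) - dev a n w (orthant c x' y')| <= eta)).
Proof.
move=> M0 eta0.
have [w1 w2] : 0 < r1 - l1 /\ 0 < r2 - l2 by rewrite !subr_gt0 lr1 lr2.
pose S s t := orthant c (l1 + s * (r1 - l1)) (l2 + t * (r2 - l2)).
have mS s t : measurable (S s t) by exact: measurable_orthant.
have mono s s' t t' : s <= s' -> t <= t' -> S s t `<=` S s' t'.
  by move=> ss tt; apply: orthant_mono; rewrite lerD2l ler_wpM2r// ltW.
have L'0 : 0 <= L * ((r1 - l1) + (r2 - l2)) by rewrite mulr_ge0// addr_ge0// ltW.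
have lip s s' t t' : 0 <= s -> s <= s' -> s' <= 1 -> 0 <= t -> t <= t' -> t' <= 1 ->
    fine (mu (S s' t' `\` S s t)) <= L * ((r1 - l1) + (r2 - l2)) * ((s' - s) + (t' - t)).
  move=> s0 ss s1 t0 tt t1.
  have le1 : l1 + s * (r1 - l1) <= l1 + s' * (r1 - l1) by rewrite lerD2l ler_wpM2r// ltW.
  have le2 : l2 + t * (r2 - l2) <= l2 + t' * (r2 - l2) by rewrite lerD2l ler_wpM2r// ltW.
  apply: (le_trans (orthant_increment mu c le1 le2)).
  have in1 : l1 <= l1 + s * (r1 - l1) by rewrite lerDl mulr_ge0// ltW.
  have in2 : l2 <= l2 + t * (r2 - l2) by rewrite lerDl mulr_ge0// ltW.
  have in3 : l1 + s' * (r1 - l1) <= r1 by rewrite -lerBrDl ler_piMl// ltW.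
  have in4 : l2 + t' * (r2 - l2) <= r2 by rewrite -lerBrDl ler_piMl// ltW.
  apply: (le_trans (lerD (FL in1 le1 in3) (GL in2 le2 in4))).
  have -> : L * (l1 + s' * (r1 - l1) - (l1 + s * (r1 - l1))) +
    L * (l2 + t' * (r2 - l2) - (l2 + t * (r2 - l2))) =
    L * ((s' - s) * (r1 - l1) + (t' - t) * (r2 - l2)) by ring.
  rewrite -mulrA ler_wpM2l//.
  have a1 : 0 <= (s' - s) * (r2 - l2) by rewrite mulr_ge0 ?subr_ge0// -subr_ge0 ltW.
  have a2 : 0 <= (t' - t) * (r1 - l1) by rewrite mulr_ge0 ?subr_ge0// -subr_ge0 ltW.
  lra.
have [dl dl0 Hm] := modulus_tail mZ iidZ mS mono L'0 lip M0 eta0.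
exists (Num.min (dl * (r1 - l1)) (dl * (r2 - l2))).
  by rewrite lt_min !mulr_gt0.
apply: moderately_imp Hm => n a n0 a0; apply: holds_but_weak => // w Hw.
move=> x x' y y' Ax Ax' By By'; rewrite !le_min => /andP[xx _] /andP[_ yy].
have u01 (l r z : R) : 0 < r - l -> l <= z <= r -> 0 <= (z - l) / (r - l) <= 1.
  move=> lr /andP[lz zr]; have zl : 0 <= z - l by rewrite subr_ge0.
  by rewrite (divr_ge0 zl (ltW lr)) ler_pdivrMr// mul1r lerD2r.
have uE (l r z : R) : 0 < r - l -> l + (z - l) / (r - l) * (r - l) = z.
  by move=> lr; rewrite divfK ?lt0r_neq0//; ring.
have ud (l r z z' : R) : 0 < r - l -> `|z - z'| <= dl * (r - l) ->
    `|(z - l) / (r - l) - (z' - l) / (r - l)| <= dl.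
  move=> lr h; rewrite -mulrBl opprB addrA subrK normrM normfV (gtr0_norm lr).
  by rewrite ler_pdivrMr.
have := Hw _ _ _ _ (u01 _ _ _ w1 Ax) (u01 _ _ _ w1 Ax') (u01 _ _ _ w2 By) (u01 _ _ _ w2 By')
  (ud _ _ _ _ w1 xx) (ud _ _ _ _ w2 yy).
by rewrite /S !uE.
Qed.

Lemma oscillation_tail (M eta : R) : 0 <= M -> 0 < eta ->
  exists2 dl : R, 0 < dl & moderately (fun n a =>
  holds_but P (expR (- (a ^+ 2 * M))) (fun w => forall c : 'I_3,
    forall x x' y y', l1 <= x <= r1 -> l1 <= x' <= r1 -> l2 <= y <= r2 -> l2 <= y' <= r2 ->
    `|x - x'| <= dl -> `|y - y'| <= dl ->
    `|dev a n w (orthant c x y) - dev a n w (orthant c x' y')| <= eta)).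
Proof.
move=> M0 eta0.
have M10 : 0 <= M + 1 by rewrite addr_ge0.
have /choice[dl dlP] c : exists dl : R, 0 < dl /\ moderately (fun n a =>
  holds_but P (expR (- (a ^+ 2 * (M + 1)))) (fun w =>
    forall x x' y y', l1 <= x <= r1 -> l1 <= x' <= r1 -> l2 <= y <= r2 -> l2 <= y' <= r2 ->
    `|x - x'| <= dl -> `|y - y'| <= dl ->
    `|dev a n w (orthant c x y) - dev a n w (orthant c x' y')| <= eta)).
  by have [dl dl0 h] := osc_c c M10 eta0; exists dl.
exists (\big[Num.min/1]_c dl c).
  by apply: lt_bigmin => // c _; have [] := dlP c.
apply: moderately_imp (moderately_and (moderately_forall (fun c => (dlP c).2))
  (moderately_absorb 3 M)) => n a n0 a0 [h ab].
have := holds_but_forall_fin h; rewrite card_ord; apply: holds_but_weak => //.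
move=> w Hw c x x' y y' Ax Ax' By By' xx yy; apply: (Hw c) => //.
  by rewrite (le_trans xx)// bigmin_le_cond.
by rewrite (le_trans yy)// bigmin_le_cond.
Qed.

(** A Bernstein bound at each of finitely many nodes, and [oscillation_tail]
between them. *)
Lemma supremum_tail (M : R) : 0 <= M ->
  exists2 Mb : R, 0 < Mb & moderately (fun n a =>
  holds_but P (expR (- (a ^+ 2 * M))) (fun w => forall (c : 'I_3) x y,
    l1 <= x <= r1 -> l2 <= y <= r2 -> `|dev a n w (orthant c x y)| <= Mb)).
Proof.
move=> M0; have M10 : 0 <= M + 1 by rewrite addr_ge0.
have [dl dl0 Hosc] := oscillation_tail M10 ltr01.
have [N [N1 N2]] := grid_fine dl0.
pose J : finType := ('I_3 * 'I_N.+2 * 'I_N.+2)%type.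
pose gs (j : J) := orthant j.1.1 (grid l1 r1 N j.1.2) (grid l2 r2 N j.2).
(* With rho = 1 and V = 1 the exponent 2 - Mb of dev_tail is below - (M + 1). *)
pose Mb := M + 4.
have mgs j : measurable (gs j) by exact: measurable_orthant.
have gs1 j : fine (mu (gs j)) <= 1.
  by rewrite -lee_fin fineK ?fin_num_measure// probability_le1.
exists (Mb + 1); first by rewrite /Mb !ltr_wpDl// addr_ge0.
apply: moderately_imp (moderately_and (moderately_and Hosc (moderately_small ltr01))
  (moderately_absorb (1 + #|J|%:R * 2) M)) => n a n0 a0 [[h t1] ab].
have r1' : 1 * (a / Num.sqrt n%:R) <= 1 by rewrite mul1r.
have tl j := dev_tail mZ iidZ Mb (mgs j) (gs1 j) n0 a0 ler01 r1'.
apply: holds_but_weak (holds_but_and h (holds_but_forall_fin tl)).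
  apply: le_trans ab; rewrite [leRHS]mulrDl mul1r lerD2l.
  rewrite mulrA ler_wpM2l ?mulr_ge0// ler_expR /Mb expr1n.
  have : 2 * 1 * 1 - 1 * (M + 4) <= - (M + 1) by lra.
  by move=> /(ler_wpM2l (sqr_ge0 a)); rewrite mulrN.
move=> w [Hw Hg] c x y Ax By.
have [i xi] := grid_near N lr1 Ax; have [j yj] := grid_near N lr2 By.
have := Hw c _ _ _ _ Ax (grid_in i (ltW lr1)) By (grid_in j (ltW lr2)) (le_trans xi N1) (le_trans yj N2).
have := Hg (c, i, j); rewrite /gs/=.
have := ler_distD (dev a n w (orthant c (grid l1 r1 N i) (grid l2 r2 N j))) (dev a n w (orthant c x y)) 0.
rewrite !subr0; lra.
Qed.

End deviations_on_box.

(** * Empirical copula process *)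

Section grid_cover.
Context (R : realType) (l1 r1 l2 r2 : R).
Hypotheses (lr1 : l1 < r1) (lr2 : l2 < r2).

Lemma grid_cover (dl : R) : 0 < dl -> exists (N : nat) (pt : 'I_N -> 'I_3 * (R * R)),
  (forall j, l1 <= (pt j).2.1 <= r1 /\ l2 <= (pt j).2.2 <= r2) /\
  forall c x y, l1 <= x <= r1 -> l2 <= y <= r2 ->
    exists j, [/\ (pt j).1 = c, `|x - (pt j).2.1| <= dl & `|y - (pt j).2.2| <= dl].
Proof.
move=> dl0; have [n [n1 n2]] := grid_fine lr1 lr2 dl0.
pose J : finType := ('I_3 * ('I_n.+2 * 'I_n.+2))%type.
exists #|J|, (fun j => let k : J := enum_val j in
  (k.1, (grid l1 r1 n k.2.1, grid l2 r2 n k.2.2))); split => [j|c x y Ax By].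
  by split; apply: grid_in; exact: ltW.
have [i xi] := grid_near n lr1 Ax; have [j yj] := grid_near n lr2 By.
exists (enum_rank ((c, (i, j)) : J)); rewrite enum_rankK /=.
by split => //; [exact: le_trans n1|exact: le_trans n2].
Qed.

End grid_cover.

Lemma subr_sub3 (R : realType) (a b c a' b' c' : R) :
  a - b - c - (a' - b' - c') = (a - a') - (b - b') - (c - c').
Proof. ring. Qed.

Lemma linearized_rescale (R : realType) (t f g A a1 a2 d0 d1 d2 : R) :
  t != 0 -> f != 0 -> g != 0 ->
  t^-1 * A - (d0 - a1 * (d1 / f) - a2 * (d2 / g)) =
  t^-1 * (A - (t * d0 - a1 * (t * d1 / f) - a2 * (t * d2 / g))).
Proof. by move=> t0 f0 g0; field; rewrite f0 g0 t0. Qed.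

Section empirical_copula_process.
Context (R : realType) d (Om : measurableType d) (P : probability Om R).
Context (mu : probability (R * R)%type R) (Z : nat -> Om -> R * R).
Hypothesis mZ : forall i, measurable_fun setT (Z i).
Hypothesis iidZ : iid_with_law P Z mu.
Local Notation dev := (dev mu Z).
Local Notation ip := (ip mu).
Local Notation sqint := (sqint mu).
Local Notation H := (joint_cdf mu).
Local Notation F := (marginal1 H).
Local Notation G := (marginal2 H).
Context (p q eps : R) (l1 r1 l2 r2 : R).
Hypotheses (p0 : 0 < p) (pq : p < q) (q1 : q < 1) (eps0 : 0 < eps).
Hypotheses (l1E : l1 = quantile F p - eps) (r1E : r1 = quantile F q + eps).
Hypotheses (l2E : l2 = quantile G p - eps) (r2E : r2 = quantile G q + eps).
Hypothesis dF : forall x, l1 <= x <= r1 -> derivable F x 1 /\ 0 < derive1 F x.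
Hypothesis cF : {within `[l1, r1], continuous (derive1 F)}.
Hypothesis dG : forall y, l2 <= y <= r2 -> derivable G y 1 /\ 0 < derive1 G y.
Hypothesis cG : {within `[l2, r2], continuous (derive1 G)}.
Hypothesis dH : forall x y, l1 <= x <= r1 -> l2 <= y <= r2 ->
  derivable (fun x' => H x' y) x 1 /\ derivable (fun y' => H x y') y 1.
Hypothesis cH1 : {within `[l1, r1] `*` `[l2, r2], continuous (fun z => partial1 H z.1 z.2)}.
Hypothesis cH2 : {within `[l1, r1] `*` `[l2, r2], continuous (fun z => partial2 H z.1 z.2)}.

Lemma window1 u : p <= u -> u <= q -> l1 <= quantile F u <= r1.
Proof.
exact: (quantile_inA l1E r1E (@marginal1_mono _ mu) (@marginal1_low _ mu)
  (@marginal1_high _ mu) p0 q1 eps0).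
Qed.

Lemma window2 u : p <= u -> u <= q -> l2 <= quantile G u <= r2.
Proof.
exact: (quantile_inA l2E r2E (@marginal2_mono _ mu) (@marginal2_low _ mu)
  (@marginal2_high _ mu) p0 q1 eps0).
Qed.

Lemma window_lt1 : l1 < r1.
Proof.
have := eps0; have := l1E; have := r1E.
have := quantile_mono (@marginal1_mono _ mu) (@marginal1_low _ mu) (@marginal1_high _ mu)
  p0 (ltW pq) q1; lra.
Qed.

Lemma window_lt2 : l2 < r2.
Proof.
have := eps0; have := l2E; have := r2E.
have := quantile_mono (@marginal2_mono _ mu) (@marginal2_low _ mu) (@marginal2_high _ mu)
  p0 (ltW pq) q1; lra.
Qed.

Lemma regularity_constants : exists m L Dm : R, [/\ 0 < m, 0 < L & 0 < Dm] /\
  [/\ forall x, l1 <= x <= r1 -> m <= derive1 F x,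
      forall y, l2 <= y <= r2 -> m <= derive1 G y,
      forall x x', l1 <= x -> x <= x' -> x' <= r1 -> F x' - F x <= L * (x' - x),
      forall y y', l2 <= y -> y <= y' -> y' <= r2 -> G y' - G y <= L * (y' - y) &
      forall x y, l1 <= x <= r1 -> l2 <= y <= r2 ->
        `|partial1 H x y| <= Dm /\ `|partial2 H x y| <= Dm].
Proof.
have [m1 m10 m1P] := positive_lower_bound (ltW window_lt1) (fun x Ax => (dF Ax).2) cF.
have [m2 m20 m2P] := positive_lower_bound (ltW window_lt2) (fun x Ax => (dG Ax).2) cG.
have [L1 L10 L1P] := compact_abs_bound (@segment_compact _ l1 r1) cF.
have [L2 L20 L2P] := compact_abs_bound (@segment_compact _ l2 r2) cG.
have cK : compact (`[l1, r1] `*` `[l2, r2])%classic.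
  by apply: compact_setX; exact: segment_compact.
have [D1 D10 D1P] := compact_abs_bound cK cH1.
have [D2 D20 D2P] := compact_abs_bound cK cH2.
exists (Num.min m1 m2), (Num.max L1 L2), (Num.max D1 D2).
split; first by split; rewrite ?lt_min ?lt_max ?m10 ?L10 ?D10.
split.
- by move=> x Ax; rewrite ge_min m1P.
- by move=> x Ax; rewrite ge_min m2P ?orbT.
- move=> x x' lx xx xr.
  have Ax : l1 <= x <= r1 by rewrite lx (le_trans xx).
  have Ax' : l1 <= x' <= r1 by rewrite (le_trans lx).
  have [c [Ac _ ->]] := mvt_interval (fun x Ax => (dF Ax).1) Ax Ax'.
  rewrite ler_wpM2r ?subr_ge0// le_max (le_trans (ler_norm _)) ?L1P//= in_itv//.
- move=> x x' lx xx xr.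
  have Ax : l2 <= x <= r2 by rewrite lx (le_trans xx).
  have Ax' : l2 <= x' <= r2 by rewrite (le_trans lx).
  have [c [Ac _ ->]] := mvt_interval (fun x Ax => (dG Ax).1) Ax Ax'.
  by rewrite ler_wpM2r ?subr_ge0// le_max orbC (le_trans (ler_norm _)) ?L2P//= in_itv.
- move=> x y Ax By; have K : (`[l1, r1] `*` `[l2, r2])%classic (x, y).
    by split; rewrite /= in_itv.
  split; rewrite le_max; first by rewrite (D1P _ K).
  by rewrite (D2P _ K) orbT.
Qed.

Lemma regularity_uniform (om : R) : 0 < om -> exists2 dl : R, 0 < dl &
  [/\ forall x x', l1 <= x <= r1 -> l1 <= x' <= r1 -> `|x - x'| <= dl ->
        `|derive1 F x - derive1 F x'| <= om,
      forall y y', l2 <= y <= r2 -> l2 <= y' <= r2 -> `|y - y'| <= dl ->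
        `|derive1 G y - derive1 G y'| <= om &
      forall x x' y y', l1 <= x <= r1 -> l1 <= x' <= r1 -> l2 <= y <= r2 -> l2 <= y' <= r2 ->
        `|x - x'| <= dl -> `|y - y'| <= dl ->
        `|partial1 H x y - partial1 H x' y'| <= om /\
        `|partial2 H x y - partial2 H x' y'| <= om].
Proof.
move=> om0.
have [e1 e10 e1P] := compact_uniform_continuity (@segment_compact _ l1 r1) cF om0.
have [e2 e20 e2P] := compact_uniform_continuity (@segment_compact _ l2 r2) cG om0.
have cK : compact (`[l1, r1] `*` `[l2, r2])%classic.
  by apply: compact_setX; exact: segment_compact.
have [e3 e30 e3P] := compact_uniform_continuity cK cH1 om0.
have [e4 e40 e4P] := compact_uniform_continuity cK cH2 om0.
pose e := Num.min (Num.min e1 e2) (Num.min e3 e4).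
have e_0 : 0 < e by rewrite !lt_min e10 e20 e30 e40.
have e2e : e / 2 < e by rewrite ltr_pdivrMr// ltr_pMr// ltr1n.
have [le1 le2 le3 le4] : [/\ e <= e1, e <= e2, e <= e3 & e <= e4].
  by rewrite /e !ge_min !lexx ?orbT.
exists (e / 2); first by rewrite divr_gt0.
split.
- move=> x x' Ax Ax' xx; apply: e1P; rewrite /= ?in_itv//.
  by rewrite /ball/= (le_lt_trans xx)// (lt_le_trans e2e).
- move=> x x' Ax Ax' xx; apply: e2P; rewrite /= ?in_itv//.
  by rewrite /ball/= (le_lt_trans xx)// (lt_le_trans e2e).
- move=> x x' y y' Ax Ax' By By' xx yy.
  have K : (`[l1, r1] `*` `[l2, r2])%classic (x, y) by split; rewrite /= in_itv.
  have K' : (`[l1, r1] `*` `[l2, r2])%classic (x', y') by split; rewrite /= in_itv.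
  have b z : e <= z -> ball (x, y) z (x', y').
    by move=> ez; split; rewrite /ball/= (le_lt_trans _ (lt_le_trans e2e ez)).
  by split; [exact: (e3P _ _ K K' (b _ le3))|exact: (e4P _ _ K K' (b _ le4))].
Qed.

(** The derivative of the copula map at a function whose value and two
marginals at [(x, y)] are given. Detaching it from the function lets it act on the
empirical deviations and on the primitives of densities alike. *)
Definition linearized (x y al0 al1 al2 : R) :=
  al0 - partial1 H x y * (al1 / derive1 F x) - partial2 H x y * (al2 / derive1 G y).

Definition Phi_density (gam : R * R -> R) (x y : R) := linearized x y
  (ip gam \1_(orthant joint x y)) (ip gam \1_(orthant side1 x y)) (ip gam \1_(orthant side2 x y)).

Lemma Phi'_Phi_density gam u v : sqint gam ->
  Phi' mu (fun s t => ip gam \1_(quadrant s t)) u v =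
  Phi_density gam (quantile F u) (quantile G v).
Proof.
move=> sg; rewrite /Phi' /Phi_density /linearized orthant0.
by rewrite (marginal1_ip _ (quantile G v) sg) (marginal2_ip (quantile F u) _ sg).
Qed.

Lemma empirical_dev n (a : R) w c x y : (0 < n)%N -> 0 < a ->
  (\sum_(i < n) \1_(orthant c x y) (Z i w)) / n%:R - fine (mu (orthant c x y)) =
  a / Num.sqrt n%:R * dev a n w (orthant c x y).
Proof.
move=> n0 a0; have sn0 : 0 < Num.sqrt (n%:R : R) by rewrite sqrtr_gt0 ltr0n.
have nE : n%:R = Num.sqrt (n%:R : R) ^+ 2 by rewrite sqr_sqrtr.
rewrite !devE sumrB sumr_const card_ord -[fine _ *+ n]mulr_natl.
move: nE sn0; move: (Num.sqrt _) => s -> s0.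
by field; rewrite !lt0r_neq0.
Qed.

Let Hn n w := empirical_joint_cdf n (fun i => Z i w).
Let Fn n w := empirical_cdf n (fst \o (fun i => Z i w)).
Let Gn n w := empirical_cdf n (snd \o (fun i => Z i w)).

Let HnE n w x y : Hn n w x y = (\sum_(i < n) \1_(orthant joint x y) (Z i w)) / n%:R.
Proof. by rewrite /Hn /empirical_joint_cdf mulrC orthant0. Qed.

Let FnE n w x y : Fn n w x = (\sum_(i < n) \1_(orthant side1 x y) (Z i w)) / n%:R.
Proof.
rewrite /Fn /empirical_cdf mulrC orthant1; congr (_ / _); apply: eq_bigr => i _.
rewrite !indicE; congr (_%:R); congr nat_of_bool.
by apply/idP/idP => /set_mem h; apply/mem_set; [split|case: h].
Qed.

Let GnE n w x y : Gn n w y = (\sum_(i < n) \1_(orthant side2 x y) (Z i w)) / n%:R.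
Proof.
rewrite /Gn /empirical_cdf mulrC orthant2; congr (_ / _); apply: eq_bigr => i _.
rewrite !indicE; congr (_%:R); congr nat_of_bool.
by apply/idP/idP => /set_mem h; apply/mem_set; [split|case: h].
Qed.

Let Hdev n (a : R) w x y : (0 < n)%N -> 0 < a ->
  Hn n w x y - H x y = a / Num.sqrt n%:R * dev a n w (orthant joint x y).
Proof. by move=> n0 a0; rewrite -empirical_dev// HnE joint_cdf_orthant. Qed.

Let Fdev n (a : R) w x y : (0 < n)%N -> 0 < a ->
  Fn n w x - F x = a / Num.sqrt n%:R * dev a n w (orthant side1 x y).
Proof. by move=> n0 a0; rewrite -empirical_dev// (FnE _ _ _ y) (marginal1_orthant _ _ y). Qed.

Let Gdev n (a : R) w x y : (0 < n)%N -> 0 < a ->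
  Gn n w y - G y = a / Num.sqrt n%:R * dev a n w (orthant side2 x y).
Proof. by move=> n0 a0; rewrite -empirical_dev// (GnE _ _ x) (marginal2_orthant _ x). Qed.

Lemma empirical_cdf_mono n (x : nat -> R) : {homo empirical_cdf n x : s t / s <= t}.
Proof.
move=> s t st; rewrite /empirical_cdf ler_wpM2l ?invr_ge0//.
apply: ler_sum => i _; rewrite !indicE ler_nat.
have [h|h] := pselect (x i \in `]-oo, s]%classic); last by move/negP: h => /negbTE ->.
rewrite h; suff -> : x i \in `]-oo, t]%classic by [].
move/set_mem: h; rewrite /= in_itv/= => h; apply/mem_set; rewrite /= in_itv/=.
exact: le_trans h st.
Qed.

Definition copula_process n (a : R) w u v : R := Num.sqrt n%:R / a *
  (copula (Hn n w) (Fn n w) (Gn n w) u v - copula H F G u v).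

Definition linearized_dev n a w x y := linearized x y
  (dev a n w (orthant joint x y)) (dev a n w (orthant side1 x y)) (dev a n w (orthant side2 x y)).

(** The deterministic part of the delta method, with step t = a / sqrt n: the
quantiles are linearized first, and then the copula. *)
Lemma copula_process_linearized (Mb kap : R) : 0 < Mb -> 0 < kap ->
  exists2 eta : R, 0 < eta & exists2 dl0 : R, 0 < dl0 &
  forall dl : R, 0 < dl -> dl <= dl0 -> moderately (fun n a => forall w,
    (forall (c : 'I_3) x y, l1 <= x <= r1 -> l2 <= y <= r2 ->
       `|dev a n w (orthant c x y)| <= Mb) ->
    (forall (c : 'I_3) x x' y y', l1 <= x <= r1 -> l1 <= x' <= r1 ->
       l2 <= y <= r2 -> l2 <= y' <= r2 -> `|x - x'| <= dl -> `|y - y'| <= dl ->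
       `|dev a n w (orthant c x y) - dev a n w (orthant c x' y')| <= eta) ->
    forall u v : R, p <= u <= q -> p <= v <= q ->
      `|copula_process n a w u v - linearized_dev n a w (quantile F u) (quantile G v)|
        <= kap).
Proof.
move=> Mb0 kap0.
have [m [L [Dm [[m0 L0 Dm0] [Fm Gm _ _ HD]]]]] := regularity_constants.
pose C := 1 + 2 * (Mb / m + Dm * ((1 + Mb / m) / m)).
have b0 : 0 < Mb / m by rewrite divr_gt0.
have C0 : 0 < C.
  by rewrite /C addr_gt0// mulr_gt0// addr_gt0// mulr_gt0// divr_gt0// addr_gt0.
pose e := kap / C.
have e0 : 0 < e by rewrite divr_gt0.
have eC : e * C = kap by rewrite divfK// lt0r_neq0.
exists e => //.
have [dl0 dl00 [ucF ucG ucH]] := regularity_uniform e0.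
exists dl0 => // dl dlp dldl0.
have hdl : dl / 2 <= dl by rewrite ler_pdivrMr// ler_peMr ?ler1n// ltW.
have epsp := eps0.
(* Under this bound on a / sqrt n the empirical quantiles stay in the window, and within
   dl / 2 of the true ones. *)
have t10 : 0 < Num.min (m * eps / (4 * Mb)) (m * dl / (2 * Mb)).
  by rewrite lt_min !divr_gt0 ?mulr_gt0.
apply: moderately_imp (moderately_small t10) => n a n0 a0.
rewrite le_min => /andP[t1 t2] w sup osc u v /andP[pu uq] /andP[pv vq].
set x := quantile F u; set y := quantile G v.
have sn0 : 0 < Num.sqrt (n%:R : R) by rewrite sqrtr_gt0 ltr0n.
set t := a / Num.sqrt n%:R in t1 t2.
have t0 : 0 < t by rewrite divr_gt0.
have tM : t * Mb < m * (eps / 2).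
  move: t1; rewrite ler_pdivlMr ?mulr_gt0// => h.
  have := mulr_gt0 m0 epsp; lra.
have tMdl : t * Mb / m <= dl / 2.
  move: t2; rewrite ler_pdivlMr ?mulr_gt0// => h.
  by rewrite ler_pdivrMr//; lra.
have x_y : l1 < r1 /\ l2 < r2 by split; [exact: window_lt1|exact: window_lt2].
have lA : l1 <= l1 <= r1 by rewrite lexx ltW//; case: x_y.
have lB : l2 <= l2 <= r2 by rewrite lexx ltW//; case: x_y.
have d0dl : `|(l1 - l1 : R)| <= dl by rewrite subrr normr0 ltW.
have d0dl2 : `|(l2 - l2 : R)| <= dl by rewrite subrr normr0 ltW.
have FnF z : l1 <= z <= r1 -> `|Fn n w z - F z| <= t * Mb.
  by move=> Az; rewrite (Fdev _ _ l2 n0 a0) normrM (gtr0_norm t0) ler_wpM2l ?(ltW t0)// sup.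
have GnG z : l2 <= z <= r2 -> `|Gn n w z - G z| <= t * Mb.
  by move=> Az; rewrite (Gdev _ l1 _ n0 a0) normrM (gtr0_norm t0) ler_wpM2l ?(ltW t0)// sup.
have Fosc z z' : l1 <= z <= r1 -> l1 <= z' <= r1 -> `|z - z'| <= dl ->
    `|(Fn n w z - F z) - (Fn n w z' - F z')| <= t * e.
  move=> Az Az' zz; rewrite !(Fdev _ _ l2 n0 a0) -mulrBr normrM (gtr0_norm t0).
  by rewrite ler_wpM2l ?(ltW t0)// osc.
have Gosc z z' : l2 <= z <= r2 -> l2 <= z' <= r2 -> `|z - z'| <= dl ->
    `|(Gn n w z - G z) - (Gn n w z' - G z')| <= t * e.
  move=> Az Az' zz; rewrite !(Gdev _ l1 _ n0 a0) -mulrBr normrM (gtr0_norm t0).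
  by rewrite ler_wpM2l ?(ltW t0)// osc.
have [Axn xnb xnk] := quantile_linearization l1E r1E (@marginal1_mono _ mu) (@marginal1_low _ mu)
  (@marginal1_high _ mu) p0 pq q1 eps0 m0 (fun x Ax => (dF Ax).1) Fm
  (@empirical_cdf_mono n _) t0 (ltW Mb0) (ltW e0) dlp FnF Fosc
  (fun z z' Az Az' zz => ucF z z' Az Az' (le_trans zz dldl0)) tM tMdl pu uq.
have [Byn ynb ynk] := quantile_linearization l2E r2E (@marginal2_mono _ mu) (@marginal2_low _ mu)
  (@marginal2_high _ mu) p0 pq q1 eps0 m0 (fun x Ax => (dG Ax).1) Gm
  (@empirical_cdf_mono n _) t0 (ltW Mb0) (ltW e0) dlp GnG Gosc
  (fun z z' Az Az' zz => ucG z z' Az Az' (le_trans zz dldl0)) tM tMdl pv vq.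
rewrite -/x -/(Fn n w) in Axn xnb xnk; rewrite -/y -/(Gn n w) in Byn ynb ynk.
have Ax : l1 <= x <= r1.
  exact: window1.
have By : l2 <= y <= r2.
  exact: window2.
have tb : t * (Mb / m) <= dl by rewrite mulrA (le_trans tMdl).
rewrite -mulrA in xnb ynb.
have Hosc : `|(Hn n w (quantile (Fn n w) u) (quantile (Gn n w) v) -
     H (quantile (Fn n w) u) (quantile (Gn n w) v)) - (Hn n w x y - H x y)| <= t * e.
  rewrite !(Hdev _ _ _ n0 a0) -mulrBr normrM (gtr0_norm t0) ler_wpM2l ?(ltW t0)//.
  by apply: osc => //; [exact: le_trans tb|exact: le_trans tb].
have := copula_linearization dH HD ucH (ltW t0) Ax Axn By Byn xnb ynb
  (le_trans tb dldl0) xnk ynk Hosc.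
rewrite (Hdev _ _ _ n0 a0) (Fdev _ _ y n0 a0) (Gdev _ x _ n0 a0) -/t => key.
have -> : copula_process n a w u v - linearized_dev n a w x y =
  t^-1 * (Hn n w (quantile (Fn n w) u) (quantile (Gn n w) v) - H x y -
    (t * dev a n w (orthant joint x y) - partial1 H x y * (t * dev a n w (orthant side1 x y) / derive1 F x)
      - partial2 H x y * (t * dev a n w (orthant side2 x y) / derive1 G y))).
  rewrite /copula_process /copula -/x -/y /linearized_dev /linearized.
  have -> : Num.sqrt n%:R / a = t^-1 by rewrite /t invf_div.
  have fx := lt0r_neq0 (lt_le_trans m0 (Fm _ Ax)).
  have gy := lt0r_neq0 (lt_le_trans m0 (Gm _ By)).
  exact: (linearized_rescale _ _ _ _ _ _ (lt0r_neq0 t0) fx gy).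
rewrite normrM normfV (gtr0_norm t0) mulrC ler_pdivrMr// (le_trans key)//.
rewrite mulrC ler_wpM2r ?(ltW t0)// -eC /C le_eqVlt; apply/orP; left; apply/eqP.
by field; rewrite lt0r_neq0.
Qed.


(** Counterpart of [oscillation_tail] for the limits. Two arbitrary corners are
compared with their coordinatewise minimum, so that the sets are nested. *)
Lemma ip_orthant_oscillation (C e : R) : 0 <= C -> 0 < e -> exists2 dl : R, 0 < dl &
  forall gam, sqint gam -> ip gam gam <= C -> forall (c : 'I_3) x x' y y',
    l1 <= x <= r1 -> l1 <= x' <= r1 -> l2 <= y <= r2 -> l2 <= y' <= r2 ->
    `|x - x'| <= dl -> `|y - y'| <= dl ->
    `|ip gam \1_(orthant c x y) - ip gam \1_(orthant c x' y')| <= e.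
Proof.
move=> C0 e0.
have [m [L [Dm [[m0 L0 Dm0] [_ _ FL GL _]]]]] := regularity_constants.
have CL0 : 0 <= C * L by rewrite mulr_ge0// ltW.
pose dl := e ^+ 2 / (8 * (C * L + 1)).
have dl0 : 0 < dl by rewrite divr_gt0 ?exprn_gt0// mulr_gt0// ltr_wpDl.
have dlE : dl * (8 * (C * L + 1)) = e ^+ 2.
  by rewrite divfK// lt0r_neq0// mulr_gt0// ltr_wpDl.
exists dl => // gam sg gC c.
have mono x x' y y' : l1 <= x -> x <= x' -> x' <= r1 -> l2 <= y -> y <= y' -> y' <= r2 ->
    x' - x <= dl -> y' - y <= dl ->
    `|ip gam \1_(orthant c x' y') - ip gam \1_(orthant c x y)| <= e / 2.
  move=> lx xx xr ly yy yr xd yd.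
  have e20 : 0 <= e / 2 by rewrite divr_ge0// ltW.
  rewrite -(@ler_pXn2r _ 2)// ?nnegrE// real_normK ?num_real//.
  apply: (le_trans (ip_indic_diff sg (measurable_orthant c x y) (measurable_orthant c x' y')
    (orthant_mono xx yy))).
  have h1 : fine (mu (orthant c x' y' `\` orthant c x y)) <= L * (2 * dl).
    apply: (le_trans (orthant_increment mu c xx yy)).
    apply: (le_trans (lerD (FL _ _ lx xx xr) (GL _ _ ly yy yr))).
    by rewrite -mulrDr ler_wpM2l ?(ltW L0)// mulr_natl mulr2n lerD.
  apply: (@le_trans _ _ (C * (L * (2 * dl)))).
    by apply: ler_pM => //; [exact: ip_ge0|exact: fine_ge0].
  have : 0 <= dl * 8 by rewrite mulr_ge0// ltW.
  rewrite expr2; move: dlE; rewrite expr2; lra.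
move=> x x' y y' Ax Ax' By By' xx yy.
have min_in (l r z z' : R) : l <= z <= r -> l <= z' <= r -> `|z - z'| <= dl ->
   [/\ l <= Num.min z z', Num.min z z' <= z, Num.min z z' <= z', z - Num.min z z' <= dl
     & z' - Num.min z z' <= dl].
  move=> /andP[lz zr] /andP[lz' zr'] zz.
  have [zz'|zz'] := leP z z'; split; rewrite ?lexx ?subrr ?(ltW dl0) ?(ltW zz')//.
    by apply: le_trans zz; rewrite distrC ler_norm.
  by apply: le_trans zz; rewrite ler_norm.
have [a1 a2 a3 a4 a5] := min_in _ _ _ _ Ax Ax' xx.
have [b1 b2 b3 b4 b5] := min_in _ _ _ _ By By' yy.
have /andP[_ xr] := Ax; have /andP[_ xr'] := Ax'.
have /andP[_ yr] := By; have /andP[_ yr'] := By'.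
have h1 := mono _ _ _ _ a1 a2 xr b1 b2 yr a4 b4.
have h2 := mono _ _ _ _ a1 a3 xr' b1 b3 yr' a5 b5.
rewrite (splitr e); apply: (le_trans (ler_distD (ip gam \1_(orthant c (Num.min x x') (Num.min y y'))) _ _)).
by apply: lerD; [exact: h1|rewrite distrC; exact: h2].
Qed.

Lemma linearized_lipschitz : exists2 B : R, 0 < B & forall x y al0 al1 al2 be0 be1 be2 e : R,
  l1 <= x <= r1 -> l2 <= y <= r2 ->
  `|al0 - be0| <= e -> `|al1 - be1| <= e -> `|al2 - be2| <= e ->
  `|linearized x y al0 al1 al2 - linearized x y be0 be1 be2| <= B * e.
Proof.
have [m [L [Dm [[m0 L0 Dm0] [Fm Gm _ _ HD]]]]] := regularity_constants.
exists (1 + 2 * (Dm / m)); first by rewrite addr_gt0// mulr_gt0// divr_gt0.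
move=> x y al0 al1 al2 be0 be1 be2 e Ax By h0 h1 h2.
have [d1 d2] := HD _ _ Ax By.
have fx := Fm _ Ax; have gy := Gm _ By.
have e0 : 0 <= e := le_trans (normr_ge0 _) h0.
have term (D f a b : R) : `|D| <= Dm -> m <= f -> `|a - b| <= e ->
    `|D * (a / f) - D * (b / f)| <= Dm / m * e.
  move=> Db mf ab; have f0 : 0 < f := lt_le_trans m0 mf.
  rewrite -mulrBr -mulrBl !normrM mulrAC -mulrA ler_pM ?mulr_ge0//.
  rewrite ler_pM// normfV (gtr0_norm f0) lef_pV2// posrE.
have t1 := term _ _ _ _ d1 fx h1.
have t2 := term _ _ _ _ d2 gy h2.
rewrite /linearized.
rewrite subr_sub3.
apply: (le_trans (ler_normB _ _)); apply: (le_trans (lerD (ler_normB _ _) (lexx _))).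
apply: (le_trans (lerD (lerD h0 t1) t2)).
by rewrite le_eqVlt; apply/orP; left; apply/eqP; ring.
Qed.

(** Finitely many integrals determine the image of a density of bounded norm up
to [kap]: the derivative is compact from L2 to bounded functions. *)
Lemma Phi_grid_control (C kap : R) : 0 <= C -> 0 < kap ->
  exists (N : nat) (S : 'I_N -> set (R * R)), (forall j, measurable (S j)) /\
  exists2 eta : R, 0 < eta & forall gam gam', sqint gam -> sqint gam' ->
    ip gam gam <= C -> ip gam' gam' <= C ->
    (forall j, `|ip gam \1_(S j) - ip gam' \1_(S j)| <= eta) ->
    forall x y, l1 <= x <= r1 -> l2 <= y <= r2 -> `|Phi_density gam x y - Phi_density gam' x y| <= kap.
Proof.
move=> C0 kap0; have [B B0 HB] := linearized_lipschitz.
pose eta := kap / (3 * B).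
have eta0 : 0 < eta by rewrite divr_gt0// mulr_gt0.
have etaE : B * (eta + eta + eta) = kap by rewrite /eta; field; rewrite lt0r_neq0.
have [dl dl0 Hosc] := ip_orthant_oscillation C0 eta0.
have [N [pt [ptin ptnear]]] := grid_cover window_lt1 window_lt2 dl0.
exists N, (fun j => orthant (pt j).1 (pt j).2.1 (pt j).2.2); split.
  by move=> j; exact: measurable_orthant.
exists eta => // gam gam' sg sg' gC gC' close x y Ax By.
have main c : `|ip gam \1_(orthant c x y) - ip gam' \1_(orthant c x y)| <= eta + eta + eta.
  have [j [jc xj yj]] := ptnear c x y Ax By; have [Aj Bj] := ptin j.
  have h1 := Hosc _ sg gC c _ _ _ _ Ax Aj By Bj xj yj.
  have h2 := Hosc _ sg' gC' c _ _ _ _ Ax Aj By Bj xj yj.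
  have := close j; rewrite jc => h3.
  apply: (le_trans (ler_distD (ip gam' \1_(orthant c (pt j).2.1 (pt j).2.2)) _ _)).
  apply: lerD; last by rewrite distrC; exact: h2.
  apply: (le_trans (ler_distD (ip gam \1_(orthant c (pt j).2.1 (pt j).2.2)) _ _)).
  by apply: lerD; [exact: h1|exact: h3].
by rewrite -etaE /Phi_density; apply: HB.
Qed.

(** The grid is chosen so fine that the deviations and the primitives of the
densities in the ball both vary by at most [eta] between nodes. *)
Lemma copula_process_near_Phi (M C kap : R) : 0 <= M -> 0 <= C -> 0 < kap ->
  exists (N : nat) (S : 'I_N -> set (R * R)), (forall j, measurable (S j)) /\
  exists2 eta : R, 0 < eta & exists2 Mb : R, 0 < Mb & moderately (fun n a =>
    holds_but P (expR (- (a ^+ 2 * M))) (fun w =>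
      (forall j, `|dev a n w (S j)| <= Mb) /\
      forall gam, sqint gam -> ip gam gam <= C ->
        (forall j, `|dev a n w (S j) - ip gam \1_(S j)| <= eta) ->
        forall u v : R, p <= u <= q -> p <= v <= q ->
        `|copula_process n a w u v - Phi_density gam (quantile F u) (quantile G v)| <= kap)).
Proof.
move=> M0 C0 kap0; have [B B0 HB] := linearized_lipschitz.
have [m [L [Dm [[m0 L0 Dm0] [_ _ FL GL _]]]]] := regularity_constants.
have M10 : 0 <= M + 1 by rewrite addr_ge0.
have kap20 : 0 < kap / 2 by rewrite divr_gt0.
have [Mb Mb0 Hsup] := supremum_tail mZ iidZ window_lt1 window_lt2 (ltW L0) FL GL M10.
have [e1 e10 [dl1 dl10 Hlin]] := copula_process_linearized Mb0 kap20.
pose eta := Num.min e1 (kap / 2 / (3 * B)).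
have eta0 : 0 < eta by rewrite lt_min e10 divr_gt0// mulr_gt0.
have etaE : B * (eta + eta + eta) <= kap / 2.
  have : eta <= kap / 2 / (3 * B) by rewrite ge_min lexx orbT.
  by rewrite ler_pdivlMr ?mulr_gt0// => h; apply: le_trans h; lra.
have [dl2 dl20 Hosc] := oscillation_tail mZ iidZ window_lt1 window_lt2 (ltW L0) FL GL M10 eta0.
have [dl3 dl30 Hgam] := ip_orthant_oscillation C0 eta0.
pose dl := Num.min dl1 (Num.min dl2 dl3).
have dl0 : 0 < dl by rewrite !lt_min dl10 dl20.
have [ld1 ld2 ld3] : [/\ dl <= dl1, dl <= dl2 & dl <= dl3].
  by rewrite /dl !ge_min !lexx ?orbT.
have [N [pt [ptin ptnear]]] := grid_cover window_lt1 window_lt2 dl0.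
exists N, (fun j => orthant (pt j).1 (pt j).2.1 (pt j).2.2); split.
  by move=> j; exact: measurable_orthant.
exists eta => //; exists Mb => //.
apply: moderately_imp (moderately_and (moderately_and Hsup Hosc)
  (moderately_and (Hlin dl dl0 ld1) (moderately_absorb 2 M))) => n a n0 a0 [[h1 h2] [h3 h4]].
apply: holds_but_weak (holds_but_and h1 h2).
  by apply: le_trans h4; rewrite mulr_natl mulr2n.
move=> w [sup osc]; split.
  by move=> j; have [Aj Bj] := ptin j; exact: sup.
move=> gam sg gC close u v /[dup] puq /andP[pu uq] /[dup] pvq /andP[pv vq].
have Ax : l1 <= quantile F u <= r1.
  exact: window1.
have By : l2 <= quantile G v <= r2.
  exact: window2.
set x := quantile F u in Ax *; set y := quantile G v in By *.
have k1 : `|copula_process n a w u v - linearized_dev n a w x y| <= kap / 2.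
  apply: (h3 w sup) => // c x1 x1' y1 y1' A1 A1' B1 B1' xx yy.
  apply: (@le_trans _ _ eta); last by rewrite ge_min lexx.
  by apply: osc => //; [exact: le_trans ld2|exact: le_trans ld2].
have main c : `|dev a n w (orthant c x y) - ip gam \1_(orthant c x y)| <= eta + eta + eta.
  have [j [jc xj yj]] := ptnear c x y Ax By; have [Aj Bj] := ptin j.
  have k2 := osc c _ _ _ _ Ax Aj By Bj (le_trans xj ld2) (le_trans yj ld2).
  have k3 := Hgam _ sg gC c _ _ _ _ Ax Aj By Bj (le_trans xj ld3) (le_trans yj ld3).
  have := close j; rewrite jc => k4.
  apply: (le_trans (ler_distD (ip gam \1_(orthant c (pt j).2.1 (pt j).2.2)) _ _)).
  apply: lerD; last by rewrite distrC; exact: k3.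
  apply: (le_trans (ler_distD (dev a n w (orthant c (pt j).2.1 (pt j).2.2)) _ _)).
  by apply: lerD; [exact: k2|exact: k4].
have k5 : `|linearized_dev n a w x y - Phi_density gam x y| <= kap / 2.
  by apply: le_trans etaE; apply: HB.
rewrite (splitr kap); apply: (le_trans (ler_distD (linearized_dev n a w x y) _ _)).
by apply: lerD; [exact: k1|exact: k5].
Qed.

End empirical_copula_process.

(** * Sequences of almost shortest densities *)

Section minimizing_sequences.
Context (R : realType) d (T : measurableType d) (mu : probability T R).
Local Notation ip := (ip mu).
Local Notation sqint := (sqint mu).

Definition midpoint (f g : T -> R) := fun x => 2^-1 * f x + 2^-1 * g x.

Lemma sqint_midpoint f g : sqint f -> sqint g -> sqint (midpoint f g).
Proof. exact: sqint_lin. Qed.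

Lemma parallelogram f g : sqint f -> sqint g ->
  ip (midpoint f g) (midpoint f g) + sqdist mu f g / 4 =
  (ip f f + ip g g) / 2.
Proof. by move=> sf sg; rewrite /midpoint ip_lin_sqr// ipB_sqr//; field. Qed.

Lemma ip_midpoint_le f g c : sqint f -> sqint g -> ip f f <= c -> ip g g <= c ->
  ip (midpoint f g) (midpoint f g) <= c.
Proof.
move=> sf sg fc gc; have := parallelogram sf sg.
have := ip_ge0 mu (fun x => f x - g x); lra.
Qed.

(** The least squared norm over [Gam k] increases with [k] to a finite limit. Two
almost shortest elements of [Gam N] have their midpoint in [Gam N], so it is not
much shorter than they are, and by the parallelogram law they are close to each
other. This provides a strong limit where compactness of balls would only
provide a weak one. *)
Lemma minimal_norm_limit (Gam : nat -> set (T -> R)) (C : R) :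
  (forall k f, Gam k f -> sqint f) ->
  (forall k l, (k <= l)%N -> Gam l `<=` Gam k) ->
  (forall k f g, Gam k f -> Gam k g -> Gam k (midpoint f g)) ->
  (forall k, exists2 f, Gam k f & ip f f <= C) ->
  exists2 g, sqint g & forall e : R, 0 < e -> exists N, forall k, (N <= k)%N ->
    exists2 f, Gam k f & sqdist mu f g <= e.
Proof.
move=> sG decG midG neG.
pose E k := [set ip f f | f in Gam k].
pose D k := inf (E k).
have Elb k : lbound (E k) 0 by move=> _ [f _ <-]; exact: ip_ge0.
have E0 k : E k !=set0 by have [f Gf _] := neG k; exists (ip f f), f.
have Einf k : has_inf (E k) by split => //; exists 0.
have Dmono k l : (k <= l)%N -> D k <= D l.
  move=> kl; apply: lb_le_inf => // _ [f Gf <-]; apply: ge_inf; first by exists 0.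
  by exists f => //; exact: decG Gf.
have DC k : D k <= C.
  have [f Gf fC] := neG k; apply: le_trans fC; apply: ge_inf; first by exists 0.
  by exists f.
have inv0 k : 0 < k.+1%:R^-1 :> R by [].
have /choice[f fP] k : exists f, Gam k f /\ ip f f <= D k + k.+1%:R^-1.
  have [_ [f Gf <-] h] := inf_adherent (inv0 k) (Einf k).
  by exists f; split => //; exact: ltW.
pose Dsup := sup (range D).
have Dub : has_sup (range D).
  by split; [exists (D 0%N), 0%N|exists C => _ [k _ <-]].
have cauchy (e : R) : 0 < e -> exists N, forall m n, (N <= m)%N -> (N <= n)%N ->
     sqdist mu (f m) (f n) <= e.
  move=> e0; have e8 : 0 < e / 16 by rewrite divr_gt0.
  have [_ [N0 _ <-] hN0] := sup_adherent e8 Dub.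
  pose N1 := Num.truncn (16 / e).
  have N1P : 16 / e < N1.+1%:R.
    have p : 0 <= 16 / e by rewrite divr_ge0// ltW.
    by have /truncn_itv/andP[] := p.
  have small k : (N1 <= k)%N -> k.+1%:R^-1 <= e / 16.
    move=> k1; rewrite -[leRHS]invrK lef_pV2 ?posrE ?invr_gt0// invf_div.
    by rewrite (le_trans (ltW N1P))// ler_nat.
  exists (maxn N0 N1) => m n; rewrite !geq_max => /andP[m0 m1] /andP[n0 n1].
  have [Gm fm] := fP m; have [Gn fn] := fP n.
  have Gm' := decG _ _ m0 _ Gm; have Gn' := decG _ _ n0 _ Gn.
  have := parallelogram (sG _ _ Gm) (sG _ _ Gn).
  have h1 : D N0 <= ip (midpoint (f m) (f n)) (midpoint (f m) (f n)).
    apply: ge_inf; first by exists 0.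
    by exists (midpoint (f m) (f n)) => //; exact: midG.
  have h2 k : D k <= Dsup by apply: ub_le_sup; [exact: Dub.2|exists k].
  have {}fm : ip (f m) (f m) <= Dsup + e / 16.
    by rewrite (le_trans fm)// lerD// ?small.
  have {}fn : ip (f n) (f n) <= Dsup + e / 16.
    by rewrite (le_trans fn)// lerD// ?small.
  move: hN0; rewrite -/Dsup; lra.
have [g sg gP] := sqint_complete (fun k => sG _ _ (fP k).1) cauchy.
exists g => // e e0; have [N NP] := gP e e0; exists N => k Nk.
by exists (f k); [exact: (fP k).1|exact: NP].
Qed.

End minimizing_sequences.

(** * Exponential rates *)

Section exponential_rates.
Context (R : realType).
Local Open Scope ereal_scope.

Lemma rate_upper (a c : R) (x : \bar R) : (0 < a)%R -> 0 <= x ->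
  x <= (expR (- (a ^+ 2 * c)))%:E -> (a ^+ 2)^-1%:E * lne x <= (- c)%:E.
Proof.
move=> a0 x0 xe; have a2 : (0 < a ^+ 2)%R by rewrite exprn_gt0.
have : lne x <= (- (a ^+ 2 * c))%:E.
  rewrite -[leRHS](_ : lne (expR (- (a ^+ 2 * c)))%:E = _); last first.
    by rewrite lne_EFin ?expR_gt0// expRK.
  by rewrite lee_lne// in_itv/= ?x0 ?leey// lee_fin expR_ge0.
have i0 : 0 <= (a ^+ 2)^-1%:E by rewrite lee_fin invr_ge0 ltW.
move=> /(lee_wpmul2l i0)/le_trans; apply.
by rewrite -EFinM lee_fin mulrN mulKf// lt0r_neq0.
Qed.

Lemma rate_lower (a c : R) (x : \bar R) : (0 < a)%R ->
  (expR (- (a ^+ 2 * c)))%:E <= x -> (- c)%:E <= (a ^+ 2)^-1%:E * lne x.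
Proof.
move=> a0 xe; have a2 : (0 < a ^+ 2)%R by rewrite exprn_gt0.
have x0 : 0 <= x by rewrite (le_trans _ xe)// lee_fin expR_ge0.
have : (- (a ^+ 2 * c))%:E <= lne x.
  rewrite -[leLHS](_ : lne (expR (- (a ^+ 2 * c)))%:E = _); last first.
    by rewrite lne_EFin ?expR_gt0// expRK.
  by rewrite lee_lne// in_itv/= ?x0 ?leey// lee_fin expR_ge0.
have i0 : 0 <= (a ^+ 2)^-1%:E by rewrite lee_fin invr_ge0 ltW.
move=> /(lee_wpmul2l i0); apply: le_trans.
by rewrite -EFinM lee_fin mulrN mulKf// lt0r_neq0.
Qed.

Lemma le_oppe_of_lt (x c : \bar R) : 0 <= c ->
  (forall l : R, l%:E < c -> x <= (- l)%:E) -> x <= - c.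
Proof.
move=> c0 H; case: c c0 H => [r| |] // r0 H.
  apply/lee_addgt0Pr => e e0.
  apply: (le_trans (H (r - e)%R _)); first by rewrite lte_fin gtrBl.
  by rewrite -EFinN -EFinD lee_fin opprB addrC.
rewrite /= leeNy_eq; apply/eqP; case: x H => [x| |] // H.
  by have := H (- x + 1)%R (ltry _); rewrite lee_fin opprD opprK lerDl ler0N1.
by have := H 0%R (ltry _); rewrite leye_eq.
Qed.

End exponential_rates.

Lemma compact_closed_separated (R : realType) (X : metricType R) (A B : set X) :
  compact A -> closed B -> A `&` B = set0 ->
  exists2 e : R, (0 < e) & forall x y, A x -> B y -> ~ ball x e y.
Proof.
move=> /compact_near_coveringP cA clB AB0.
have := cA R (0^'+) (fun e x => forall y, B y -> ~ ball x e y) _.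
case=> [x Ax|e /= e0 H].
  have nBx : nbhs x (~` B).
    apply: open_nbhs_nbhs; split; first exact: closed_openC.
    by move=> Bx; rewrite -[False]/(set0 x) -AB0.
  have /nbhs_ballP[r /= r0 rP] := nBx.
  have r2 : (0 < r / 2) by rewrite divr_gt0.
  exists (ball x (r / 2), [set e | 0 < e < r / 2]) => /=.
    split; first exact: nbhsx_ballx.
    by near=> e => /=; apply/andP; split.
  move=> [x' e]/= [xx' /andP[e0 er]] y By x'y.
  apply: (rP y) => //; rewrite (splitr r); apply: ball_triangle xx' _.
  by apply: le_ball x'y; exact: ltW.
exists (e / 2); first by rewrite divr_gt0.
move=> x y Ax By; apply: (H (e / 2)) => //=.
- by rewrite sub0r normrN gtr0_norm ?divr_gt0// ltr_pdivrMr// ltr_pMr// ltr1n.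
- by rewrite divr_gt0.
Unshelve. all: by end_near.
Qed.

(** * Moderate deviation principle for compact linear images *)

(** [Phi] is a linear map from densities to functions on [X], which is continuous
([Phi_lipschitz]) and compact ([Phi_finite_control]). By [I_lt] and [I_le], [I] is the
infimum of half the squared norm over the centred densities with a given image. *)
Section moderate_deviation_principle.
Context (R : realType) d (T : measurableType d) (mu : probability T R).
Local Notation ip := (ip mu).
Local Notation sqint := (sqint mu).
Context (X : Type) (Phi : (T -> R) -> X -> R) (I : linf R X -> \bar R).
Hypothesis Phi_linear : forall f g (a b : R) t, sqint f -> sqint g ->
  Phi (fun x => a * f x + b * g x) t = a * Phi f t + b * Phi g t.
Context (B : R).
Hypothesis B0 : 0 < B.
Hypothesis Phi_lipschitz : forall f g (e : R) t, sqint f -> sqint g -> 0 <= e ->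
  sqdist mu f g <= e ^+ 2 -> `|Phi f t - Phi g t| <= B * e.
Hypothesis Phi_finite_control : forall C kap : R, 0 <= C -> 0 < kap ->
  exists (N : nat) (S : 'I_N -> set T), (forall j, measurable (S j)) /\
  exists2 eta : R, 0 < eta & forall f g, sqint f -> sqint g ->
    ip f f <= C -> ip g g <= C ->
    (forall j, `|ip f \1_(S j) - ip g \1_(S j)| <= eta) ->
    forall t, `|Phi f t - Phi g t| <= kap.
Hypothesis I_lt : forall (phi : linf R X) (c : R), (I phi < c%:E)%E ->
  exists f, [/\ sqint f, \int[mu]_x f x = 0, ip f f / 2 < c & forall t, Phi f t = phi t].
Hypothesis I_le : forall (phi : linf R X) f, sqint f -> \int[mu]_x f x = 0 ->
  (forall t, Phi f t = phi t) -> (I phi <= (ip f f / 2)%:E)%E.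

Lemma ip_indic_bound f (A : set T) : sqint f -> measurable A -> `|ip f \1_A| <= ip f f + 1.
Proof.
move=> sf mA; have f0 := ip_ge0 mu f.
rewrite -(@ler_pXn2r _ 2)// ?nnegrE ?addr_ge0// real_normK ?num_real//.
apply: (le_trans (cauchy_schwarz sf (sqint_indic mu mA))).
rewrite ip_indic//.
have A1 : fine (mu A) <= 1 by rewrite -lee_fin fineK ?fin_num_measure// probability_le1.
have A0 : 0 <= fine (mu A) by rewrite fine_ge0.
have := sqr_ge0 (ip f f); rewrite (expr2 (_ + _)) expr2; nra.
Qed.

Lemma image_bounded (f : T -> R) : sqint f ->
  (fun t => Phi f t) \in @bounded_funs R X.
Proof.
move=> sf; apply/bounded_funsE; have s0 := sqint_cst mu 0.
have [M M0 HM] : exists2 M : R, 0 <= M & ip (fun x => f x - 0) (fun x => f x - 0) <= M ^+ 2.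
  exists (1 + ip (fun x => f x - 0) (fun x => f x - 0)).
    by rewrite addr_ge0// ip_ge0.
  have := ip_ge0 mu (fun x => f x - 0); move: (ip _ _) => z z0.
  rewrite expr2; nra.
have z0 t : Phi (fun=> 0) t = 0.
  by have := Phi_linear 0 0 t s0 s0; rewrite !mul0r addr0.
exists (B * M) => t.
by have := Phi_lipschitz t sf s0 M0 HM; rewrite z0 subr0.
Qed.

Lemma linf_dist_le (phi psi : linf R X) (e : R) : 0 <= e ->
  (forall t, `|phi t - psi t| <= e) -> `|phi - psi| <= e.
Proof. by move=> e0 h; apply: sup_norm_le. Qed.

Lemma linf_dist_pointwise (phi psi : linf R X) (e : R) t :
  `|phi - psi| <= e -> `|phi t - psi t| <= e.
Proof. by move=> /(le_trans (sup_norm_ub (phi - psi) t)). Qed.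

Lemma ultra_finite_union (F : set_system (linf R X)) (J : finType)
    (A : J -> set (linf R X)) : UltraFilter F -> F (\bigcup_(j in [set: J]) A j) ->
  exists j, F (A j).
Proof.
move=> UF FA; have PF : ProperFilter F by exact: ultra_proper.
apply: contrapT => nA.
have FC : forall j, F (~` A j).
  by move=> j; have [FAj|//] := in_ultra_setVsetC (A j) UF; exfalso; apply: nA; exists j.
have FA2 : F [set x | forall j, (~` A j) x] by exact: filter_forall FC.
have [phi [[j _ Aj] nAj]] := @filter_ex _ F PF _ (@filterI _ F _ _ _ FA FA2).
exact: (nAj j).
Qed.

(** The densities of a level set lie in a ball, where finitely many integrals,
rounded to multiples of [eta], determine the image up to [kap]. An ultrafilter
selects one of these finitely many classes. *)
Lemma ultra_cauchy (F : set_system (linf R X)) (L kap : R) : UltraFilter F ->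
  0 <= L -> F [set phi | (I phi <= L%:E)%E] -> 0 < kap ->
  exists phi, F [set psi | `|psi - phi| <= kap].
Proof.
move=> UF L0 FK kap0; have PF : ProperFilter F by exact: ultra_proper.
have C0 : 0 <= 2 * (L + 1) by rewrite mulr_ge0// addr_ge0.
have [N [S [mS [eta eta0 H]]]] := Phi_finite_control C0 kap0.
have /choice[gam gamP] (phi : linf R X) : exists f, (I phi <= L%:E)%E ->
    [/\ sqint f, ip f f <= 2 * (L + 1) & forall t, Phi f t = phi t].
  have [IL|nIL] := pselect (I phi <= L%:E)%E; last by exists (fun=> 0).
  have IL1 : (I phi < (L + 1)%:E)%E by rewrite (le_lt_trans IL)// lte_fin ltrDl.
  have [f [sf _ fL fphi]] := I_lt IL1; exists f => _; split => //.
  by move: fL; rewrite ltr_pdivrMr// mulrC => /ltW.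
pose M0 := 2 * (L + 1) + 1.
pose m := (Num.truncn (2 * M0 / eta)).+1.
pose val phi j := (ip (gam phi) \1_(S j) + M0) / eta.
pose A (c : {ffun 'I_N -> 'I_m}) := [set phi | (I phi <= L%:E)%E /\
  forall j, Num.truncn (val phi j) = c j].
have vb phi j : (I phi <= L%:E)%E -> 0 <= val phi j <= 2 * M0 / eta.
  move=> /gamP[sf fC _].
  have := le_trans (ip_indic_bound sf (mS j)) (lerD fC (lexx 1)).
  rewrite -/M0 ler_norml => /andP[h1 h2].
  rewrite /val divr_ge0 ?(ltW eta0)//=; last by lra.
  by rewrite ler_wpM2r ?invr_ge0 ?(ltW eta0)//; lra.
have [c Fc] : exists c, F (A c).
  apply: ultra_finite_union; apply: filterS FK => phi /= IL.
  have lm j : (Num.truncn (val phi j) < m)%N.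
    by rewrite ltnS; apply: le_truncn; have /andP[] := vb phi j IL.
  by exists [ffun j => Ordinal (lm j)] => //; split => // j; rewrite ffunE.
have [phi0 [I0 c0]] := @filter_ex _ F PF _ Fc.
exists phi0; apply: filterS Fc => phi [I1 c1] /=.
have [s0 b0 e0] := gamP _ I0; have [s1 b1 e1] := gamP _ I1.
apply: linf_dist_le (ltW kap0) _ => t; rewrite -e0 -e1; apply: H => // j.
have /andP[v0 _] := vb phi0 j I0; have /andP[v1 _] := vb phi j I1.
have /truncn_itv/andP[] := v0; have /truncn_itv/andP[] := v1.
rewrite c0 c1 /val -!natr1 !ler_pdivlMr// !ltr_pdivrMr// => p1 p2 p3 p4.
rewrite ler_norml; apply/andP; split; lra.
Qed.

(** An ultrafilter on the level set has approximate limits [phi k] by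
[ultra_cauchy]. The centred densities of squared norm almost at most [2 * L] whose
images are close to the first [k] approximate limits form decreasing convex sets. The limit
[g] given by [minimal_norm_limit] inherits their constraints, so its image is in the
level set and is the limit of the ultrafilter. *)
Lemma compact_level_set (L : R) : 0 <= L -> compact [set phi | (I phi <= L%:E)%E].
Proof.
move=> L0; rewrite compact_ultra => F UF FK.
have PF : ProperFilter F by exact: ultra_proper.
pose rad k : R := k.+1%:R^-1.
have rad0 k : 0 < rad k by rewrite /rad invr_gt0.
have /choice[phi phiP] k := ultra_cauchy UF L0 FK (rad0 k).
(* Norms are allowed to exceed the level by rad k, because the infimum defining I need not
   be attained. *)
pose Gam k := [set f | [/\ sqint f, \int[mu]_x f x = 0, ip f f <= 2 * (L + rad k) &
  forall i, (i <= k)%N -> forall t, `|Phi f t - phi i t| <= rad i]].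
have rad_mono k l : (k <= l)%N -> rad l <= rad k.
  by move=> kl; rewrite /rad lef_pV2 ?posrE// ler_nat ltnS.
have rad1 k : rad k <= 1 by rewrite /rad invf_le1// ler1n.
have [g sg gP] : exists2 g, sqint g & forall e : R, 0 < e -> exists N, forall k, (N <= k)%N ->
    exists2 f, Gam k f & sqdist mu f g <= e.
  apply: (@minimal_norm_limit _ _ _ mu Gam (2 * (L + 1))).
  - by move=> k f [].
  - move=> k l kl f [sf f0 fL fphi]; split => //.
      by apply: le_trans fL _; rewrite ler_wpM2l// lerD2l rad_mono.
    by move=> i ik; apply: fphi; exact: leq_trans kl.
  - move=> k f g [sf f0 fL fphi] [sg g0 gL gphi]; split.
    + exact: sqint_midpoint.
    + rewrite -ip1 /midpoint ip_linl//; last exact: sqint_cst.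
      by rewrite !ip1 f0 g0 !mulr0 addr0.
    + exact: ip_midpoint_le.
    + move=> i ik t; rewrite /midpoint Phi_linear//.
      have := fphi i ik t; have := gphi i ik t.
      rewrite !ler_norml => /andP[h1 h2] /andP[h3 h4]; apply/andP; split; lra.
  - move=> k.
    have Fk : F [set psi | forall i : 'I_k.+1, `|psi - phi i| <= rad i].
      by apply: (@filter_forall _ _ (fun i : 'I_k.+1 => [set psi | `|psi - phi i| <= rad i])) => i;
        exact: phiP.
    have [psi [Ipsi near_psi]] := @filter_ex _ F PF _ (@filterI _ F _ _ _ FK Fk).
    have IL1 : (I psi < (L + rad k)%:E)%E by rewrite (le_lt_trans Ipsi)// lte_fin ltrDl.
    have [f [sf f0 fL fpsi]] := I_lt IL1.
    have fL' : ip f f <= 2 * (L + rad k) by move: fL; rewrite ltr_pdivrMr// mulrC => /ltW.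
    exists f; last by rewrite (le_trans fL')// ler_wpM2l// lerD2l.
    split => // i ik t; rewrite fpsi; apply: linf_dist_pointwise.
    exact: (near_psi (Ordinal (ik : (i < k.+1)%N))).
have close (e : R) k : 0 < e -> exists2 f, Gam k f & sqdist mu f g <= e ^+ 2.
  move=> e0; have [N NP] := gP _ (exprn_gt0 2 e0).
  have [f [sf f0 fL fphi] fg] := NP _ (leq_maxl N k); exists f => //; split => //.
    by apply: le_trans fL _; rewrite ler_wpM2l// lerD2l rad_mono// leq_maxr.
  by move=> i ik; apply: fphi; rewrite (leq_trans ik) ?leq_maxr.
have g0 : \int[mu]_x g x = 0.
  apply/eqP; rewrite -normr_le0; apply/ler_addgt0Pl => e e0; rewrite addr0.
  have [f [sf f0 _ _] fg] := close e 0%N e0.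
  rewrite -(@ler_pXn2r _ 2)// ?nnegrE ?(ltW e0)//; apply: le_trans fg.
  have sfg := sqintB sf sg.
  have := cauchy_schwarz sfg (sqint_cst mu 1).
  rewrite ip1 RintegralB//; [|exact: sqint_integrable|exact: sqint_integrable].
  rewrite f0 sub0r sqrrN real_normK ?num_real//.
  have -> : ip (fun=> 1) (fun=> 1) = 1.
    transitivity (1 * 1 * fine (mu setT)); first exact: Rintegral_cst.
    by rewrite probability_setT/= !mulr1.
  by rewrite mulr1.
have gL : ip g g <= 2 * L.
  apply/ler_addgt0Pl => e e0.
  (* The cross term is controlled by the Cauchy-Schwarz inequality once the distance of g
     to the approximating sets is small compared with e and with the norms. *)
  pose D := 2 * (L + 1) + 1.
  have D1 : 1 <= D by rewrite lerDr mulr_ge0// addr_ge0.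
  have D0 : 0 < D := lt_le_trans ltr01 D1.
  pose z := Num.min 1 (e / (8 * D)).
  have z0 : 0 < z by rewrite lt_min ltr01 divr_gt0// mulr_gt0.
  have z1 : z <= 1 by rewrite ge_min lexx.
  have zD : z * D <= e / 8.
    have : z <= e / (8 * D) by rewrite ge_min lexx orbT.
    by rewrite ler_pdivlMr ?mulr_gt0// => h; lra.
  pose k := Num.truncn (8 / e).
  have kP : rad k <= e / 8.
    have p : 0 <= 8 / e by rewrite divr_ge0// ltW.
    have /truncn_itv/andP[_ h] := p.
    rewrite /rad -[leRHS]invrK lef_pV2 ?posrE ?invr_gt0 ?divr_gt0// invf_div.
    exact: ltW.
  have [f [sf f0 fL _] fg] := close _ k z0.
  have sfg := sqintB sf sg.
  have E := ipB_sqr sf sfg.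
  have gE : ip (fun x => f x - (f x - g x)) (fun x => f x - (f x - g x)) = ip g g.
    by apply: eq_Rintegral => x _; ring.
  rewrite gE in E.
  have cs := cauchy_schwarz sf sfg.
  have f0' := ip_ge0 mu f; have d0 := ip_ge0 mu (fun x => f x - g x).
  have fD : ip f f <= D.
    by rewrite (le_trans fL)// /D; have := rad1 k; lra.
  have cross : `|ip f (fun x => f x - g x)| <= z * D.
    have zD0 : 0 <= z * D by rewrite mulr_ge0 ?ltW.
    rewrite -(@ler_pXn2r _ 2)// ?nnegrE// real_normK ?num_real//.
    apply: (le_trans cs); rewrite exprMn mulrC.
    apply: ler_pM => //; apply: (le_trans fD).
    by rewrite expr2 ler_peMr// ltW.
  move: cross; rewrite ler_norml => /andP[x1 _].
  have z2 : z ^+ 2 <= z * D by rewrite expr2 ler_wpM2l ?(ltW z0)// (le_trans z1).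
  rewrite E; have := kP; lra.
pose psi : linf R X := Linf (image_bounded sg).
have psi_near i t : `|Phi g t - phi i t| <= rad i.
  apply/ler_addgt0Pl => e e0.
  have eB : 0 < e / B by rewrite divr_gt0.
  have [f [sf _ _ fphi] fg] := close _ i eB.
  have h1 := fphi i (leqnn i) t.
  have := Phi_lipschitz t sf sg (ltW eB) fg.
  rewrite mulrCA divff ?lt0r_neq0// mulr1 => h2.
  apply: (le_trans (ler_distD (Phi f t) _ _)).
  by rewrite lerD// distrC.
exists psi; split.
  rewrite /=; apply: le_trans (I_le sg g0 _) _ => //.
  by rewrite lee_fin ler_pdivrMr// mulrC.
move=> A /nbhs_ballP[e /= e0 eA].
pose k := Num.truncn (2 / e).
have kP : rad k < e / 2.
  have p : 0 <= 2 / e by rewrite divr_ge0// ltW.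
  have /truncn_itv/andP[_ h] := p.
  rewrite /rad -[ltRHS]invrK ltf_pV2 ?posrE ?invr_gt0 ?divr_gt0// invf_div.
  exact: h.
apply: filterS (phiP k) => f /= fk; apply: eA.
rewrite -ball_normE /=.
have pk : `|psi - phi k| <= rad k by apply: linf_dist_le; [exact: ltW|exact: psi_near].
apply: le_lt_trans (ler_distD (phi k) psi f) _; rewrite (splitr e).
by apply: ler_ltD; [exact: le_trans pk (ltW kP)|rewrite distrC (le_lt_trans fk)].
Qed.

Context d' (Om : measurableType d') (P : probability Om R) (Z : nat -> Om -> T).
Hypothesis mZ : forall i, measurable_fun setT (Z i).
Hypothesis iidZ : iid_with_law P Z mu.
Local Notation dev := (dev mu Z).
Context (a : nat -> R).
Hypothesis a_gt0 : forall n, (0 < n)%N -> 0 < a n.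
Hypothesis a_infty : a n @[n --> \oo] --> +oo.
Hypothesis a_sqrt : a n / Num.sqrt n%:R @[n --> \oo] --> (0 : R).
Hypothesis I_ge0 : forall phi, (0 <= I phi)%E.
Context (W : nat -> Om -> linf R X).
Hypothesis W_near : forall M C kap : R, 0 <= M -> 0 <= C -> 0 < kap ->
  exists (N : nat) (S : 'I_N -> set T), (forall j, measurable (S j)) /\
  exists2 eta : R, 0 < eta & exists2 Mb : R, 0 < Mb & \forall n \near \oo,
    holds_but P (expR (- (a n ^+ 2 * M))) (fun w =>
      (forall j, `|dev (a n) n w (S j)| <= Mb) /\
      forall gam, sqint gam -> ip gam gam <= C ->
        (forall j, `|dev (a n) n w (S j) - ip gam \1_(S j)| <= eta) ->
        forall t, `|W n w t - Phi gam t| <= kap).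

Let a_near : \forall n \near \oo, 0 < a n.
Proof. by exists 1%N => // n /= n0; exact: a_gt0. Qed.

(** If [W n w] is in [K], the deviations cannot match a density of squared norm
at most [2 * l], whose image is at a positive distance from [K];
[deviations_upper] makes this event rare. *)
Lemma limsup_bound (K : set (linf R X)) (l : R) : closed K -> 0 <= l ->
  (forall phi, K phi -> (l%:E < I phi)%E) -> forall eta : R, 0 < eta ->
  (limn_esup (fun n => ((a n ^+ 2)^-1)%:E * lne (outer_prob P (W n @^-1` K)))
    <= (- l + eta)%:E)%E.
Proof.
move=> clK l0 KI eta eta0.
have cK := compact_level_set l0.
have disj : [set phi | (I phi <= l%:E)%E] `&` K = set0.
  by apply/seteqP; split => // phi [/= Il /KI]; rewrite ltNge Il.
have [kap kap0 sep] := compact_closed_separated cK clK disj.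
have kap20 : 0 < kap / 2 by rewrite divr_gt0.
have C0 : 0 <= 2 * l by rewrite mulr_ge0.
have [N [S [mS [e e0 [Mb Mb0 H1]]]]] := W_near l0 C0 kap20.
have eta20 : 0 < eta / 2 by rewrite divr_gt0.
have H2 := moderately_near a_infty a_sqrt (deviations_upper mZ iidZ mS l0 e0 Mb0 eta20).
have H3 := moderately_near a_infty a_sqrt (moderately_expR 2 eta20).
apply: limn_esup_le_near.
have H4 : \forall n \near \oo, 2 <= expR (a n ^+ 2 * (eta / 2)) /\ 0 < a n.
  by apply: filterS2 H3 a_near => n; split.
move: H1 H2 H4; apply: filterS3 => n [B1 [mB1 PB1 HB1]] [B2 [mB2 PB2 HB2]] [H3n an0].
rewrite (_ : - l + eta = - (l - eta)); last by rewrite opprB addrC.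
apply: rate_upper => //.
  by apply: le_ereal_inf_tmp => _ [D _ <-]; exact: measure_ge0.
apply: (@le_trans _ _ (P (B1 `|` B2))).
  apply: ereal_inf_lbound; exists (B1 `|` B2) => //; split; first exact: measurableU.
  move=> w Ww; apply: contrapT => nB.
  have [devM Hw] : (forall j, `|dev (a n) n w (S j)| <= Mb) /\ forall gam, sqint gam -> ip gam gam <= 2 * l ->
        (forall j, `|dev (a n) n w (S j) - ip gam \1_(S j)| <= e) ->
        forall t, `|W n w t - Phi gam t| <= kap / 2.
    by apply: HB1 => ?; apply: nB; left.
  have [gam [sg g0 gl gdev]] := HB2 w (fun b => nB (or_intror b)) devM.
  have gl2 : ip gam gam <= 2 * l by move: gl; rewrite ler_pdivrMr// mulrC.
  pose psi : linf R X := Linf (image_bounded sg).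
  apply: (sep psi (W n w)) => //=.
    by apply: le_trans (I_le sg g0 _) _ => //; rewrite lee_fin.
  rewrite -ball_normE /=; apply: (@le_lt_trans _ _ (kap / 2)).
    rewrite distrC; apply: linf_dist_le; first exact: ltW.
    exact: Hw.
  by rewrite ltr_pdivrMr// ltr_pMr// ltr1n.
apply: (le_trans (measureU2 _ mB1 mB2)); apply: (le_trans (leeD PB1 PB2)).
rewrite -EFinD lee_fin.
apply: (@le_trans _ _ (2 * expR (- (a n ^+ 2 * (l - eta / 2))))).
  rewrite mulr_natl mulr2n lerD2r ler_expR lerN2 ler_wpM2l ?sqr_ge0//.
  by rewrite gerBl ltW.
have -> : - (a n ^+ 2 * (l - eta)) = a n ^+ 2 * (eta / 2) + - (a n ^+ 2 * (l - eta / 2)).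
  by field.
by rewrite expRD ler_wpM2r ?expR_ge0.
Qed.

(** Some density of cost less than [c] has image [phi]. When the deviations
match it, [W n] is in [U], outside an event of smaller order. *)
Lemma liminf_bound (U : set (linf R X)) (phi : linf R X) (c : R) : open U -> U phi ->
  (I phi < c%:E)%E ->
  ((- c)%:E <= limn_einf (fun n => ((a n ^+ 2)^-1)%:E * lne (inner_prob P (W n @^-1` U))))%E.
Proof.
move=> oU Uphi Ic.
have [gam [sg g0 gc gphi]] := I_lt Ic.
have q0 : 0 <= ip gam gam by exact: ip_ge0.
have c0 : 0 <= c by rewrite (le_trans _ (ltW gc))// divr_ge0.
pose eta := (c - ip gam gam / 2) / 2.
have eta0 : 0 < eta by rewrite divr_gt0// subr_gt0.
have /nbhs_ballP[r /= r0 rU] : nbhs phi U by apply: open_nbhs_nbhs.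
have r20 : 0 < r / 2 by rewrite divr_gt0.
have [N [S [mS [e e0 [Mb Mb0 H1]]]]] := W_near c0 q0 r20.
have H2 := moderately_near a_infty a_sqrt (deviations_lower mZ iidZ mS sg g0 e0 eta0).
have H3 := moderately_near a_infty a_sqrt (moderately_expR 2 eta0).
apply: limn_einf_ge_near.
have H4 : \forall n \near \oo, 2 <= expR (a n ^+ 2 * eta) /\ 0 < a n.
  by apply: filterS2 H3 a_near => n; split.
move: H1 H2 H4; apply: filterS3 => n [B1 [mB1 PB1 HB1]] [B2 [mB2 PB2 HB2]] [H3n an0].
apply: rate_lower => //.
apply: (@le_trans _ _ (P (B2 `\` B1))); last first.
  apply: ereal_sup_ubound; exists (B2 `\` B1) => //; split; first exact: measurableD.
  move=> w [B2w nB1w]; apply: rU; rewrite -ball_normE /=.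
  have [_ Hw] := HB1 w nB1w.
  apply: (@le_lt_trans _ _ (r / 2)).
    apply: linf_dist_le; first exact: ltW.
    by move=> t; rewrite distrC -gphi; apply: Hw => //; exact: HB2.
  by rewrite ltr_pdivrMr// ltr_pMr// ltr1n.
have PB21 : (P B2 <= P (B2 `\` B1) + P B1)%E.
  apply: (le_trans _ (measureU2 _ (measurableD mB2 mB1) mB1)).
  apply: le_measure; rewrite ?inE//.
    by apply: measurableU => //; exact: measurableD.
  by move=> w B2w; have [?|?] := pselect (B1 w); [right|left; split].
have fB : P (B2 `\` B1) \is a fin_num by apply: fin_num_measure; exact: measurableD.
rewrite -(fineK fB) lee_fin.
have := le_trans PB2 (le_trans PB21 (leeD (lexx _) PB1)).
rewrite -(fineK fB) -EFinD lee_fin.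
have -> : - (a n ^+ 2 * (ip gam gam / 2 + eta)) = a n ^+ 2 * eta + - (a n ^+ 2 * c).
  by rewrite /eta; field.
rewrite expRD => h1.
have := ler_wpM2r (expR_ge0 (- (a n ^+ 2 * c))) H3n; lra.
Qed.

Lemma moderate_deviation_LDP (F : set (set (linf R X))) :
  LDP P F W (fun n => a n ^+ 2) I.
Proof.
split.
- split; first exact: I_ge0.
  move=> L; have [L0|L0] := leP 0 L.
    have cK := compact_level_set L0.
    exact: cK.
  rewrite (_ : mkset _ = set0); first exact: compact0.
  apply/seteqP; split => // phi /= /(le_trans (I_ge0 phi)).
  by rewrite lee_fin leNgt L0.
- move=> U oU _; rewrite leeNl; apply: le_ereal_inf_tmp => _ [phi Uphi <-].
  rewrite leeNl; have := I_ge0 phi; case EI : (I phi) => [r| |] // r0.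
    rewrite -leeN2 oppeK; apply/lee_addgt0Pr => e e0.
    rewrite -leeN2 oppeK -EFinD -EFinN; apply: (liminf_bound oU Uphi).
    by rewrite EI lte_fin ltrDl.
  by rewrite leNye.
- move=> K clK _; apply: le_oppe_of_lt.
    by apply: le_ereal_inf_tmp => _ [phi _ <-]; exact: I_ge0.
  move=> l lI.
  have KI l' : (l' <= l)%R -> forall phi, K phi -> (l'%:E < I phi)%E.
    move=> l'l phi Kphi; apply: (@le_lt_trans _ _ l%:E); first by rewrite lee_fin.
    by apply: (lt_le_trans lI); apply: ereal_inf_lbound; exists phi.
  have [l0|l0] := leP 0 l.
    apply/lee_addgt0Pr => e e0; rewrite -EFinD.
    by apply: limsup_bound => //; exact: KI.
  apply: limn_esup_le_near; move: a_near; apply: filterS => n an0.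
  apply: (@le_trans _ _ (- 0)%:E); last by rewrite lee_fin lerN2 ltW.
  apply: rate_upper => //.
    by apply: le_ereal_inf_tmp => _ [D _ <-]; exact: measure_ge0.
  rewrite mulr0 oppr0 expR0; apply: (@le_trans _ _ (P setT)).
    by apply: ereal_inf_lbound; exists setT.
  exact: probability_le1.
Qed.

End moderate_deviation_principle.

(** * Rate function of the empirical copula *)

Lemma linear_combination3 (R : realType) (b c d1 d2 f g x0 x1 x2 y0 y1 y2 : R) :
  b * x0 + c * y0 - d1 * ((b * x1 + c * y1) / f) - d2 * ((b * x2 + c * y2) / g) =
  b * (x0 - d1 * (x1 / f) - d2 * (x2 / g)) + c * (y0 - d1 * (y1 / f) - d2 * (y2 / g)).
Proof. ring. Qed.

Section rate_function.
Context (R : realType) (mu : probability (R * R)%type R) (p q : R).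
Local Notation ip := (ip mu).
Local Notation sqint := (sqint mu).
Local Notation H := (joint_cdf mu).
Implicit Types (gam : R * R -> R) (phi : linf R (square p q)).

Definition density_image gam (uv : square p q) : R := Phi_density mu gam
  (quantile (marginal1 H) (val uv).1) (quantile (marginal2 H) (val uv).2).

Lemma measurable_quadrant (s t : R) : measurable (quadrant s t).
Proof. by rewrite -orthant0; exact: measurable_orthant. Qed.

Lemma is_density_ip gam : sqint gam -> \int[mu]_z gam z = 0 ->
  is_density mu (fun s t => ip gam \1_(quadrant s t)) gam.
Proof.
move=> sg g0; have [mg _] := sg; have ig := sqint_integrable sg.
split => // [|s t].
  by rewrite -(fineK (integrable_fin_num measurableT ig)) -[fine _]/(\int[mu]_z gam z) g0.
have mQ := measurable_quadrant s t.
rewrite -Rintegral_indic// /Rintegral fineK//.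
apply: integrable_fin_num => //; exact: integrableS ig.
Qed.

(** A finite cost forces square integrability, and [alpha] is then the
primitive of [gam]. *)
Lemma density_sqint alpha gam : is_density mu alpha gam ->
  (\int[mu]_z ((gam z) ^+ 2)%:E < +oo)%E ->
  [/\ sqint gam, \int[mu]_z gam z = 0 & alpha = fun s t => ip gam \1_(quadrant s t)].
Proof.
move=> [mg ig g0 gal] fin; split.
- split => //; apply/integrableP; split.
    by apply/measurable_EFinP; exact: measurable_funX.
  by under eq_integral do rewrite abse_EFin ger0_norm ?sqr_ge0//.
- by rewrite /Rintegral g0.
- apply/funext => s; apply/funext => t.
  by rewrite -Rintegral_indic ?/Rintegral -?gal//; exact: measurable_quadrant.
Qed.

Lemma I_C_ge0 phi : (0 <= I_C mu phi)%E.
Proof.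
apply: le_ereal_inf_tmp => _ [alpha _ <-]; apply: le_ereal_inf_tmp => _ [gam _ <-].
by rewrite mule_ge0// integral_ge0// => z _; rewrite lee_fin sqr_ge0.
Qed.

Lemma I_C_lt phi (c : R) : (I_C mu phi < c%:E)%E ->
  exists gam, [/\ sqint gam, \int[mu]_z gam z = 0, ip gam gam / 2 < c &
                  forall uv, density_image gam uv = phi uv].
Proof.
move=> /ereal_inf_lt[_ [alpha /= al <-]] /ereal_inf_lt[_ [gam /= dg <-]] lec.
have fin : (\int[mu]_z ((gam z) ^+ 2)%:E < +oo)%E.
  rewrite ltNge leye_eq; apply/eqP => E; move: lec.
  by rewrite E gt0_muley// lte_fin invr_gt0.
have [sg g0 alE] := density_sqint dg fin.
exists gam; split => //.
  by move: lec; rewrite sqint_ipE// -EFinM lte_fin mulrC.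
by move=> uv; rewrite -al alE Phi'_Phi_density.
Qed.

Lemma I_C_le phi gam : sqint gam -> \int[mu]_z gam z = 0 ->
  (forall uv, density_image gam uv = phi uv) -> (I_C mu phi <= (ip gam gam / 2)%:E)%E.
Proof.
move=> sg g0 gphi.
apply: (@le_trans _ _ (I_H mu (fun s t => ip gam \1_(quadrant s t)))).
  apply: ereal_inf_lbound; exists (fun s t => ip gam \1_(quadrant s t)) => //= uv.
  by rewrite Phi'_Phi_density// -gphi.
apply: ereal_inf_lbound; exists gam; first exact: is_density_ip.
by rewrite sqint_ipE// -EFinM mulrC.
Qed.

Lemma density_image_linear f g (b c : R) uv : sqint f -> sqint g ->
  density_image (fun z => b * f z + c * g z) uv =
  b * density_image f uv + c * density_image g uv.
Proof.
move=> sf sg; rewrite /density_image /Phi_density /linearized.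
rewrite !ip_linl//; try by apply: sqint_indic; exact: measurable_orthant.
exact: linear_combination3.
Qed.

End rate_function.

Lemma ip_indic_lipschitz (R : realType) d (T : measurableType d) (mu : probability T R)
    (f g : T -> R) (A : set T) (e : R) :
  sqint mu f -> sqint mu g -> measurable A -> 0 <= e ->
  sqdist mu f g <= e ^+ 2 ->
  `|ip mu f \1_A - ip mu g \1_A| <= e.
Proof.
move=> sf sg mA e0 h; have sA := sqint_indic mu mA.
rewrite -ipBl// -(@ler_pXn2r _ 2)// ?nnegrE// real_normK ?num_real//.
apply: (le_trans (cauchy_schwarz (sqintB sf sg) sA)).
apply: le_trans h; rewrite ler_piMr ?ip_ge0// ip_indic//.
by rewrite -lee_fin fineK ?fin_num_measure// probability_le1.
Qed.

Theorem theorem4p6 (R : realType) (d : measure_display) (Om : measurableType d)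
    (P : probability Om R) (mu : probability (R * R)%type R)
    (Z : nat -> {RV P >-> (R * R)%type}) (a : nat -> R) (p q eps : R) :
  let H := joint_cdf mu in
  let F := marginal1 H in
  let G := marginal2 H in
  let A := `[quantile F p - eps, quantile F q + eps]%classic in
  let B := `[quantile G p - eps, quantile G q + eps]%classic in
  (forall n, (0 < n)%N -> 0 < a n) ->
  a n @[n --> \oo] --> +oo ->
  a n / Num.sqrt n%:R @[n --> \oo] --> 0 ->
  iid_with_law P Z mu ->
  0 < p -> p < q -> q < 1 -> 0 < eps ->
  (forall x, A x -> derivable F x 1 /\ 0 < derive1 F x) ->
  {within A, continuous derive1 F} ->
  (forall y, B y -> derivable G y 1 /\ 0 < derive1 G y) ->
  {within B, continuous derive1 G} ->
  (forall x y, A x -> B y ->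
     derivable (fun x' => H x' y) x 1 /\ derivable (fun y' => H x y') y 1) ->
  {within A `*` B, continuous (fun z => partial1 H z.1 z.2)} ->
  {within A `*` B, continuous (fun z => partial2 H z.1 z.2)} ->
  LDP P (@ball_coordinate_sigma_field R (square p q))
    (fun n w => (Num.sqrt n%:R / a n) *:
       (empirical_copula p q n (fun i => Z i w) - true_copula p q mu))
    (fun n => a n ^+ 2)
    (@I_C R mu p q).
Proof.
move=> H F G A B a_gt0 a_infty a_sqrt iidZ p0 pq q1 eps0 dF cF dG cG dH cH1 cH2.
have mZ i : measurable_fun setT (Z i : Om -> R * R) by exact: measurable_funPT.
have dF' x : quantile F p - eps <= x <= quantile F q + eps ->
    derivable F x 1 /\ 0 < derive1 F x.
  by move=> Ax; apply: dF; rewrite /A /= in_itv.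
have dG' y : quantile G p - eps <= y <= quantile G q + eps ->
    derivable G y 1 /\ 0 < derive1 G y.
  by move=> By; apply: dG; rewrite /B /= in_itv.
have dH' x y : quantile F p - eps <= x <= quantile F q + eps ->
    quantile G p - eps <= y <= quantile G q + eps ->
    derivable (fun x' => H x' y) x 1 /\ derivable (fun y' => H x y') y 1.
  by move=> Ax By; apply: dH; rewrite /A /B /= in_itv.
have square_in (uv : square p q) :
    p <= (val uv).1 <= q /\ p <= (val uv).2 <= q.
  by have := set_valP uv; rewrite /square /= !in_itv.
have inA (uv : square p q) :
    quantile F p - eps <= quantile F (val uv).1 <= quantile F q + eps.
  have [/andP[pu uq] _] := square_in uv.
  exact: (window1 p0 q1 eps0 erefl erefl).
have inB (uv : square p q) :
    quantile G p - eps <= quantile G (val uv).2 <= quantile G q + eps.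
  have [_ /andP[pv vq]] := square_in uv.
  exact: (window2 p0 q1 eps0 erefl erefl).
have [b b0 bP] := linearized_lipschitz p0 pq q1 eps0 erefl erefl erefl erefl
  dF' cF dG' cG cH1 cH2.
apply: (moderate_deviation_LDP (Phi := @density_image R mu p q) _ b0 _ _ _ _
  mZ iidZ a_gt0 a_infty a_sqrt).
- by move=> f g c e uv sf sg; exact: density_image_linear.
- move=> f g e uv sf sg e0 h; apply: bP => //;
    by apply: ip_indic_lipschitz => //; exact: measurable_orthant.
- move=> C kap C0 kap0.
  have [N [S [mS [eta eta0 HS]]]] := Phi_grid_control p0 pq q1 eps0
    erefl erefl erefl erefl dF' cF dG' cG cH1 cH2 C0 kap0.
  exists N, S; split => //; exists eta => // f g sf sg fC gC fg uv.
  exact: HS.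
- by move=> phi c; exact: I_C_lt.
- by move=> phi f; exact: I_C_le.
- by move=> phi; exact: I_C_ge0.
- move=> M C kap M0 C0 kap0.
  have [N [S [mS [eta eta0 [Mb Mb0 HS]]]]] := copula_process_near_Phi mZ iidZ p0 pq q1 eps0
    erefl erefl erefl erefl dF' cF dG' cG dH' cH1 cH2 M0 C0 kap0.
  exists N, S; split => //; exists eta => //; exists Mb => //.
  have := moderately_near a_infty a_sqrt HS; apply: filterS => n.
  apply: holds_but_weak => // w [devM close]; split => // gam sg gC gdev uv.
  have [pu pv] := square_in uv.
  exact: close.
Qed.
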